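(* Let $0<m<n$, $s:=n-m$, and let $Z\subseteq\mathbb{P}^n$ be an $m$-dimensional irreducible complex projective variety. Let $z$ be a smooth point of $Z$ and let $L\in\mathbb{G}(s,\mathbb{P}^n)$ be such that $z\in L$. Then $$d_p(L,\Sigma_z(Z))=\sin d_g(L,\Sigma_z(Z))\quad\text{and}\quad \kappa_Z(L,z)=\frac{1}{\sin d_g(L,\Sigma_z(Z))}$$ (where $1/0=\infty$).
   Context: Metrics. $\mathbb{C}^{n+1}$ carries its standard hermitian inner product $\langle\cdot,\cdot\rangle$. The tangent space of $\mathbb{P}^n=\mathbb{P}^n(\mathbb{C})$ at the point represented by $z\in\mathbb{C}^{n+1}\setminus\{0\}$ is modelled as $T_z\mathbb{P}^n=\{\dot z\in\mathbb{C}^{n+1}\mid\langle\dot z,z\rangle=0\}$ with hermitian inner product $\langle\dot u,\dot v\rangle_z=\|z\|^{-2}\langle\dot u,\dot v\rangle$ (Fubini-Study metric). $\mathbb{G}:=\mathbb{G}(s,\mathbb{P}^n)$ is the complex Grassmann manifold of $s$-dimensional projective linear subspaces $L\subseteq\mathbb{P}^n$, identified with the Grassmann manifold $\mathbb{G}(s+1,\mathbb{C}^{n+1})$ of $(s+1)$-dimensional linear subspaces $\widehat L\subseteq\mathbb{C}^{n+1}$ (with $L=\mathbb{P}(\widehat L)$). Its hermitian metric is the unitarily invariant one: identifying $T_L\mathbb{G}$ with $\mathrm{Hom}(\widehat L,\widehat L^\perp)$ and writing linear maps as matrices $R,S$ in orthonormal bases, $\langle R,S\rangle=\mathrm{tr}(RS^*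 )$. Intersection condition number. For a smooth point $z$ of $Z$ and $L\in\mathbb{G}$ with $z\in L$, the intersection is transversal at $z$ if $T_zZ+T_zL=T_z\mathbb{P}^n$. In this case there are open neighborhoods $U$ of $L$ in $\mathbb{G}$ and $V$ of $z$ in $Z$ and a holomorphic map $\gamma\colon U\to V$ (the solution map) with $\tilde L\cap V=\{\gamma(\tilde L)\}$ for all $\tilde L\in U$. One sets $\kappa_Z(L,z):=\|D_L\gamma\|$, the operator norm of $D_L\gamma\colon T_L\mathbb{G}\to T_z\mathbb{P}^n$ with respect to the hermitian norm on $T_L\mathbb{G}$ and the Fubini-Study norm on $T_z\mathbb{P}^n$. If the intersection at $z$ is not transversal, or $z$ is not a smooth point of $Z$, $\kappa_Z(L,z):=\infty$. Local Schubert variety. Let $\mathbb{G}_z:=\{L\in\mathbb{G}\mid z\in L\}$. For a smooth point $z$ of $Z$, $\Sigma_z(Z):=\{L\in\mathbb{G}_z\mid T_zZ\cap T_zL\ne0\}$ (the $L$ through $z$ having a nontransversal intersection with $Z$ at $z$). Distances. The projection distance is $d_p(L_1,L_2):=\|\Pi_{\widehat L_1}-\Pi_{\widehat L_2}\|$ (spectral norm), where $\Pi_W$ denotes orthogonal projection of $\mathbb{C}^{n+1}$ onto $W$. The geodesic distance $d_g(L_1,L_2)$ is the minimum length of curves in $\mathbb{G}$ connecting $L_1$ and $L_2$ with respect to the Riemannian metric given by the real part of the unitarily invariant hermitian metric $\langle R,S\rangle=\mathrm{tr}(RS^* )$ on $T_L\mathbb{G}\simeq\mathrm{Hom}(\widehat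 L,\widehat L^\perp)$; in terms of the principal angles $\theta_1,\theta_2,\dots$ between $\widehat L_1$ and $\widehat L_2$ it equals $\sqrt{\sum_j\theta_j^2}$. Moreover $d_g(L,\Sigma_z(Z)):=\min\{d_g(L,L')\mid L'\in\Sigma_z(Z)\}$, and analogously for $d_p(L,\Sigma_z(Z))$. *)

(* Defs.v *)
From HB Require Import structures.
From mathcomp Require Import all_boot all_order all_algebra.
From mathcomp Require Import all_classical all_reals all_analysis.
From mathcomp Require Import complex sesquilinear spectral.
From mathcomp Require mpoly.

Set Implicit Arguments.
Unset Strict Implicit.
Unset Printing Implicit Defensive.

Import Order.TTheory GRing.Theory Num.Theory.
Import numFieldNormedType.Exports.

Local Open Scope classical_set_scope.
Local Open Scope ring_scope.
Local Open Scope sesquilinear_scope.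

(* Naming the complex field at this structure is what lets matrices over it
   inherit the topology and the normed module structure. *)
Definition Cplx (R : realType) : numClosedFieldType := R[i].

(* A point of P^n is represented by a nonzero row vector, and a subset of P^n
   by the set of all representatives of its points. An s-dimensional
   projective linear subspace P(L) is represented by the (s+1)-dimensional
   vector space L. Matrices act on row vectors from the right. *)

Section Projective.
Context {R : realType} {n : nat}.
Local Notation C := (Cplx R).
Local Notation V := 'rV[C]_n.+1.
Local Notation M := 'M[C]_n.+1.
Local Notation poly := (mpoly.mpoly n.+1 C).

Definition hnorm (v : V) : R := Num.sqrt (complex.Re (dotmx v v)).

Definition frobnorm (A : M) : R :=
  Num.sqrt (complex.Re (\tr (A *m A ^t* ))).

Definition specnorm (A : M) : R :=
  sup [set hnorm (v *m A) | v in [set v : V | hnorm v <= 1]].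

Definition orthoproj (L : {vspace V}) : M :=
  proj_ortho (\matrix_(i < \dim L) (vbasis L)`_i).

Local Notation total_degree := (mpoly.mpoly_mdeg__canonical__mpoly_Measure n.+1).

Definition homogeneous (f : poly) : Prop := f \is mpoly.ishomog total_degree.

Definition eval (f : poly) (x : V) : C := mpoly.meval (x 0) f.

Definition zero_locus (S : set poly) : set V :=
  [set x | x != 0 /\ forall f, S f -> eval f x = 0].

Definition proj_closed (X : set V) : Prop :=
  exists S : set poly, S `<=` homogeneous /\ X = zero_locus S.

Definition proj_variety (X : set V) : Prop :=
  [/\ proj_closed X, X !=set0 &
      forall Y1 Y2, proj_closed Y1 -> proj_closed Y2 ->
        X `<=` Y1 `|` Y2 -> X `<=` Y1 \/ X `<=` Y2].

Definition has_chain (X : set V) (k : nat) : Prop :=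
  exists W : nat -> set V,
    [/\ forall i, (i <= k)%N -> proj_variety (W i),
        forall i, (i < k)%N -> W i `<` W i.+1 & W k `<=` X].

Definition proj_dim (X : set V) (k : nat) : Prop :=
  has_chain X k /\ ~ has_chain X k.+1.

Definition vanishing_ideal (X : set V) : set poly :=
  [set f | homogeneous f /\ forall x, X x -> eval f x = 0].

(* The projective Zariski tangent space, in the model z^perp of T_z P^n. *)
Definition tangent_space (X : set V) (z : V) : set V :=
  [set w | dotmx w z = 0 /\
     forall f, vanishing_ideal X f ->
       \sum_i eval (mpoly.mderiv i f) z * w 0 i = 0].

Definition smooth_point (X : set V) (z : V) : Prop :=
  X z /\ exists (k : nat) (T : {vspace V}),
    [/\ proj_dim X k, \dim T = k & forall w, w \in T <-> tangent_space X z w].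

Definition tangent_linear (L : {vspace V}) (z : V) : set V :=
  [set w | w \in L /\ dotmx w z = 0].

Definition transversal (X : set V) (L : {vspace V}) (z : V) : Prop :=
  forall w, dotmx w z = 0 ->
    exists u v, [/\ tangent_space X z u, tangent_linear L z v & w = u + v].

Definition schubert (s : nat) (X : set V) (z : V) : set {vspace V} :=
  [set L | [/\ \dim L = s.+1, z \in L &
    exists w, [/\ w != 0, tangent_space X z w & tangent_linear L z w]]].

(* Hom(L, L^perp): maps vanishing on L^perp with image in L^perp. *)
Definition hom_perp (L : {vspace V}) : set M :=
  [set A | orthoproj L *m A = A /\ A *m orthoproj L = 0].

Definition to_hom_perp (L : {vspace V}) (A : M) : M :=
  orthoproj L *m A *m (1%:M - orthoproj L).

(* For A in [hom_perp L] this is the graph of A, the point of coordinate A in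
   the standard holomorphic chart of the Grassmannian centered at L; this chart
   realizes the identification of the tangent space at L with Hom(L, L^perp). *)
Definition graph (L : {vspace V}) (A : M) : {vspace V} :=
  (linfun (mulmxr (1%:M + A) : V -> V) @: L)%VS.

Definition chart (L : {vspace V}) (A : M) : {vspace V} :=
  graph L (to_hom_perp L A).

Definition grass_open (U : set {vspace V}) : Prop :=
  forall L, U L -> \forall A \near (0 : M), U (chart L A).

Definition open_in (X W : set V) : Prop :=
  exists O : set V,
    [/\ open O, forall (a : C) v, a != 0 -> O v -> O (a *: v) & W = X `&` O].

(* [g] is a lift to V \ {0} of a map from an open set of the Grassmannian to
   P^n; differentiability is over the complex numbers. *)
Definition holomorphic_on (U : set {vspace V}) (g : {vspace V} -> V) : Prop :=
  forall L, U L -> differentiable (g \o chart L) (0 : M).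

(* Locally at L, a holomorphic map to P^n sending L to z has a holomorphic lift
   sending L to the chosen representative z. *)
Definition solution_map (X : set V) (L : {vspace V}) (z : V)
    (g : {vspace V} -> V) : Prop :=
  g L = z /\ exists (U : set {vspace V}) (W : set V),
    [/\ grass_open U /\ U `<=` [set L' | \dim L' = \dim L], U L,
        open_in X W /\ W z, holomorphic_on U g &
        forall L', U L' -> forall w,
          (W w /\ w \in L') <-> exists2 a : C, a != 0 & w = a *: g L'].

(* The derivative of a lift, projected to the tangent space z^perp of P^n. *)
Definition Dsolution (L : {vspace V}) (z : V) (g : {vspace V} -> V) (A : M) : V :=
  'd (g \o chart L) (0 : M) A *m (1%:M - orthoproj <[z]>%VS).

(* The derivative does not depend on the solution map that is picked, since two
   normalized lifts agree near L up to a nonvanishing scalar function equal to 1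
   at L. *)
Definition kappa (X : set V) (L : {vspace V}) (z : V) : \bar R :=
  if `[< smooth_point X z /\ transversal X L z >] then
    let g := xget (fun=> 0) (solution_map X L z) in
    ereal_sup [set (hnorm (Dsolution L z g A) / hnorm z)%:E
              | A in [set A | hom_perp L A /\ frobnorm A <= 1]]
  else +oo%E.

Definition dproj (L1 L2 : {vspace V}) : R :=
  specnorm (orthoproj L1 - orthoproj L2).

(* [A] is the velocity at t of the curve c, read in the chart centered at c t. *)
Definition has_velocity (c : R -> {vspace V}) (t : R) (A : M) : Prop :=
  exists F : R -> M,
    (\forall h \near (0 : R),
       hom_perp (c t) (F h) /\ c (t + h) = graph (c t) (F h)) /\
    ((h^-1)%:C%C : C) *: F h @[h --> (0 : R)^'] --> A.

Definition curve_length (v : R -> M) : R :=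
  (\int[lebesgue_measure]_(t in `[0, 1]) frobnorm (v t))%R.

Definition C1_curve (c : R -> {vspace V}) (v : R -> M) : Prop :=
  (forall t, 0 <= t <= 1 -> has_velocity c t (v t)) /\
  {within `[0, 1], continuous v}.

Definition dgeo (L1 L2 : {vspace V}) : R :=
  inf [set l | exists (c : R -> {vspace V}) (v : R -> M),
    [/\ C1_curve c v, c 0 = L1, c 1 = L2 & l = curve_length v]].

(* The infimum is a minimum for the compact sets considered here. *)
Definition dist_to (d : {vspace V} -> {vspace V} -> R)
    (L : {vspace V}) (S : set {vspace V}) : R :=
  inf [set d L L' | L' in S].

End Projective.

(* Main.v *)
Require Import Defs.
From HB Require Import structures.
From mathcomp Require Import all_boot all_order all_algebra.
From mathcomp Require Import all_classical all_reals all_analysis.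
From mathcomp Require Import complex sesquilinear spectral.
From mathcomp Require Import zify ring lra.
From mathcomp Require mpoly.

(** Let P be the orthogonal projection onto L and T the tangent space of Z at z,
    an m-dimensional subspace of the orthogonal complement of z. All three
    quantities are functions of one number, [gap L T]: the infimum of
    |u (1 - P)| over the unit vectors u of T, that is, the sine of the smallest
    angle between T and L. The condition number is the inverse of the gap,
    the projection distance to the local Schubert variety is the gap, and the
    geodesic distance is its arcsine.

    Projection distance. If L' lies in the Schubert variety then it contains a
    unit vector w of T, and |w (P' - P)| = |w (1 - P)| is at least the gap
    ([gap_le_dproj]). Conversely, a unit vector u of T is cos(th) a + sin(th) b
    with a in L and b orthogonal to L; both are orthogonal to z, so rotating L
    by th in the plane of a and b keeps z, puts u into the rotated space, and
    moves the projection by sin(th) = |u (1 - P)| only ([schubert_rotation]).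

    Geodesic distance. The rotation above, run at constant speed, is a curve of
    length th. For the other inequality follow a unit vector w of T that lies in
    the end point L' of a curve: the squared length f of its projection to the
    moving space goes from |w P|^2 to 1, and |f'| <= 2 |v| sqrt(f (1 - f)) for
    the velocity v. The angle acos(2 f - 1) therefore changes at most twice as
    fast as the length grows ([angle_comparison], [length_lower]). Infima of
    lengths are meaningful because spaces of equal dimension are joined by some
    curve ([connecting_curve]).

    Condition number. Differentiating the two conditions on a solution map, that
    it takes values in Z and that its value at L' lies in L', shows that the
    image u of a tangent vector A lies in T and satisfies u (1 - P) = z A
    ([solution_derivative]). If T and L meet only in 0 this determines u,
    whence |u| <= |z| |A| / gap, and rank one maps A show that no smaller
    constant will do ([kappa_transversal]). If T and L have a common line, the
    intersection is not transversal, L is in its own Schubert variety, and both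
    sides are infinite.

    What makes this long is that a solution map must exist, since the condition
    number is defined from one: near z the variety has to be the zero set of
    c = n - m of its equations F with independent differentials, although its
    dimension is only known through chains of subvarieties. The route is as
    follows. A chain of length m forces m + 1 algebraically independent
    coordinates modulo the ideal of Z, by counting independent polynomials
    in boxes of bounded degree ([chain_growth], [transcendence_ge]). Hence the
    tangent space of the cone over Z has dimension at least m + 1 at a generic
    point ([generic_tangent]); at z it is m + 1 exactly, and Cramer's rule gives
    d df = sum l_i dF_i + sum l'_j E_j with d(z) <> 0 for every f in the ideal,
    where the E_j are complementary linear forms. At generic points the common
    kernel of the dF_i is tangent, so the l'_j vanish there and thus belong to
    the ideal ([conormal_generators]). Along a path of zeros of F starting at z,
    the values of finitely many generators of the ideal ([hilbert_basis]) then
    satisfy a linear differential inequality, and a discrete Gronwall argument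
    shows that they stay zero ([locus_in_ideal]). Once Z is locally the zero set
    of F, Newton's method with parameters ([solve_system]) solves for the
    intersection point as a function of the coordinates of the subspace
    ([exists_solution_map]). *)

Set Implicit Arguments.
Unset Strict Implicit.
Unset Printing Implicit Defensive.

Import Order.TTheory GRing.Theory Num.Theory.
Import numFieldNormedType.Exports.
Import (canonicals, coercions) mpoly.

Local Open Scope classical_set_scope.
Local Open Scope ring_scope.
Local Open Scope sesquilinear_scope.

(** * Growth of prime ideals and transcendence degree *)

Section PrimeIdeals.
Context {k : fieldType} {A : comNzRingType} (cst : {rmorphism k -> A}).
Variable x : nat -> A.

Definition ideal (S I : A -> Prop) : Prop :=
  [/\ I 0, forall f g, I f -> I g -> I (f + g) &
      forall f g, S f -> I g -> I (f * g)].

Definition prime_ideal (I : A -> Prop) : Prop :=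
  [/\ ideal (fun=> True) I, ~ I 1 & forall f g, I (f * g) -> I f \/ I g].

(** Elements of degree at most d in each of x_0, ..., x_(j-1). Bounding the
    degree in every variable separately, rather than the total degree, makes
    the induction on the number of variables immediate. *)
Fixpoint boxdeg (j d : nat) (f : A) : Prop :=
  if j is j'.+1 then
    exists p : {poly A}, [/\ (size p <= d.+1)%N,
      forall i, boxdeg j' d p`_i & f = p.[x j']]
  else exists c, f = cst c.

Lemma boxdeg_cst j d c : boxdeg j d (cst c).
Proof.
elim: j c => [|j IH] c /=; first by exists c.
exists (cst c)%:P; split; first by apply: leq_trans (size_polyC_leq1 _) _.
  by move=> i; rewrite coefC; case: eqP => // _; rewrite -(rmorph0 cst).
by rewrite hornerC.
Qed.

Lemma boxdeg0 j d : boxdeg j d 0.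
Proof. by rewrite -(rmorph0 cst); apply: boxdeg_cst. Qed.

Lemma boxdeg1 j d : boxdeg j d 1.
Proof. by rewrite -(rmorph1 cst); apply: boxdeg_cst. Qed.

Lemma boxdeg_mono j d e f : (d <= e)%N -> boxdeg j d f -> boxdeg j e f.
Proof.
move=> de; elim: j f => [//|j IH] f /= [p [sp cp ->]].
by exists p; split=> // [|i]; [apply: leq_trans sp _|apply: IH].
Qed.

Lemma boxdegD j d f g : boxdeg j d f -> boxdeg j d g -> boxdeg j d (f + g).
Proof.
elim: j f g => [|j IH] f g /=.
  by move=> [c ->] [c' ->]; exists (c + c'); rewrite rmorphD.
move=> [p [sp cp ->]] [q [sq cq ->]]; exists (p + q); split.
- by apply: leq_trans (size_polyD _ _) _; rewrite geq_max sp sq.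
- by move=> i; rewrite coefD; apply: IH.
- by rewrite hornerD.
Qed.

Lemma boxdeg_sum (T : Type) (s : seq T) (P : pred T) j d (f : T -> A) :
  (forall i, boxdeg j d (f i)) -> boxdeg j d (\sum_(i <- s | P i) f i).
Proof. by move=> H; elim/big_ind: _ => // [|? ?]; [apply: boxdeg0|apply: boxdegD]. Qed.

Lemma boxdegM j d e f g :
  boxdeg j d f -> boxdeg j e g -> boxdeg j (d + e) (f * g).
Proof.
elim: j f g => [|j IH] f g /=.
  by move=> [c ->] [c' ->]; exists (c * c'); rewrite rmorphM.
move=> [p [sp cp ->]] [q [sq cq ->]]; exists (p * q); split.
- apply: leq_trans (size_polyMleq _ _) _.
  by rewrite -subn1 leq_subLR add1n -addnS -addSn leq_add.
- by move=> i; rewrite coefM; apply: boxdeg_sum => l; apply: IH.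
- by rewrite hornerM.
Qed.

Lemma boxdegN j d f : boxdeg j d f -> boxdeg j d (- f).
Proof.
move=> Hf; rewrite -mulN1r -(rmorph1 cst) -rmorphN -[d]add0n.
by apply: boxdegM => //; apply: boxdeg_cst.
Qed.

Lemma boxdegXn j d f m : boxdeg j d f -> boxdeg j (m * d) (f ^+ m).
Proof.
move=> Hf; elim: m => [|m IH]; first by rewrite expr0; apply: boxdeg1.
by rewrite exprS mulSn; apply: boxdegM.
Qed.

Lemma boxdeg_widen j d f : boxdeg j d f -> boxdeg j.+1 d f.
Proof.
move=> Hf; exists f%:P; split; first by apply: leq_trans (size_polyC_leq1 _) _.
  by move=> i; rewrite coefC; case: eqP => // _; apply: boxdeg0.
by rewrite hornerC.
Qed.

Lemma boxdeg_widen_le j l d f : (j <= l)%N -> boxdeg j d f -> boxdeg l d f.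
Proof.
by move=> /subnK <-; elim: (_ - _)%N => // m IH /IH; rewrite addSn; apply: boxdeg_widen.
Qed.

Lemma boxdeg_var j : boxdeg j.+1 1 (x j).
Proof.
exists 'X; split; first by rewrite size_polyX.
  by move=> i; rewrite coefX -(rmorph_nat cst); apply: boxdeg_cst.
by rewrite hornerX.
Qed.

Definition polysub j (f : A) : Prop := exists d, boxdeg j d f.
Definition coefsub j (p : {poly A}) : Prop := exists d, forall i, boxdeg j d p`_i.

Lemma polysubD j f g : polysub j f -> polysub j g -> polysub j (f + g).
Proof.
move=> [d Hf] [e Hg]; exists (d + e)%N.
by apply: boxdegD; [apply: boxdeg_mono Hf|apply: boxdeg_mono Hg];
  rewrite ?leq_addr ?leq_addl.
Qed.

Lemma polysubM j f g : polysub j f -> polysub j g -> polysub j (f * g).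
Proof. by move=> [d Hf] [e Hg]; exists (d + e)%N; apply: boxdegM. Qed.

Lemma polysub_coef j (p : {poly A}) :
  (forall i, polysub j p`_i) -> coefsub j p.
Proof.
move=> H; have [b Hb] := choice H.
exists (\max_(i < size p) b i) => i.
have [ip|ip] := ltnP i (size p); last by rewrite nth_default //; apply: boxdeg0.
by apply: boxdeg_mono (Hb i); apply: (leq_bigmax (Ordinal ip)).
Qed.

Lemma coefsub_polysub j (p : {poly A}) i : coefsub j p -> polysub j p`_i.
Proof. by move=> [d H]; exists d. Qed.

Lemma polysubS j f : polysub j.+1 f -> exists2 p, coefsub j p & f = p.[x j].
Proof. by move=> [d [p [sp cp ->]]]; exists p => //; exists d. Qed.

Section IdealTheory.
Variable I : A -> Prop.
Hypothesis idI : ideal (fun=> True) I.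

Lemma ideal0 : I 0. Proof. by case: idI. Qed.
Lemma idealD f g : I f -> I g -> I (f + g). Proof. by case: idI => ? H ?; apply: H. Qed.
Lemma idealM f g : I g -> I (f * g). Proof. by case: idI => ? ? H; apply: H. Qed.
Lemma idealMr f g : I g -> I (g * f). Proof. by rewrite mulrC; apply: idealM. Qed.
Lemma idealN f : I f -> I (- f). Proof. by rewrite -mulN1r; apply: idealM. Qed.
Lemma idealB f g : I f -> I g -> I (f - g).
Proof. by move=> If /idealN; apply: idealD. Qed.
Lemma ideal_sum (T : Type) (s : seq T) (P : pred T) (f : T -> A) :
  (forall i, P i -> I (f i)) -> I (\sum_(i <- s | P i) f i).
Proof. by move=> H; elim/big_ind: _ => //; [apply: ideal0|apply: idealD]. Qed.
Lemma ideal_transfer f g : I (f - g) -> I g -> I f.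
Proof. by move=> /idealD H /H; rewrite subrK. Qed.
End IdealTheory.

(** The leading coefficient must stay nonzero modulo I, so that q is a true
    equation for x_j over the fraction field of the subring of the earlier
    variables modulo I. *)
Definition algebraic_at (I : A -> Prop) j (q : {poly A}) : Prop :=
  [/\ coefsub j q, I q.[x j] & ~ I (lead_coef q)].

Definition algebraic (I : A -> Prop) j : Prop := exists q, algebraic_at I j q.

Definition min_algebraic (I : A -> Prop) j (q : {poly A}) : Prop :=
  algebraic_at I j q /\
  forall q', algebraic_at I j q' -> (size q <= size q')%N.

Lemma exists_min_algebraic I j : algebraic I j -> exists q, min_algebraic I j q.
Proof.
move=> [q0 H0]; have ex : exists s, `[< exists2 q, algebraic_at I j q & size q = s >].
  by exists (size q0); apply/asboolP; exists q0.
case: (ex_minnP ex) => s /asboolP [q Hq sq] Hmin.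
by exists q; split=> // q' Hq'; rewrite sq; apply: Hmin; apply/asboolP; exists q'.
Qed.

Lemma size_cancel_lead (R : nzRingType) (p : {poly R}) s :
  (size p <= s.+1)%N -> p`_s = 0 -> (size p <= s)%N.
Proof.
move=> sp ps; apply/leq_sizeP => i; rewrite leq_eqVlt => /orP[/eqP <- //|si].
by apply: (leq_sizeP _ _ sp).
Qed.

(** One step of pseudo-division: the two top terms cancel. *)
Lemma pseudo_step (p q : {poly A}) s : (size p <= s.+1)%N -> (0 < size q <= s.+1)%N ->
  (size (lead_coef q *: p - (p`_s *: 'X^(s.+1 - size q)) * q)%R <= s)%N.
Proof.
move=> sp /andP[q0 sq]; apply: size_cancel_lead.
  apply: leq_trans (size_polyD _ _) _; rewrite geq_max size_polyN; apply/andP; split.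
    by apply: leq_trans (size_scale_leq _ _) _.
  rewrite -scalerAl; apply: leq_trans (size_scale_leq _ _) _.
  apply: leq_trans (size_polyMleq _ _) _; rewrite size_polyXn addSn /=.
  by rewrite subnK.
rewrite coefB coefZ -scalerAl coefZ coefXnM ltnNge.
have -> : (s.+1 - size q <= s)%N by rewrite leq_subLR -addn1 addnC leq_add2r.
rewrite /= /lead_coef.
have -> : (s - (s.+1 - size q) = (size q).-1)%N.
  by move: q0 sq; lia.
by rewrite mulrC subrr.
Qed.

Section Derivation.
Variables (ev : {rmorphism A -> k}) (D : A -> k).
Hypothesis DD : forall f g, D (f + g) = D f + D g.
Hypothesis DM : forall f g, D (f * g) = ev f * D g + ev g * D f.
Hypothesis Dcst : forall c, D (cst c) = 0.

Lemma D0 : D 0 = 0. Proof. by rewrite -(rmorph0 cst) Dcst. Qed.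
Lemma DN f : D (- f) = - D f.
Proof. by apply/eqP; rewrite -addr_eq0 -DD addNr D0. Qed.

(** A derivation at a point, lifted along the tower of variables. A
    transcendental x_j imposes no condition, and for an algebraic x_j the
    single condition that D kills the minimal equation suffices: multiplied
    by a power of its leading coefficient, every element of I reduces modulo
    that equation to elements of smaller degree in x_j. *)
Lemma tangent_tower (I : A -> Prop) (q : nat -> {poly A}) N :
  prime_ideal I -> (forall f, I f -> ev f = 0) ->
  (forall j, (j < N)%N -> algebraic I j ->
     [/\ min_algebraic I j (q j), ev (lead_coef (q j)) != 0 & D (q j).[x j] = 0]) ->
  forall j f, (j <= N)%N -> polysub j f -> I f -> D f = 0.
Proof.
move=> [idI _ _] evI Hq; elim=> [|j IH] f.
  by move=> _ [d [c ->]] _; rewrite Dcst.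
move=> jN /polysubS [p cp ->].
have [s sp] := ubnP (size p); elim: s p sp cp => // s IHs p.
rewrite ltnS => sp cp Ip.
case: s sp IHs => [|s] sp IHs.
  by move: sp; rewrite leqn0 size_poly_eq0 => /eqP ->; rewrite horner0 D0.
(* Induction on the degree in x_j. A top coefficient in I is dropped;
   otherwise p is reduced by the minimal equation. *)
have [Is|nIs] := pselect (I p`_s).
  pose p' := p - p`_s *: 'X^s.
  have Ix : I (p`_s * x j ^+ s) by apply: idealMr.
  have pE : p.[x j] = p'.[x j] + p`_s * x j ^+ s.
    by rewrite /p' hornerD hornerN hornerZ hornerXn subrK.
  have Dps : D p`_s = 0 by apply: IH => //; [apply: ltnW|apply: coefsub_polysub].
  rewrite pE DD DM (evI _ Is) Dps mul0r add0r mulr0 addr0.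
  apply: IHs.
  + rewrite ltnS; apply: size_cancel_lead.
      apply: leq_trans (size_polyD _ _) _; rewrite geq_max sp size_polyN.
      by apply: leq_trans (size_scale_leq _ _) _; rewrite size_polyXn.
    by rewrite /p' coefB coefZ coefXn eqxx mulr1 subrr.
  + apply: polysub_coef => i; rewrite coefB coefZ coefXn.
    apply: polysubD; first exact: coefsub_polysub.
    case: (i == s); rewrite ?mulr1 ?mulr0 ?oppr0; last by exists 0%N; apply: boxdeg0.
    by case: (coefsub_polysub s cp) => d Hd; exists d; apply: boxdegN.
  + by rewrite /p' hornerD hornerN hornerZ hornerXn; apply: idealB.
have sps : size p = s.+1.
  apply/eqP; rewrite eqn_leq sp ltnNge; apply/negP => /leq_sizeP/(_ s (leqnn _)) ps.
  by apply: nIs; rewrite ps; apply: ideal0.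
(* Now p is itself an equation for x_j, so the minimal one has at most its
   degree and cancels its top coefficient. *)
have ap : algebraic_at I j p by split=> //; rewrite /lead_coef sps.
have [[aq minq] evq Dq] := Hq j jN (ex_intro _ p ap).
have sq := minq _ ap; case: (aq) => cq Iq nIq.
have sq0 : (0 < size (q j))%N.
  rewrite lt0n size_poly_eq0; apply/eqP => q0; apply: nIq.
  by rewrite q0 lead_coef0; apply: ideal0.
pose p' := lead_coef (q j) *: p - (p`_s *: 'X^(s.+1 - size (q j))) * q j.
have cl : polysub j (lead_coef (q j)) by apply: coefsub_polysub.
have cps : polysub j (- p`_s).
  by case: (coefsub_polysub s cp) => d Hd; exists d; apply: boxdegN.
have p'E : p'.[x j] = lead_coef (q j) * p.[x j] -
    (p`_s * x j ^+ (s.+1 - size (q j))) * (q j).[x j].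
  by rewrite /p' hornerD hornerN hornerZ hornerM hornerZ hornerXn.
have : D p'.[x j] = 0.
  apply: IHs.
  - by rewrite ltnS; apply: pseudo_step; rewrite // sq0 -sps.
  - apply: polysub_coef => i; rewrite coefB coefZ -scalerAl coefZ coefXnM -mulNr.
    apply: polysubD; first by apply: polysubM => //; apply: coefsub_polysub.
    apply: polysubM => //; case: ifP => _; last exact: coefsub_polysub.
    by exists 0%N; apply: boxdeg0.
  - by rewrite p'E; apply: idealB => //; apply: idealM.
rewrite p'E DD DN !DM (evI _ Ip) (evI _ Iq) Dq !mul0r !addr0 mulr0 oppr0 addr0.
by move/eqP; rewrite mulf_eq0 (negPf evq) => /eqP.
Qed.
End Derivation.

Lemma prime_exp I f m : prime_ideal I -> ~ I f -> ~ I (f ^+ m).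
Proof.
move=> [_ n1 pI] nf; elim: m => [|m IH]; first by rewrite expr0.
by rewrite exprS => /pI[].
Qed.

(** Up to a common denominator a outside I, the box is spanned by B elements
    modulo I. *)
Definition spanned (I : A -> Prop) j d B : Prop :=
  exists (T : finType) (a : A) (b : T -> A), [/\ (#|T| <= B)%N, ~ I a &
    forall f, boxdeg j d f ->
      exists l : T -> k, I (a * f - \sum_t cst (l t) * b t)].

Lemma spanned_step I j d B s (a0 : A) e : prime_ideal I -> ~ I a0 ->
  (forall f, boxdeg j.+1 d f -> exists p : {poly A}, [/\ (size p <= s)%N,
     forall i, boxdeg j e p`_i & I (a0 * f - p.[x j])]) ->
  spanned I j e B -> spanned I j.+1 d (s * B).
Proof.
move=> pI na0 red [T [a [b [cT na H]]]]; have [idI _ prI] := pI.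
exists ('I_s * T)%type, (a * a0), (fun t : 'I_s * T => b t.2 * x j ^+ (t.1 : 'I_s)); split.
- by rewrite card_prod card_ord leq_mul2l cT orbT.
- by move=> /prI[].
- move=> f /red[p [sp cp Ip]].
  have /choice[l Hl] : forall i, exists l : T -> k,
    I (a * p`_i - \sum_t cst (l t) * b t) by move=> i; apply: H.
  exists (fun t : 'I_s * T => l t.1 t.2).
  have -> : \sum_t cst (l (t : 'I_s * T).1 t.2) * (b t.2 * x j ^+ t.1) =
            \sum_(i < s) (\sum_t cst (l i t) * b t) * x j ^+ i.
    transitivity (\sum_(i < s) \sum_t cst (l i t) * (b t * x j ^+ i)).
      by rewrite pair_big.
    by apply: eq_bigr => i _; rewrite mulr_suml; apply: eq_bigr => t _; rewrite mulrA.
  have -> : a * a0 * f - \sum_(i < s) (\sum_t cst (l i t) * b t) * x j ^+ i =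
     a * (a0 * f - p.[x j]) +
     \sum_(i < s) (a * p`_i - \sum_t cst (l i t) * b t) * x j ^+ i.
    rewrite (horner_coef_wide (x j) sp) mulrBr mulrA -addrA; congr (_ + _).
    rewrite mulr_sumr -sumrN -sumrN -big_split /=; apply: eq_bigr => i _.
    by rewrite mulrBl mulrA addrA addNr add0r.
  apply: idealD => //; first exact: idealM.
  by apply: ideal_sum => // i _; apply: idealMr.
Qed.

Lemma pseudo_reduction I j q b s d (p : {poly A}) : prime_ideal I ->
  algebraic_at I j q -> (forall i, boxdeg j b q`_i) ->
  (size p <= s)%N -> (forall i, boxdeg j d p`_i) ->
  exists p' : {poly A}, [/\ (size p' <= (size q).-1)%N,
    forall i, boxdeg j (d + s * b) p'`_i &
    I (lead_coef q ^+ s * p.[x j] - p'.[x j])].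
Proof.
move=> [idI _ _] [_ Iq nl] cq.
have sq0 : (0 < size q)%N.
  rewrite lt0n size_poly_eq0; apply/eqP => q0; apply: nl.
  by rewrite q0 lead_coef0; apply: ideal0.
elim: s d p => [|s IH] d p sp cp.
  move: sp; rewrite leqn0 size_poly_eq0 => /eqP ->; exists 0; split.
  - by rewrite size_poly0.
  - by move=> i; rewrite coef0; apply: boxdeg0.
  - by rewrite horner0 mulr0 subrr; apply: ideal0.
have [sm|sm] := leqP (size q) s.+1; last first.
  exists (lead_coef q ^+ s.+1 *: p); split.
  - apply: leq_trans (size_scale_leq _ _) _; apply: leq_trans sp _.
    by move: sm; case: (size q).
  - move=> i; rewrite coefZ addnC; apply: boxdegM; last by [].
    by apply: boxdegXn; apply: cq.
  - by rewrite hornerZ subrr; apply: ideal0.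
pose p1 := lead_coef q *: p - (p`_s *: 'X^(s.+1 - size q)) * q.
have [||p' [sp' cp' Ip']] := IH (d + b)%N p1.
- by apply: pseudo_step; rewrite // sq0.
- move=> i; rewrite coefB coefZ -scalerAl coefZ coefXnM; apply: boxdegD.
    by rewrite addnC; apply: boxdegM; [apply: cq|].
  apply: boxdegN; case: ifP => _; last by apply: boxdegM.
  by rewrite mulr0; apply: boxdeg0.
exists p'; split=> //.
  by move=> i; rewrite mulSn addnA.
apply: (ideal_transfer idI) Ip'.
rewrite opprB addrA subrK.
rewrite /p1 hornerD hornerN hornerZ hornerM hornerZ hornerXn mulrBr opprB.
rewrite exprSr -mulrA addrCA subrr addr0.
by apply: idealM => //; apply: idealM.
Qed.

(** For a prime ideal this is the transcendence degree over the base field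
    of the subring of the first j variables modulo I. *)
Definition transcendence (I : A -> Prop) j :=
  count (fun i => ~~ `[< algebraic I i >]) (iota 0 j).

(** Each algebraic variable multiplies the number of spanning elements by a
    constant, each transcendental one by the side of the box. *)
Lemma spanned_bound I j : prime_ideal I ->
  exists c, forall d, spanned I j d (c * d.+1 ^ transcendence I j).
Proof.
move=> pI; have [idI n1 prI] := pI.
elim: j => [|j [c IH]].
  exists 1%N => d; rewrite expn0 muln1; exists unit, 1, (fun=> 1); split=> //.
    by rewrite card_unit.
  move=> f [l ->]; exists (fun=> l); rewrite big_const card_unit /= addr0.
  by rewrite mul1r mulr1 subrr; apply: ideal0.
have tE : transcendence I j.+1 = (transcendence I j + ~~ `[< algebraic I j >])%N.
  by rewrite /transcendence -addn1 iotaD count_cat add0n /= addn0.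
have [Ha|Ha] := asboolP (algebraic I j); last first.
  rewrite tE asboolF //= addn1; exists c => d.
  rewrite expnS mulnCA; apply: (spanned_step (a0 := 1)) (IH d) => //.
  move=> f [p [sp cp ->]]; exists p; split=> //.
  by rewrite mul1r subrr; apply: ideal0.
rewrite tE asboolT //= addn0.
have [q aq] := Ha; have [[b cq] _ nl] := aq.
(* Reduction modulo q leaves the powers of x_j below the degree of q, with
   coefficients in a box that is larger by the constant factor b + 1. *)
exists ((size q).-1 * (c * b.+1 ^ transcendence I j))%N => d.
rewrite -!mulnA -expnMn.
have -> : (b.+1 * d.+1 = (d + d.+1 * b).+1)%N by lia.
apply: (spanned_step (a0 := lead_coef q ^+ d.+1)) (IH (d + d.+1 * b)%N) => //.
  exact: prime_exp.
move=> f [p [sp cp ->]]; exact: pseudo_reduction.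
Qed.

Definition indep (I : A -> Prop) N d r : Prop :=
  exists f : 'I_r -> A, (forall i, boxdeg N d (f i)) /\
    forall l : 'I_r -> k, I (\sum_i cst (l i) * f i) -> forall i, l i = 0.

(** The denominator a is harmless because I is prime, and r vectors in a
    space of dimension less than r satisfy a linear relation. *)
Lemma indep_le_spanned I N d r B : prime_ideal I ->
  indep I N d r -> spanned I N d B -> (r <= B)%N.
Proof.
move=> [idI _ prI] [f [df Hf]] [T [a [b [cT na H]]]].
apply: leq_trans cT; rewrite leqNgt; apply/negP => lt.
have /choice[l Hl] : forall i, exists l : T -> k,
    I (a * f i - \sum_t cst (l t) * b t) by move=> i; apply: H.
pose M : 'M[k]_(r, #|T|) := \matrix_(i, t) l i (enum_val t).
have : kermx M != 0.
  rewrite -mxrank_eq0 mxrank_ker subn_eq0 -ltnNge.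
  exact: leq_ltn_trans (rank_leq_col _) lt.
case/rowV0Pn => v /sub_kermxP vM /eqP; apply; apply/rowP => i; rewrite mxE.
apply: (Hf (fun i => v 0 i)) i.
suff /prI[] : I (a * \sum_i cst (v 0 i) * f i) by [].
have -> : a * (\sum_i cst (v 0 i) * f i) =
   \sum_i cst (v 0 i) * (a * f i - \sum_t cst (l i t) * b t) +
   \sum_t cst (\sum_i v 0 i * l i t) * b t.
  under [X in _ + X]eq_bigr do rewrite rmorph_sum mulr_suml.
  rewrite mulr_sumr exchange_big -big_split /=; apply: eq_bigr => i _.
  rewrite mulrBr mulrCA -[LHS]addr0 -addrA; congr (_ + _).
  rewrite mulr_sumr -sumrN -big_split /= big1 // => t _.
  by rewrite rmorphM mulrA addNr.
rewrite [X in _ + X]big1 ?addr0.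
  by apply: ideal_sum => // i _; apply: idealM.
move=> t _; suff -> : \sum_i v 0 i * l i t = 0 by rewrite rmorph0 mul0r.
have := congr1 (fun w : 'rV_#|T| => w 0 (enum_rank t)) vM; rewrite !mxE.
by apply: etrans; apply: eq_bigr => i _; rewrite mxE enum_rankK.
Qed.

Lemma indep_mono (I I' : A -> Prop) N d e r : (forall f, I f -> I' f) -> (d <= e)%N ->
  indep I' N d r -> indep I N e r.
Proof.
move=> sI de [f [df Hf]]; exists f; split=> [i|l /sI /Hf //].
exact: boxdeg_mono de (df i).
Qed.

(** Multiples of g vanish modulo I', so they come on top of what is already
    independent modulo I'; since I is prime, multiplication by g preserves
    independence modulo I. *)
Lemma indep_step (I I' : A -> Prop) N d e r l g : prime_ideal I -> ideal (fun=> True) I' ->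
  (forall f, I f -> I' f) -> I' g -> ~ I g -> boxdeg N e g ->
  indep I' N (e + d) r -> indep I N d l -> indep I N (e + d) (r + l).
Proof.
move=> [idI _ prI] idI' sI Ig nIg dg [f [df Hf]] [h [dh Hh]].
exists (fun i => match fintype.split i with inl i => f i | inr i => g * h i end); split.
  by move=> i; case: (fintype.split i) => // i'; apply: boxdegM.
move=> v; rewrite big_split_ord /=.
under eq_bigr do rewrite (unsplitK (inl _)).
under [X in _ + X]eq_bigr do rewrite (unsplitK (inr _)) mulrCA.
rewrite -mulr_sumr => Iv.
have v1 : forall i, v (lshift l i) = 0.
  apply: (Hf (fun i => v (lshift l i))).
  by have := idealB idI' (sI _ Iv) (idealMr idI' (\sum_i cst (v (rshift r i)) * h i) Ig);
    rewrite addrK.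
have v2 : forall i, v (rshift r i) = 0.
  apply: (Hh (fun i => v (rshift r i))).
  move: Iv; rewrite big1 ?add0r; first by move=> /prI[].
  by move=> i _; rewrite v1 rmorph0 mul0r.
by move=> i; case: (splitP i) => i' ii'; [rewrite -(v1 i')|rewrite -(v2 i')];
  congr v; apply: val_inj.
Qed.

(** The coefficient is the number of monomials of degree at most q in m
    variables, so this says that the Hilbert function of the quotient grows
    at least like a polynomial of degree m. *)
Definition growth (I : A -> Prop) N m : Prop :=
  exists e, forall q, indep I N (e * q) 'C(q + m, m).

Lemma growth0 (I : A -> Prop) N : prime_ideal I -> growth I N 0.
Proof.
move=> [idI n1 _]; exists 0%N => q; rewrite mul0n bin0.
exists (fun=> 1); split=> [i|l]; first exact: boxdeg1.
rewrite big_ord1 mulr1 => Il i; rewrite ord1; apply/eqP/negP => /negP l0.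
by apply: n1; rewrite -(rmorph1 cst) -(mulVf l0) rmorphM; apply: idealM.
Qed.

Lemma growth_sub (I I' : A -> Prop) N m : (forall f, I f -> I' f) ->
  growth I' N m -> growth I N m.
Proof. by move=> sI [e H]; exists e => q; apply: indep_mono (H q). Qed.

(** Enlarging the box by the degree of g, the independent families of I' and
    those of I for a smaller box add up: this is the Pascal identity for the
    binomial coefficients of the previous definition, so a strict inclusion
    of prime ideals raises the growth exponent by one. *)
Lemma growth_step (I I' : A -> Prop) N m g : prime_ideal I -> prime_ideal I' ->
  (forall f, I f -> I' f) -> I' g -> ~ I g -> polysub N g ->
  growth I' N m -> growth I N m.+1.
Proof.
move=> pI pI' sI Ig nIg [e dg] [e' H]; have [idI' _ _] := pI'.
pose e2 := (e + e')%N; exists e2.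
elim=> [|q IH].
  have [e0 H0] := growth0 N pI; have := H0 0%N; rewrite !add0n !binn muln0.
  exact: indep_mono.
rewrite addSn binS mulnS;
rewrite [X in indep _ _ _ X]addnC; apply: (indep_step pI idI' sI Ig nIg) => //.
  exact: boxdeg_mono (leq_addr _ _) dg.
have := H q.+1; rewrite addSnnS; apply: indep_mono => //.
by rewrite -mulnS leq_mul // leq_addl.
Qed.

Lemma leq_pow_bin q m : (q.+1 ^ m <= m`! * 'C(q + m, m))%N.
Proof.
rewrite mulnC bin_ffact; elim: m => [|m IH]; first by rewrite expn0.
rewrite addnS ffactnS expnS /= leq_mul //.
by rewrite ltnS leq_addr.
Qed.

(** The quotient has at least order q^m independent elements in a box of
    size proportional to q, but is spanned there by order q^t elements,
    where t is the transcendence degree. *)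
Lemma transcendence_ge I N m : prime_ideal I -> growth I N m ->
  (m <= transcendence I N)%N.
Proof.
move=> pI [e H]; have [c Hc] := spanned_bound N pI.
set t := transcendence I N in Hc *; rewrite leqNgt; apply/negP => tm.
pose M := (m`! * c * e.+1 ^ t)%N.
have := indep_le_spanned pI (H M) (Hc _).
rewrite -(leq_pmul2l (fact_gt0 m)); move/(leq_trans (leq_pow_bin _ _)).
apply/negP; rewrite -ltnNge.
apply: (@leq_ltn_trans (M * M.+1 ^ t)).
  rewrite /M -!mulnA; do 2 (apply: leq_mul => //).
  rewrite -expnMn; case: (posnP t) => [-> //|t0].
  by rewrite leq_exp2r //; lia.
apply: (@leq_trans (M.+1 ^ t.+1)).
  by rewrite expnS ltn_pmul2r // expn_gt0.
by rewrite leq_pexp2l.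
Qed.

(** The ideal generated by s, as an intersection, which avoids explicit
    coefficients while the ring of coefficients varies. *)
Definition ideal_span (S : A -> Prop) (s : seq A) (f : A) : Prop :=
  forall J, ideal S J -> (forall g, g \in s -> J g) -> J f.

Lemma ideal_span_ideal S s : ideal S (ideal_span S s).
Proof.
split.
- by move=> J [].
- by move=> f g Hf Hg J iJ sJ; have [_ JD _] := iJ; apply: JD; [apply: Hf|apply: Hg].
- by move=> f g Sf Hg J iJ sJ; have [_ _ JM] := iJ; apply: JM => //; apply: Hg.
Qed.

Lemma seq_choice (T U : eqType) (s : seq T) (Q : T -> U -> Prop) :
  (forall c, c \in s -> exists p, Q c p) ->
  exists P : seq U, (forall c, c \in s -> exists2 p, p \in P & Q c p) /\
                    (forall p, p \in P -> exists c, Q c p).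
Proof.
elim: s => [_|c s IH H]; first by exists [::].
have [p Qp] := H c (mem_head _ _).
have [|P [H1 H2]] := IH; first by move=> c' c's; apply: H; rewrite inE c's orbT.
exists (p :: P); split=> [c'|p'].
  rewrite inE => /orP[/eqP ->|/H1[p' p'P Qp']]; first by exists p; rewrite ?mem_head.
  by exists p'; rewrite // inE p'P orbT.
by rewrite inE => /orP[/eqP ->|/H2 //]; exists c.
Qed.

(** The basis theorem for one more variable. The coefficients of degree m of
    the elements of I of degree at most m in the last variable form an
    increasing sequence of ideals; lifts of generators of their union and of
    its finitely many members below the stable range generate I. *)
Lemma polysub_noetherian j (I : A -> Prop) : (forall f, I f -> polysub j f) ->
  ideal (polysub j) I ->
  exists s : seq A, (forall g, g \in s -> I g) /\
    forall f, I f -> ideal_span (polysub j) s f.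
Proof.
elim: j I => [|j IH] I subI idI.
  have [[f [If f0]]|n] := pselect (exists f, I f /\ f != 0).
    exists [:: f]; split=> [g|g Ig J [_ _ JM] HJ]; first by rewrite inE => /eqP ->.
    have [d [c cf]] := subI _ If; have [d' [c' cg]] := subI _ Ig.
    have c0 : c != 0 by apply: contraNneq f0 => c0; rewrite cf c0 rmorph0.
    have -> : g = cst (c' / c) * f by rewrite cf cg -rmorphM divfK.
    by apply: JM; [exists 0%N; apply: boxdeg_cst|apply: HJ; rewrite mem_head].
  exists [::]; split=> // f If J [J0 _ _] _.
  suff -> : f = 0 by [].
  by apply/eqP/negP => /negP f0; apply: n; exists f.
have [I0 ID IM] := idI.
(* Here c is the coefficient of degree m of an element of I of degree at
   most m in x_j. *)
pose lifts m (c : A) (p : {poly A}) :=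
  [/\ coefsub j p, (size p <= m.+1)%N, p`_m = c & I p.[x j]].
have polysubN f : polysub j f -> polysub j (- f).
  by move=> [d Hd]; exists d; apply: boxdegN.
have shift m l c p : lifts m c p -> lifts (l + m)%N c ('X^l * p).
  move=> [cp sp <- Ip]; split.
  - apply: polysub_coef => i; rewrite coefXnM; case: ifP => _.
      by exists 0%N; apply: boxdeg0.
    exact: coefsub_polysub.
  - apply: leq_trans (size_polyMleq _ _) _.
    by rewrite size_polyXn addSn /= -addnS leq_add2l.
  - by rewrite coefXnM ltnNge leq_addr /= addKn.
  - rewrite hornerM hornerXn; apply: IM => //.
    by exists (l * 1)%N; apply: boxdegXn; apply: boxdeg_var.
have liftsD m c c' p p' : lifts m c p -> lifts m c' p' -> lifts m (c + c') (p + p').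
  move=> [cp sp <- Ip] [cp' sp' <- Ip']; split.
  - by apply: polysub_coef => i; rewrite coefD; apply: polysubD; apply: coefsub_polysub.
  - by apply: leq_trans (size_polyD _ _) _; rewrite geq_max sp sp'.
  - by rewrite coefD.
  - by rewrite hornerD; apply: ID.
have liftsM m a c p : polysub j a -> lifts m c p -> lifts m (a * c) (a *: p).
  move=> Sa [cp sp <- Ip]; split.
  - by apply: polysub_coef => i; rewrite coefZ; apply: polysubM => //; apply: coefsub_polysub.
  - exact: leq_trans (size_scale_leq _ _) _.
  - by rewrite coefZ.
  - rewrite hornerZ; apply: IM => //.
    by have [d Hd] := Sa; exists d; apply: boxdeg_widen.
have lifts0 m : lifts m 0 0.
  split; [exists 0%N => i|by rewrite size_poly0|by rewrite coef0|by rewrite horner0].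
  by rewrite coef0; apply: boxdeg0.
have gen (L : A -> {poly A} -> Prop) : (forall c p, L c p -> polysub j c) ->
    L 0 0 -> (forall c c' p p', L c p -> L c' p' -> exists p'', L (c + c') p'') ->
    (forall a c p, polysub j a -> L c p -> exists p', L (a * c) p') ->
    exists P : seq {poly A}, (forall p, p \in P -> exists c, L c p) /\
      forall J, ideal (polysub j) J -> (forall p c, p \in P -> L c p -> J c) ->
      forall c p, L c p -> J c.
  move=> LS L0 LD LM; have [||s [s1 s2]] := IH (fun c => exists p, L c p).
  - by move=> c [p /LS].
  - split; first by exists 0.
      by move=> c c' [p Lp] [p' Lp']; apply: LD Lp Lp'.
    by move=> a c Sa [p Lp]; apply: LM Lp.
  have [P [P1 P2]] := seq_choice s1; exists P; split=> // J iJ HJ c p Lp.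
  apply: s2 iJ _; first by exists p.
  by move=> g /P1[p' p'P /HJ]; apply.
have [|||| Pinf [Pinf1 Pinf2]] := gen (fun c p => exists m, lifts m c p).
- by move=> c p [m [cp _ <- _]]; apply: coefsub_polysub.
- by exists 0%N.
- move=> c c' p p' [m /shift Hp] [m' /shift Hp']; eexists; exists (m + m')%N.
  by apply: liftsD; [rewrite addnC; apply: Hp|apply: Hp'].
- by move=> a c p Sa [m Hp]; eexists; exists m; apply: liftsM Hp.
have /choice[Pm HPm] : forall m, exists P : seq {poly A},
    (forall p, p \in P -> exists c, lifts m c p) /\
      forall J, ideal (polysub j) J -> (forall p c, p \in P -> lifts m c p -> J c) ->
      forall c p, lifts m c p -> J c.
  move=> m; apply: gen => //.
  - by move=> c p [cp _ <- _]; apply: coefsub_polysub.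
  - by move=> c c' p p' Hp Hp'; eexists; apply: liftsD Hp Hp'.
  - by move=> a c p Sa Hp; eexists; apply: liftsM Hp.
(* Beyond K the lifts for the union, multiplied by powers of x_j, suffice;
   below K each degree has its own list. *)
pose K := (\max_(p <- Pinf) size p)%N.
pose P := Pinf ++ flatten [seq Pm m | m <- iota 0 K].
exists [seq p.[x j] | p : {poly A} <- P]; set G := [seq _ | _ <- _].
split=> [g /mapP[p]|f If].
  rewrite mem_cat => /orP[/Pinf1[c [m [_ _ _ Ip]]] -> //|/flattenP[s /mapP[m _ ->]]].
  by move=> /(proj1 (HPm m))[c [_ _ _ Ip]] ->.
have [p cp fp] := polysubS (subI _ If); move: If; rewrite fp => If {fp}.
have [GD0 GDD GDM] := ideal_span_ideal (polysub j.+1) G.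
have [s sp] := ubnP (size p); elim: s p sp cp If => // s IHs p.
rewrite ltnS => sp cp Ip.
case: s sp IHs => [|s] sp IHs.
  by move: sp; rewrite leqn0 size_poly_eq0 => /eqP ->; rewrite horner0.
(* The leading coefficients that can be cancelled by elements of the span; p
   has smaller degree after subtracting such an element. *)
pose J c := exists2 p', lifts s c p' & ideal_span (polysub j.+1) G p'.[x j].
have iJ : ideal (polysub j) J.
  split; first by exists 0 => //; rewrite horner0.
    move=> c c' [p1 L1 G1] [p2 L2 G2]; exists (p1 + p2); first exact: liftsD.
    by rewrite hornerD; apply: GDD.
  move=> a c Sa [p1 L1 G1]; exists (a *: p1); first exact: liftsM.
  rewrite hornerZ; apply: GDM => //.
  by have [d Hd] := Sa; exists d; apply: boxdeg_widen.
have GP p' : p' \in P -> ideal_span (polysub j.+1) G p'.[x j].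
  by move=> p'P J' _; apply; apply: map_f.
have Lp : lifts s p`_s p by [].
have [p' [cp' sp' ps' Ip'] Gp'] : J p`_s.
  have [sK|sK] := ltnP s K.
    apply: (proj2 (HPm s)) iJ _ _ _ Lp => p' c p'P Lp'; exists p' => //.
    apply: GP; rewrite mem_cat; apply/orP; right; apply/flattenP; exists (Pm s) => //.
    by apply: map_f; rewrite mem_iota.
  apply: (Pinf2 J iJ _ _ p); last by exists s.
  move=> p' c p'P [m Lp']; have [Jc|c0] := eqVneq c 0.
    by rewrite Jc; exists 0 => //; rewrite horner0.
  have ms : (m <= s)%N.
    apply: leq_trans sK; apply: (@leq_trans (size p')).
      rewrite leqNgt; apply: contra c0 => lt; case: Lp' => _ _ <- _.
      by rewrite nth_default // ltnW.
    by rewrite /K (big_rem _ p'P) leq_maxl.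
  exists ('X^(s - m) * p'); first by rewrite -{1}(subnK ms); apply: shift.
  rewrite hornerM hornerXn; apply: GDM; last by apply: GP; rewrite mem_cat p'P.
  by exists ((s - m) * 1)%N; apply: boxdegXn; apply: boxdeg_var.
have -> : p.[x j] = (p - p').[x j] + p'.[x j] by rewrite hornerD hornerN subrK.
apply: GDD => //; apply: IHs.
- rewrite ltnS; apply: size_cancel_lead; last by rewrite coefB ps' subrr.
  by apply: leq_trans (size_polyD _ _) _; rewrite geq_max size_polyN sp sp'.
- apply: polysub_coef => i; rewrite coefB; apply: polysubD; first exact: coefsub_polysub.
  by apply: polysubN; apply: coefsub_polysub.
- rewrite hornerD hornerN; apply: ID => //.
  rewrite -mulN1r; apply: IM => //.
  by exists 0%N; apply: boxdegN; apply: boxdeg1.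
Qed.

Lemma ideal_spanP (s : seq A) (f : A) : ideal_span (fun=> True) s f ->
  exists h : 'I_(size s) -> A, f = \sum_i h i * s`_i.
Proof.
move=> Hs; apply: (Hs (fun f => exists h : 'I_(size s) -> A, f = \sum_i h i * s`_i)).
  split.
  - by exists (fun=> 0); rewrite big1 // => i _; rewrite mul0r.
  - move=> _ _ [h1 ->] [h2 ->]; exists (fun i => h1 i + h2 i).
    by rewrite -big_split; apply: eq_bigr => i _; rewrite mulrDl.
  - move=> a _ _ [h ->]; exists (fun i => a * h i).
    by rewrite mulr_sumr; apply: eq_bigr => i _; rewrite mulrA.
move=> g gs; have gi : (index g s < size s)%N by rewrite index_mem.
exists (fun i => (i == Ordinal gi)%:R).
rewrite (bigD1 (Ordinal gi)) //= eqxx mul1r nth_index // big1 ?addr0 //.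
by move=> i /negPf ->; rewrite mul0r.
Qed.

Theorem hilbert_basis N (I : A -> Prop) : (forall f, polysub N f) ->
  ideal (fun=> True) I ->
  exists s : seq A, (forall g, g \in s -> I g) /\
    forall f, I f -> exists h : 'I_(size s) -> A, f = \sum_i h i * s`_i.
Proof.
move=> all idI; have [//||s [s1 s2]] := @polysub_noetherian N I _ _.
  by case: idI => I0 ID IM; split=> // f g _; apply: IM.
exists s; split=> // f /s2 H; apply: ideal_spanP => J [J0 JD JM]; apply: H.
by split=> // a b _; apply: JM.
Qed.

End PrimeIdeals.

(** * The ideal of a projective variety and its generic tangent space *)

Section ConeIdeal.
Context {R : realType} {n : nat}.
Local Notation C := (Cplx R).
Local Notation V := 'rV[C]_n.+1.
Local Notation poly := (mpoly.mpoly n.+1 C).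
Local Notation mconst := (@mpoly.mpolyC n.+1 C : {rmorphism C -> poly}).
Local Notation evalr w := (mpoly.meval ((w : V) 0) : {rmorphism poly -> C}).
Local Notation deg := (mpoly.mpoly_mdeg__canonical__mpoly_Measure n.+1).

Local Notation eval := (@Defs.eval R n).

Lemma evalD f g w : eval (f + g) w = eval f w + eval g w.
Proof. by rewrite /Defs.eval rmorphD. Qed.

Lemma evalM f g w : eval (f * g) w = eval f w * eval g w.
Proof. by rewrite /Defs.eval rmorphM. Qed.

Lemma evalC c w : eval (mconst c) w = c.
Proof. by rewrite /Defs.eval /= mpoly.mevalC. Qed.

Definition mvar (j : nat) : poly := mpoly.mpolyX C (mpoly.mnm1 (inord j : 'I_n.+1)).

(** The positive integers are infinitely many roots. *)
Lemma poly_nat_roots (p : {poly C}) : (forall i : nat, p.[i.+1%:R] = 0) -> p = 0.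
Proof.
move=> H; apply/eqP/negP => /negP p0.
have := max_poly_roots p0 (rs := [seq i.+1%:R | i <- iota 0 (size p)]).
rewrite size_map size_iota ltnn => H1.
suff : false by []; apply: H1.
  by apply/allP => _ /mapP[i _ ->]; apply/rootP; apply: H.
rewrite map_inj_uniq ?iota_uniq // => i j /eqP.
by rewrite eqr_nat => /eqP[].
Qed.

Lemma eval_homog d (f : poly) (a : C) (w : V) : f \is mpoly.ishomog1 d deg ->
  eval f (a *: w) = a ^+ d * eval f w.
Proof.
move=> /mpoly.dhomogP hf; rewrite /eval !mpoly.mevalE mulr_sumr.
rewrite !big_seq; apply: eq_bigr => m /hf md.
rewrite mulrCA; congr (_ * _).
transitivity (\prod_i (a ^+ m i * w 0 i ^+ m i)).
  by apply: eq_bigr => i _; rewrite mxE exprMn.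
rewrite big_split /=; congr (_ * _).
by rewrite -expr_sum -mpoly.mdegE [mpoly.mdeg m]md.
Qed.

Lemma proj_closed_cone (X : set V) (a : C) w : proj_closed X -> a != 0 -> X w -> X (a *: w).
Proof.
move=> [S [hS ->]] a0 [w0 Sw]; split; first by rewrite scaler_eq0 negb_or a0.
move=> f Sf; have /mpoly.homogP[d hd] := hS f Sf.
by rewrite (eval_homog _ _ hd) (Sw f Sf) mulr0.
Qed.

Lemma proj_closed_neq0 (X : set V) w : proj_closed X -> X w -> w != 0.
Proof. by move=> [S [hS ->]] []. Qed.

Lemma eval_homog_parts (f : poly) (t : C) (w : V) :
  eval f (t *: w) =
    (\poly_(d < mpoly.mmeasure deg f) eval (mpoly.pihomog deg d f) w).[t].
Proof.
have fE := mpoly.pihomog_partitionE (leqnn (mpoly.mmeasure deg f)).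
rewrite horner_poly {1}fE.
rewrite /eval raddf_sum; apply: eq_bigr => d _ /=.
rewrite mulrC; apply: eval_homog; exact: mpoly.pihomogP.
Qed.

Definition ideal_of (X : set V) (f : poly) : Prop := forall w, X w -> eval f w = 0.

Lemma ideal_ofP (X : set V) : ideal (fun=> True) (ideal_of X).
Proof.
split=> [w _|f g If Ig w Xw|f g _ Ig w Xw].
- by rewrite /eval rmorph0.
- by rewrite /eval rmorphD /= [mpoly.meval _ f]If // [mpoly.meval _ g]Ig // addr0.
- by rewrite /eval rmorphM /= [mpoly.meval _ g]Ig // mulr0.
Qed.

(** The closed cone on which every homogeneous component of f vanishes. On a
    cone it is the zero set of f, see [ray_zero_parts]. *)
Definition parts_locus (f : poly) : set V :=
  zero_locus [set g | exists2 d, (d < mpoly.mmeasure deg f)%N & g = mpoly.pihomog deg d f].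

Lemma parts_locus_closed f : proj_closed (parts_locus f).
Proof.
eexists; split; last by [].
by move=> _ [d _ ->]; apply/mpoly.homogP; exists d; apply: mpoly.pihomogP.
Qed.

Lemma eval_parts_locus f w : parts_locus f w -> eval f w = 0.
Proof.
move=> [_ Hf]; rewrite -(scale1r w) eval_homog_parts horner_poly big1 // => d _.
by rewrite Hf ?mul0r //; exists d.
Qed.

Lemma ray_zero_parts f (w : V) : w != 0 ->
  \poly_(d < mpoly.mmeasure deg f) eval (mpoly.pihomog deg d f) w = 0 -> parts_locus f w.
Proof.
move=> w0 H; split=> // _ [d dl ->].
by have := congr1 (fun p : {poly C} => p`_d) H; rewrite coef_poly dl coef0.
Qed.

(** Irreducibility is assumed for closed sets given by homogeneous
    equations, whereas f and g are arbitrary. On the ray of a point both are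
    polynomials in the scaling parameter, and if their product vanishes on
    the ray then one of the two has only zero components there. *)
Lemma ideal_of_prime (X : set V) : proj_variety X -> prime_ideal (ideal_of X).
Proof.
move=> [cX [x0 Xx0] irrX]; split; first exact: ideal_ofP.
  by move=> /(_ _ Xx0) /eqP; rewrite /eval rmorph1 oner_eq0.
move=> f g Ifg; have [|HX|HX] := irrX _ _ (parts_locus_closed f) (parts_locus_closed g).
- move=> w Xw; have w0 := proj_closed_neq0 cX Xw.
  pose P h := \poly_(d < mpoly.mmeasure deg h) eval (mpoly.pihomog deg d h) w.
  have /eqP : P f * P g = 0.
    apply: poly_nat_roots => i; rewrite hornerM -!eval_homog_parts.
    rewrite /eval -mpoly.mevalM; apply: Ifg.
    by apply: proj_closed_cone => //; rewrite pnatr_eq0.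
  by rewrite mulf_eq0 => /orP[] /eqP H; [left|right]; apply: ray_zero_parts.
- by left => w /HX; apply: eval_parts_locus.
- by right => w /HX; apply: eval_parts_locus.
Qed.

Lemma mpoly_alg_ind (P : poly -> Prop) :
  (forall c, P (mconst c)) -> (forall i : 'I_n.+1, P (mpoly.mpolyX C (mpoly.mnm1 i))) ->
  (forall f g, P f -> P g -> P (f + g)) -> (forall f g, P f -> P g -> P (f * g)) ->
  forall f, P f.
Proof.
move=> Pc PX PD PM; elim/mpoly.mpolyind => [|c m p _ _ IH].
  by rewrite -(rmorph0 mconst).
apply: PD => //; rewrite -mpoly.mul_mpolyC; apply: (PM); first exact: Pc.
rewrite mpoly.mpolyXE_id; elim/big_ind: _ => [|f g|i _].
- by rewrite -(rmorph1 mconst).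
- exact: PM.
- by elim: (m i) => [|k IHk]; rewrite ?expr0 ?exprS -?(rmorph1 mconst) //; apply: PM.
Qed.

Lemma mpoly_polysub (f : poly) : polysub mconst mvar n.+1 f.
Proof.
elim/mpoly_alg_ind: f => [c|i|f g|f g].
- by exists 0%N; apply: (boxdeg_cst mconst).
- have <- : mvar i = mpoly.mpolyX C (mpoly.mnm1 i) by rewrite /mvar inord_val.
  exists 1%N; apply: (@boxdeg_widen_le _ _ _ _ i.+1) => //.
  exact: (boxdeg_var mconst mvar i).
- exact: polysubD.
- exact: polysubM.
Qed.

(** The vertex of the cones; its ideal is the bottom of every chain and
    accounts for the dimension of the cone exceeding that of the variety by
    one. *)
Lemma vertex_ideal_prime : prime_ideal (ideal_of [set 0 : V]).
Proof.
split; first exact: ideal_ofP.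
  by move=> /(_ 0 erefl) /eqP; rewrite /eval rmorph1 oner_eq0.
move=> f g /(_ 0 erefl) /eqP; rewrite /eval mpoly.mevalM mulf_eq0.
by case/orP => /eqP H; [left|right] => _ ->.
Qed.

(** Each strict inclusion in the chain, and the one of the vertex in the
    smallest cone, is a strict inclusion of prime ideals. *)
Lemma chain_growth (X : set V) m : has_chain X m ->
  growth mconst mvar (ideal_of X) n.+1 m.+1.
Proof.
move=> [W [varW ltW WX]].
have sub (Y Y' : set V) : Y `<=` Y' -> forall f, ideal_of Y' f -> ideal_of Y f.
  by move=> YY' f H w /YY'; apply: H.
apply: (growth_sub (sub _ _ WX)).
suff : forall i, (i <= m)%N -> growth mconst mvar (ideal_of (W i)) n.+1 i.+1 by apply.
elim=> [|i IH] im.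
  have [cW [w Ww] _] := varW 0%N im.
  have [j wj] : exists j, w 0 j != 0 by apply/rV0Pn/(proj_closed_neq0 cW Ww).
  apply: (growth_step (I' := ideal_of [set 0]) (g := mpoly.mpolyX C (mpoly.mnm1 j))).
  - exact/ideal_of_prime/varW.
  - exact: vertex_ideal_prime.
  - move=> f If _ ->; have /(congr1 (fun p : {poly C} => p.[0])) :
      \poly_(d < mpoly.mmeasure deg f) eval (mpoly.pihomog deg d f) w = 0.
      apply: poly_nat_roots => k; rewrite -eval_homog_parts; apply: If.
      by apply: proj_closed_cone => //; rewrite pnatr_eq0.
    by rewrite -eval_homog_parts scale0r horner0.
  - by move=> _ ->; rewrite /eval mpoly.mevalXU mxE.
  - by move=> /(_ _ Ww) /eqP; rewrite /eval mpoly.mevalXU (negPf wj).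
  - exact: mpoly_polysub.
  - exact/growth0/vertex_ideal_prime.
have [cW _ _] := varW i (ltnW im); have [S [hS WS]] := cW.
have [sW /nonsubset[w [W1 W0]]] := ltW i im; have [cW1 _ _] := varW i.+1 im.
have [g Sg gw] : exists2 g, S g & eval g w != 0.
  apply: contra_notP W0 => H; rewrite WS; split; first exact: proj_closed_neq0 cW1 W1.
  by move=> f Sf; apply/eqP/negP => /negP fw; apply: H; exists f.
apply: (growth_step (I' := ideal_of (W i)) (g := g)).
- exact/ideal_of_prime/varW.
- exact/ideal_of_prime/varW/ltnW.
- exact: sub.
- by move=> w'; rewrite WS => -[_]; apply.
- by move=> /(_ _ W1) /eqP; rewrite (negPf gw).
- exact: mpoly_polysub.
- exact/IH/ltnW.
Qed.

Definition gradient (f : poly) (w : V) : V := \row_i eval (mpoly.mderiv i f) w.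

Definition dirder (w u : V) (f : poly) : C := (u *m (gradient f w)^T) 0 0.

Lemma dirderE w u f : dirder w u f = \sum_i u 0 i * eval (mpoly.mderiv i f) w.
Proof. by rewrite /dirder mxE; apply: eq_bigr => i _; rewrite !mxE. Qed.

Lemma dirderD w u f g : dirder w u (f + g) = dirder w u f + dirder w u g.
Proof.
rewrite !dirderE -big_split; apply: eq_bigr => i _.
by rewrite mpoly.mderivD /eval rmorphD mulrDr.
Qed.

Lemma dirderM w u f g : dirder w u (f * g) = eval f w * dirder w u g + eval g w * dirder w u f.
Proof.
rewrite !dirderE !mulr_sumr -big_split; apply: eq_bigr => i _.
rewrite mpoly.mderivM /eval rmorphD !rmorphM /=.
by ring.
Qed.

Lemma dirderC w u c : dirder w u (mpoly.mpolyC n.+1 c) = 0.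
Proof.
by rewrite dirderE big1 // => i _; rewrite mpoly.mderivC /eval rmorph0 mulr0.
Qed.

(** At points where no leading coefficient of the minimal equations
    vanishes, the tangent space is cut out by one linear condition for each
    algebraic variable, and at least m + 1 of the n + 1 variables are
    transcendental. *)
Lemma generic_tangent (X : set V) m : proj_variety X -> has_chain X m ->
  exists2 a : poly, ~ ideal_of X a & forall w, X w -> eval a w != 0 ->
    exists K : 'M[C]_n.+1, (\rank K >= m.+1)%N /\
      forall u f, ideal_of X f -> dirder w (u *m K) f = 0.
Proof.
move=> varX chX; have pI := ideal_of_prime varX; set I := ideal_of X in pI *.
have tm := transcendence_ge pI (chain_growth chX).
have /choice[q Hq] : forall j, exists q, algebraic mconst mvar I j -> min_algebraic mconst mvar I j q.
  move=> j; have [/exists_min_algebraic[q Hq]|nH] := pselect (algebraic mconst mvar I j).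
    by exists q.
  by exists 0.
pose alg j := `[< algebraic mconst mvar I j >].
(* The generic points are those where no leading coefficient vanishes. *)
pose a := \prod_(j < n.+1 | alg j) lead_coef (q j).
exists a.
  have [_ nI1 prI] := pI.
  rewrite /a; elim/big_ind: _ => // [f g nf ng /prI[]//|j /asboolP /Hq[[_ _]]].
  by [].
move=> w Xw; rewrite /eval /a rmorph_prod => /prodf_neq0 aw.
have [G GE] : exists G : 'M[C]_n.+1, forall i j,
    G i j = if alg j then eval (mpoly.mderiv i (q j).[mvar j]) w else 0.
  exists (\matrix_(i, j) (if alg j then eval (mpoly.mderiv i (q j).[mvar j]) w else 0)).
  by move=> i j; rewrite mxE.
have rG : (\rank G <= n.+1 - m.+1)%N.
  rewrite -mxrank_tr.
  pose s : seq nat := [seq j <- iota 0 n.+1 | alg j].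
  pose B : 'M[C]_(size s, n.+1) := \matrix_(k, i) (G^T (inord (nth 0%N s k)) i).
  have sB : (G^T <= B)%MS.
    apply/row_subP => j; have [aj|naj] := boolP (alg j); last first.
      have -> : row j G^T = 0 by apply/rowP => i; rewrite !mxE GE (negPf naj).
      exact: sub0mx.
    have js : (j : nat) \in s by rewrite mem_filter aj mem_iota /=.
    have ks : (index (j : nat) s < size s)%N by rewrite index_mem.
    have -> : row j G^T = row (Ordinal ks) B.
      have e : inord (nth 0%N s (Ordinal ks)) = j by rewrite /= nth_index // inord_val.
      by apply/rowP => i; rewrite !mxE e.
    exact: row_sub.
  apply: leq_trans (mxrankS sB) _; apply: leq_trans (rank_leq_row _) _.
  rewrite /s size_filter.
  have tm' : (m < count (predC alg) (iota 0 n.+1))%N := tm.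
  have := count_predC alg (iota 0 n.+1); rewrite size_iota.
  move: tm'; move: (count alg _) (count (predC alg) _) => c1 c2; lia.
exists (kermx G); split.
  rewrite mxrank_ker; move: rG; have := rank_leq_row G.
  have : (m < n.+1)%N.
    apply: leq_trans tm _; rewrite /transcendence; apply: leq_trans (count_size _ _) _.
    by rewrite size_iota.
  by move: (\rank G) => r; lia.
move=> u f If; apply: (@tangent_tower _ _ mconst mvar (evalr w) (dirder w (u *m kermx G))
   (dirderD w _) (dirderM w _) (dirderC w _) I q n.+1) (leqnn _) (mpoly_polysub f) If => //.
  by move=> g Ig; apply: Ig.
move=> j jn aj; have Hj := Hq _ aj; split=> //.
  by have := aw (Ordinal jn); apply; apply/asboolP.
have : (u *m kermx G *m G) 0 (Ordinal jn) = 0 by rewrite -mulmxA mulmx_ker mulmx0 mxE.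
rewrite dirderE mxE; apply: etrans; apply: eq_bigr => i _.
by rewrite GE ifT //; apply/asboolP.
Qed.

End ConeIdeal.

(** * Complex moduli, the entry sum norm and contractions *)

Section EntrySumNorm.
Context {R : realType}.
Local Notation C := (Cplx R).

Definition cmod (x : C) : R := complex.Re `|x|.

Lemma cmodE (x : C) : ((cmod x)%:C)%C = `|x|.
Proof. by rewrite /cmod RRe_real // normr_real. Qed.

Lemma cmod_le (x : C) (r : R) : (cmod x <= r) = (`|x| <= (r%:C)%C).
Proof. by rewrite -cmodE lecR. Qed.

Lemma cmod_ge0 x : 0 <= cmod x.
Proof. by rewrite -lecR cmodE normr_ge0. Qed.

Lemma cmod_eq0 x : (cmod x == 0) = (x == 0).
Proof. by rewrite -(normr_eq0 x) -cmodE -(inj_eq (@complexI R)). Qed.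

Lemma cmod0 : cmod 0 = 0. Proof. by apply/eqP; rewrite cmod_eq0. Qed.

Lemma cmodM x y : cmod (x * y) = cmod x * cmod y.
Proof. by apply: complexI; rewrite rmorphM /= !cmodE normrM. Qed.

Lemma cmodD x y : cmod (x + y) <= cmod x + cmod y.
Proof. by rewrite -lecR rmorphD /= !cmodE ler_normD. Qed.

Lemma cmodN x : cmod (- x) = cmod x.
Proof. by rewrite /cmod normrN. Qed.

Lemma cmod_real (r : R) : cmod (r%:C)%C = `|r|.
Proof.
apply: complexI; rewrite cmodE.
have [r0|r0] := ger0P r; first by rewrite ger0_norm // lecR.
by rewrite ler0_norm ?rmorphN // lecR ltW.
Qed.

Lemma cmod1 : cmod 1 = 1.
Proof. by rewrite -(rmorph1 (real_complex R)) cmod_real normr1. Qed.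

Lemma cmod_sum (T : Type) (s : seq T) (P : pred T) (f : T -> C) :
  cmod (\sum_(i <- s | P i) f i) <= \sum_(i <- s | P i) cmod (f i).
Proof.
elim/big_rec2: _ => [|i y x _ H]; first by rewrite cmod0.
by apply: le_trans (cmodD _ _) _; rewrite lerD2l.
Qed.

Lemma cmod_conj (x : C) : cmod (x^* )%R = cmod x.
Proof. by apply: complexI; rewrite !cmodE norm_conjC. Qed.

Lemma Re_le_cmod (x : C) : `|complex.Re x| <= cmod x.
Proof. by rewrite -lecR cmodE; apply: normc_ge_Re. Qed.

Lemma cmod_i : cmod ('i%C : C) = 1.
Proof.
apply/eqP; rewrite -(@eqrXn2 _ 2) ?cmod_ge0 // expr1n expr2 -cmodM -expr2.
by rewrite sqr_i cmodN cmod1.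
Qed.

Lemma Im_le_cmod (x : C) : `|complex.Im x| <= cmod x.
Proof.
have -> : complex.Im x = - complex.Re (x * 'i%C) by rewrite ReiNIm opprK.
rewrite normrN; apply: le_trans (Re_le_cmod _) _.
by rewrite cmodM cmod_i mulr1.
Qed.

Lemma cmod_le_ReIm (x : C) : cmod x <= `|complex.Re x| + `|complex.Im x|.
Proof.
rewrite {1}(complexE x); apply: le_trans (cmodD _ _) _.
by rewrite cmodM cmod_i mul1r !cmod_real.
Qed.

(** The sum of the moduli of the entries is submultiplicative for products
    of arbitrary sizes and has values in R, unlike the norm of the normed
    module structure; all estimates are made with it. *)
Definition n1 p q (A : 'M[C]_(p, q)) : R := \sum_i \sum_j cmod (A i j).

Section N1.
Variables p q : nat.
Implicit Types A B : 'M[C]_(p, q).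

Lemma n1_ge0 A : 0 <= n1 A.
Proof. by apply: sumr_ge0 => i _; apply: sumr_ge0 => j _; apply: cmod_ge0. Qed.

Lemma n1_entry A i j : cmod (A i j) <= n1 A.
Proof.
rewrite /n1 (bigD1 i) //= (bigD1 j) //= -addrA lerDl addr_ge0 //.
  by apply: sumr_ge0 => *; apply: cmod_ge0.
by apply: sumr_ge0 => *; apply: sumr_ge0 => *; apply: cmod_ge0.
Qed.

Lemma n1D A B : n1 (A + B) <= n1 A + n1 B.
Proof.
rewrite /n1 -big_split /=; apply: ler_sum => i _; rewrite -big_split /=.
by apply: ler_sum => j _; rewrite mxE cmodD.
Qed.

Lemma n1N A : n1 (- A) = n1 A.
Proof. by apply: eq_bigr => i _; apply: eq_bigr => j _; rewrite mxE cmodN. Qed.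

Lemma n1B A B : n1 (A - B) <= n1 A + n1 B.
Proof. by apply: le_trans (n1D _ _) _; rewrite n1N. Qed.

Lemma n1C A B : n1 (A - B) = n1 (B - A).
Proof. by rewrite -n1N opprB. Qed.

Lemma n1_tri B A D : n1 (A - D) <= n1 (A - B) + n1 (B - D).
Proof. by rewrite -{1}(subrK B A) -addrA n1D. Qed.

Lemma n1Z a A : n1 (a *: A) = cmod a * n1 A.
Proof.
rewrite /n1 mulr_sumr; apply: eq_bigr => i _; rewrite mulr_sumr.
by apply: eq_bigr => j _; rewrite mxE cmodM.
Qed.

Lemma n1_0 : n1 (0 : 'M[C]_(p, q)) = 0.
Proof. by apply: big1 => i _; apply: big1 => j _; rewrite mxE cmod0. Qed.

Lemma n1_eq0 A : (n1 A == 0) = (A == 0).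
Proof.
apply/eqP/eqP => [H|->]; last exact: n1_0.
apply/matrixP => i j; rewrite mxE; apply/eqP; rewrite -cmod_eq0.
by rewrite eq_le cmod_ge0 andbT -H n1_entry.
Qed.

Lemma n1_le0 A : n1 A <= 0 -> A = 0.
Proof. by move=> H; apply/eqP; rewrite -n1_eq0 eq_le H n1_ge0. Qed.
End N1.

Lemma n1M p q r (A : 'M[C]_(p, q)) (B : 'M[C]_(q, r)) : n1 (A *m B) <= n1 A * n1 B.
Proof.
rewrite /n1 mulr_suml; apply: ler_sum => i _.
apply: (@le_trans _ _ (\sum_j \sum_l cmod (A i l) * cmod (B l j))).
  apply: ler_sum => j _; rewrite mxE; apply: le_trans (cmod_sum _ _ _) _.
  by apply: ler_sum => l _; rewrite cmodM.
rewrite exchange_big /= mulr_suml; apply: ler_sum => l _.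
rewrite -mulr_sumr; apply: ler_wpM2l; first exact: cmod_ge0.
rewrite (bigD1 l) //= lerDl.
by apply: sumr_ge0 => *; apply: sumr_ge0 => *; apply: cmod_ge0.
Qed.

Lemma n1_adj p q (A : 'M[C]_(p, q)) : n1 (A ^t*) = n1 A.
Proof.
rewrite /n1 exchange_big; apply: eq_bigr => i _; apply: eq_bigr => j _.
by rewrite !mxE cmod_conj.
Qed.

Lemma n1_row_mx p q r (A : 'M[C]_(p, q)) (B : 'M[C]_(p, r)) :
  n1 (row_mx A B) = n1 A + n1 B.
Proof.
rewrite /n1 -big_split; apply: eq_bigr => i _; rewrite big_split_ord /=.
by congr (_ + _); apply: eq_bigr => j _; rewrite ?row_mxEl ?row_mxEr.
Qed.

(** The Neumann series, estimated to order zero, one and two. *)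
Lemma neumann k (X : 'M[C]_k) : n1 X <= 2^-1 ->
  [/\ 1%:M + X \in unitmx,
      n1 (invmx (1%:M + X)) <= 2 * n1 (1%:M : 'M[C]_k),
      n1 (invmx (1%:M + X) - 1%:M) <= 2 * n1 (1%:M : 'M[C]_k) * n1 X &
      n1 (invmx (1%:M + X) - 1%:M + X) <= 2 * n1 (1%:M : 'M[C]_k) * n1 X ^+ 2].
Proof.
move=> hX; have uX : 1%:M + X \in unitmx.
  rewrite -row_free_unit -kermx_eq0; apply/eqP/row_matrixP => i; rewrite row0.
  set v := row i _; have : v *m (1%:M + X) = 0.
    by rewrite /v -row_mul mulmx_ker row0.
  rewrite mulmxDr mulmx1 => /eqP; rewrite addr_eq0 => /eqP vX.
  apply: n1_le0; have := n1M v X; rewrite -n1N -vX.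
  have := ler_wpM2l (n1_ge0 v) hX; have := n1_ge0 v; lra.
set Y := invmx _; have E1 : Y = 1%:M - Y *m X.
  by apply/eqP; rewrite eq_sym subr_eq -{1}(mulVmx uX) mulmxDr mulmx1.
have bY : n1 Y <= 2 * n1 (1%:M : 'M[C]_k).
  have := n1B 1%:M (Y *m X); rewrite -E1; have := n1M Y X.
  have := ler_wpM2l (n1_ge0 Y) hX; lra.
have E2 : Y - 1%:M = - (Y *m X) by apply/eqP; rewrite subr_eq addrC -E1.
have E3 : Y *m X = X - Y *m X *m X.
  by have := congr1 (mulmx^~ X) E1; rewrite mulmxBl mul1mx.
split=> //.
  by rewrite E2 n1N; apply: le_trans (n1M _ _) _; rewrite ler_wpM2r // n1_ge0.
have -> : Y - 1%:M + X = Y *m X *m X by rewrite E2 addrC {1}E3 opprB addrC subrK.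
apply: le_trans (n1M _ _) _; rewrite expr2 mulrA; apply: ler_wpM2r; first exact: n1_ge0.
by apply: le_trans (n1M _ _) _; rewrite ler_wpM2r // n1_ge0.
Qed.

Lemma geometric_cvg (u : nat -> R) (c : R) : 0 <= c ->
  (forall k, `|u k.+1 - u k| <= c * 2^-1 ^+ k) ->
  exists l, forall k, `|u k - l| <= 2 * c * 2^-1 ^+ k.
Proof.
move=> c0 H; pose d k : R := 2 * c * 2^-1 ^+ k.
have d0 k : 0 <= d k by rewrite /d !mulr_ge0 ?exprn_ge0.
have dS k : d k.+1 = c * 2^-1 ^+ k by rewrite /d exprS; field.
have dS2 k : d k = d k.+1 + d k.+1 by rewrite /d exprS; field.
have a_mono : {homo (fun k => u k - d k) : i j / (i <= j)%N >-> i <= j}.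
  apply: homo_leq => [x|y x z|k]; [exact: lexx|exact: le_trans|].
  by have := H k; rewrite -dS ler_norml (dS2 k) => /andP[]; lra.
have b_mono : {homo (fun k => u k + d k) : i j / (i <= j)%N >-> j <= i}.
  apply: homo_leq => [x|y x z H1 H2|k]; [exact: lexx|exact: le_trans H2 H1|].
  by have := H k; rewrite -dS ler_norml (dS2 k) => /andP[]; lra.
pose S := range (fun k => u k - d k).
have ub k : ubound S (u k + d k).
  move=> _ [i _ <-]; have := a_mono _ _ (leq_maxl i k); have := b_mono _ _ (leq_maxr i k).
  by have := d0 (maxn i k); lra.
have S0 : S !=set0 by exists (u 0%N - d 0%N); exists 0%N.
exists (sup S) => k; rewrite -/(d k) ler_norml.
have h1 : sup S <= u k + d k by apply: ge_sup.
have h2 : u k - d k <= sup S.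
  by apply: ub_le_sup; [exists (u 0%N + d 0%N)|exists k].
by lra.
Qed.

Lemma geometric_cvg_mx p q (w : nat -> 'M[C]_(p, q)) (c : R) : 0 <= c ->
  (forall k, n1 (w k.+1 - w k) <= c * 2^-1 ^+ k) ->
  exists l, exists2 K, 0 <= K & forall k, n1 (w k - l) <= K * 2^-1 ^+ k.
Proof.
move=> c0 H.
have cE i j : exists l : C, forall k, cmod (w k i j - l) <= 4 * c * 2^-1 ^+ k.
  have Hij k : cmod (w k.+1 i j - w k i j) <= c * 2^-1 ^+ k.
    by apply: le_trans (H k); have := n1_entry (w k.+1 - w k) i j; rewrite !mxE.
  have [|a Ha] := @geometric_cvg (fun k => complex.Re (w k i j)) c c0.
    by move=> k; rewrite -raddfB; apply: le_trans (Re_le_cmod _) (Hij k).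
  have [|b Hb] := @geometric_cvg (fun k => complex.Im (w k i j)) c c0.
    by move=> k; rewrite -raddfB; apply: le_trans (Im_le_cmod _) (Hij k).
  exists (Complex a b) => k; apply: le_trans (cmod_le_ReIm _) _.
  rewrite !raddfB /=; have := Ha k; have := Hb k; lra.
have /choice[l Hl] : forall i, exists l : 'I_q -> C,
    forall j k, cmod (w k i j - l j) <= 4 * c * 2^-1 ^+ k.
  by move=> i; have [l Hl] := choice (cE i); exists l.
exists (\matrix_(i, j) l i j), ((4 * c) *+ q *+ p).
  by rewrite !mulrn_wge0 // mulr_ge0.
move=> k; rewrite /n1.
apply: (@le_trans _ _ (\sum_(i < p) \sum_(j < q) (4 * c * 2^-1 ^+ k))).
  by apply: ler_sum => i _; apply: ler_sum => j _; rewrite !mxE.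
by rewrite !sumr_const !card_ord !mulrnAl.
Qed.

Lemma half_exp_small (K e : R) : 0 <= K -> 0 < e -> exists k, K * 2^-1 ^+ k < e.
Proof.
move=> K0 e0; pose k := Num.bound (K / e); exists k.
have h : K / e < k%:R by apply: archi_boundP; rewrite divr_ge0 // ltW.
have : K < 2 ^+ k * e.
  rewrite -ltr_pdivrMr //; apply: lt_le_trans h _.
  rewrite -natrX ler_nat; exact/ltnW/ltn_expl.
by rewrite exprVn ltr_pdivrMr ?exprn_gt0 // mulrC.
Qed.

(** The Banach fixed point theorem on a closed ball for the contraction
    factor 1/2; the last hypothesis keeps the iteration in the ball. *)
Lemma contraction_fixpoint p q (T : 'M[C]_(p, q) -> 'M[C]_(p, q)) z (r : R) : 0 <= r ->
  (forall w w', n1 (w - z) <= r -> n1 (w' - z) <= r ->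
     n1 (T w - T w') <= 2^-1 * n1 (w - w')) ->
  n1 (T z - z) <= r / 2 -> exists2 w, n1 (w - z) <= r & T w = w.
Proof.
move=> r0 HT Hz; pose w k := iter k T z.
have zr : n1 (z - z) <= r by rewrite subrr n1_0.
have Tr x : n1 (x - z) <= r -> n1 (T x - z) <= r.
  move=> xr; have := n1_tri (T z) (T x) z; have := HT _ _ xr zr; lra.
have wr k : n1 (w k - z) <= r by elim: k => [//|k /Tr].
have wS k : n1 (w k.+1 - w k) <= r / 2 * 2^-1 ^+ k.
  elim: k => [|k IH]; first by rewrite expr0 mulr1.
  have := HT _ _ (wr k.+1) (wr k); rewrite exprS -/(w k.+2) -/(w k.+1); lra.
have [|l [K K0 Hl]] := geometric_cvg_mx _ wS; first by rewrite divr_ge0.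
have lr : n1 (l - z) <= r.
  rewrite leNgt; apply/negP => lt.
  have [k Hk] := half_exp_small K0 (e := n1 (l - z) - r) ltac:(by rewrite subr_gt0).
  have := n1_tri (w k) l z; have := Hl k; rewrite n1C; have := wr k; lra.
exists l => //; apply/eqP; rewrite -subr_eq0; apply/eqP/n1_le0; rewrite leNgt.
apply/negP => lt; have [k Hk] := half_exp_small K0 (e := n1 (T l - l) / 2) ltac:(by rewrite divr_gt0).
have := n1_tri (w k.+1) (T l) l; have := Hl k.+1; have := HT _ _ lr (wr k).
rewrite -/(w k.+1) exprS n1C; have := Hl k; rewrite (n1C (w k) l).
have : 0 <= 2^-1 ^+ k :> R by rewrite exprn_ge0.
rewrite (n1C _ l); nra.
Qed.
End EntrySumNorm.

(** * Polynomial estimates and Newton iteration *)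

Section PolynomialEstimates.
Context {R : realType} {n : nat}.
Local Notation C := (Cplx R).
Local Notation V := 'rV[C]_n.+1.
Local Notation poly := (mpoly.mpoly n.+1 C).
Local Notation mconst := (@mpoly.mpolyC n.+1 C : {rmorphism C -> poly}).
Local Notation eval := (@Defs.eval R n).

Lemma dirderX (w u : V) (i : 'I_n.+1) :
  dirder w u (mpoly.mpolyX C (mpoly.mnm1 i)) = u 0 i.
Proof.
rewrite dirderE (bigD1 i) //= big1 ?addr0 => [|j ji]; last first.
  rewrite mpoly.mderivX mpoly.mnm1E eq_sym (negPf ji) scale0r.
  by rewrite /Defs.eval rmorph0 mulr0.
rewrite mpoly.mderivX.
have -> : mpoly.mnm_sub (mpoly.mnm1 i) (mpoly.mnm1 i) = @mpoly.mnm0 n.+1.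
  by apply/mpoly.mnmP => j; rewrite mpoly.mnmBE subnn mpoly.mnm0E.
by rewrite mpoly.mnm1E eqxx scale1r mpoly.mpolyX0 /Defs.eval rmorph1 mulr1.
Qed.

Lemma dirderBu (w u v : V) f : dirder w (u - v) f = dirder w u f - dirder w v f.
Proof. by rewrite /dirder mulmxBl !mxE. Qed.

(** By induction on the polynomial, since the four bounds on a ball are
    compatible with sums and products. *)
Lemma poly_estimates (f : poly) (r : R) : 0 <= r ->
  exists2 K, 0 <= K & forall w w' : V, n1 w <= r -> n1 w' <= r ->
    [/\ cmod (eval f w) <= K,
        cmod (eval f w' - eval f w) <= K * n1 (w' - w),
        forall u, cmod (dirder w u f) <= K * n1 u &
        cmod (eval f w' - eval f w - dirder w (w' - w) f) <= K * n1 (w' - w) ^+ 2].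
Proof.
move=> r0.
have sum_le (a b : C) a' b' : cmod a <= a' -> cmod b <= b' -> cmod (a + b) <= a' + b'.
  by move=> h1 h2; apply: le_trans (cmodD a b) _; apply: lerD.
have pr (a b : C) a' b' : cmod a <= a' -> cmod b <= b' -> cmod (a * b) <= a' * b'.
  by move=> h1 h2; rewrite cmodM ler_pM ?cmod_ge0.
have num1 (x : R) : 0 <= x -> x <= 3 * x by lra.
have num2 (x y t : R) : 0 <= x * y * t -> x * (y * t) + y * (x * t) <= 3 * (x * y) * t by lra.
have num3 (x y t : R) :
  x * (y * t ^+ 2) + (y * (x * t ^+ 2) + x * t * (y * t)) <= 3 * (x * y) * t ^+ 2 by lra.
have sum_quad (a a' b b' d e : C) :
  a' + b' - (a + b) - (d + e) = (a' - a - d) + (b' - b - e) by ring.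
have prod_lip (a a' b b' : C) : a' * b' - a * b = a' * (b' - b) + b * (a' - a) by ring.
have prod_quad (a a' b b' d e : C) : a' * b' - a * b - (a * e + b * d) =
  a' * (b' - b - e) + (b * (a' - a - d) + (a' - a) * e) by ring.
move: f; apply: (@mpoly_alg_ind R n) => [c|i|f g|f g].
- exists (cmod c); first exact: cmod_ge0.
  move=> w w' _ _; rewrite /Defs.eval !mpoly.mevalC subrr cmod0.
  have c0 := cmod_ge0 c; split=> // [|u|].
  + by rewrite mulr_ge0 // n1_ge0.
  + by rewrite dirderC cmod0 mulr_ge0 // n1_ge0.
  + by rewrite dirderC subrr cmod0 mulr_ge0 // exprn_ge0 // n1_ge0.
- exists (r + 1); first by rewrite addr_ge0.
  move=> w w' hw hw'; rewrite /Defs.eval !mpoly.mevalXU.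
  have le (u : V) : cmod (u 0 i) <= (r + 1) * n1 u.
    apply: le_trans (n1_entry u 0 i) _; rewrite ler_peMl ?n1_ge0 // lerDr //.
  split=> // [||u|].
  + by have := n1_entry w 0 i; lra.
  + by have := le (w' - w); rewrite !mxE.
  + by rewrite dirderX; apply: le.
  + rewrite dirderX !mxE subrr cmod0 mulr_ge0 ?exprn_ge0 ?n1_ge0 //; lra.
- move=> [K K0 HK] [L L0 HL]; exists (K + L); first by rewrite addr_ge0.
  move=> w w' hw hw'; have [a1 a2 a3 a4] := HK w w' hw hw'.
  have [b1 b2 b3 b4] := HL w w' hw hw'.
  rewrite !evalD dirderD mulrDl mulrDl; split.
  + exact: sum_le a1 b1.
  + by rewrite opprD addrACA; apply: sum_le a2 b2.
  + by move=> u; rewrite dirderD mulrDl; apply: sum_le (a3 u) (b3 u).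
  + by rewrite sum_quad; apply: sum_le a4 b4.
- move=> [K K0 HK] [L L0 HL]; exists (3 * (K * L)).
    by rewrite !mulr_ge0.
  move=> w w' hw hw'; have [a1 a2 a3 a4] := HK w w' hw hw'.
  have [b1 b2 b3 b4] := HL w w' hw hw'.
  have [c1 _ _ _] := HK w' w hw' hw.
  have KL : 0 <= K * L by rewrite mulr_ge0.
  rewrite !evalM dirderM.
  have N0 := n1_ge0 (w' - w).
  split.
  + by apply: le_trans (pr _ _ _ _ a1 b1) _; apply: num1.
  + rewrite prod_lip.
    apply: le_trans (sum_le _ _ _ _ (pr _ _ _ _ c1 b2) (pr _ _ _ _ b1 a2)) _.
    by apply: num2; rewrite // mulr_ge0.
  + move=> u; rewrite dirderM.
    apply: le_trans (sum_le _ _ _ _ (pr _ _ _ _ a1 (b3 u)) (pr _ _ _ _ b1 (a3 u))) _.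
    by apply: num2; rewrite // mulr_ge0 // n1_ge0.
  + rewrite prod_quad.
    apply: le_trans (sum_le _ _ _ _ (pr _ _ _ _ c1 b4)
      (sum_le _ _ _ _ (pr _ _ _ _ b1 a4) (pr _ _ _ _ a2 (b3 (w' - w))))) _.
    exact: num3.
Qed.

Lemma dirder_lipschitz (f : poly) (r : R) : 0 <= r ->
  exists2 K, 0 <= K & forall w w' u : V, n1 w <= r -> n1 w' <= r ->
    cmod (dirder w' u f - dirder w u f) <= K * n1 (w' - w) * n1 u.
Proof.
move=> r0; have /choice[K HK] : forall i : 'I_n.+1, exists K, 0 <= K /\
    forall w w' : V, n1 w <= r -> n1 w' <= r ->
    cmod (eval (mpoly.mderiv i f) w' - eval (mpoly.mderiv i f) w) <= K * n1 (w' - w).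
  move=> i; have [K K0 HK] := poly_estimates (mpoly.mderiv i f) r0.
  by exists K; split=> // w w' hw hw'; have [] := HK w w' hw hw'.
have K0 : 0 <= \sum_i K i by apply: sumr_ge0 => i _; have [] := HK i.
exists (\sum_i K i) => // w w' u hw hw'.
rewrite !dirderE -sumrB; apply: le_trans (cmod_sum _ _ _) _.
rewrite !mulr_suml; apply: ler_sum => i _; rewrite -mulrBr cmodM mulrC.
have [Ki HKi] := HK i; apply: ler_pM; rewrite ?cmod_ge0 //; first exact: HKi.
exact: n1_entry.
Qed.

End PolynomialEstimates.

Lemma row_mxB (W : zmodType) p q r (A A' : 'M[W]_(p, q)) (B B' : 'M[W]_(p, r)) :
  row_mx A B - row_mx A' B' = row_mx (A - A') (B - B').
Proof. by rewrite opp_row_mx add_row_mx. Qed.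

Lemma n1_diameter (R : realType) p q (w w' z : 'M[Cplx R]_(p, q)) (r : R) :
  n1 (w - z) <= r -> n1 (w' - z) <= r -> n1 (w - w') <= 2 * r.
Proof. by move=> h h'; have := n1_tri z w w'; rewrite (n1C z); lra. Qed.

Lemma newton_bound (R : realType) (K r u a e b x y : R) : 0 <= a ->
  x <= K * (3 * r) * u -> y <= u * e * b ->
  K * r * a * u <= 2^-1 ^+ 3 * u -> u * e * b * a <= 2^-1 ^+ 3 * u ->
  (x + y) * a <= 2^-1 * u.
Proof. by move=> a0 hx hy h1 h2; have := ler_wpM2r a0 (lerD hx hy); lra. Qed.

(** The difference quotient of F against its derivative at z: a first error
    from moving the base point, a second one from the quadratic remainder.
    *)
Lemma secant_bound (R : realType) (K r u v : R) : 0 <= K -> 0 <= u -> u <= 2 * r ->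
  v <= r -> K * v * u + K * u ^+ 2 <= K * (3 * r) * u.
Proof.
move=> K0 u0 ur vr; have Ku : 0 <= K * u by rewrite mulr_ge0.
have := ler_wpM2l Ku (lerD vr ur); lra.
Qed.

Lemma sub_shift (W : zmodType) (w w' X X' Y : W) :
  w - w' - (X - X') = w - (X - Y) - (w' - (X' - Y)).
Proof.
rewrite (opprB w') (opprB X Y) (opprB X X') -[LHS]addrA -[RHS]addrA; congr (_ + _).
by rewrite [RHS]addrC (addrAC X') [RHS]addrA subrK addrCA addrA.
Qed.

Section LocalEquations.
Context {R : realType} {n c m : nat}.
Local Notation C := (Cplx R).
Local Notation V := 'rV[C]_n.+1.
Local Notation poly := (mpoly.mpoly n.+1 C).
Local Notation mconst := (@mpoly.mpolyC n.+1 C : {rmorphism C -> poly}).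
Local Notation eval := (@Defs.eval R n).
Variables (F : 'I_c -> poly) (E : 'M[C]_(n.+1, m.+1)) (z : V).

Definition gradmx (w : V) : 'M[C]_(n.+1, c) := \matrix_(j, i) eval (mpoly.mderiv j (F i)) w.

Definition eqvec (w : V) : 'rV[C]_c := \row_i eval (F i) w.

Lemma mul_gradmx w u : u *m gradmx w = \row_i dirder w u (F i).
Proof. by apply/rowP => i; rewrite !mxE dirderE; apply: eq_bigr => j _; rewrite mxE. Qed.

Lemma eqvec_estimates (r : R) : 0 <= r ->
  exists2 K, 0 <= K & forall w w' : V, n1 w <= r -> n1 w' <= r ->
    n1 (eqvec w' - eqvec w - (w' - w) *m gradmx w) <= K * n1 (w' - w) ^+ 2 /\
    forall u : V, n1 (u *m gradmx w' - u *m gradmx w) <= K * n1 (w' - w) * n1 u.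
Proof.
move=> r0; have /choice[K HK] : forall i : 'I_c, exists K, 0 <= K /\
    forall w w' : V, n1 w <= r -> n1 w' <= r ->
    cmod (eval (F i) w' - eval (F i) w - dirder w (w' - w) (F i)) <= K * n1 (w' - w) ^+ 2 /\
    forall u, cmod (dirder w' u (F i) - dirder w u (F i)) <= K * n1 (w' - w) * n1 u.
  move=> i; have [K K0 HK] := poly_estimates (F i) r0.
  have [L L0 HL] := dirder_lipschitz (F i) r0; exists (K + L); split.
    by rewrite addr_ge0.
  move=> w w' hw hw'; have [_ _ _ h] := HK w w' hw hw'; split.
    apply: le_trans h _; rewrite ler_wpM2r ?exprn_ge0 ?n1_ge0 //; lra.
  move=> u; apply: le_trans (HL w w' u hw hw') _.
  by rewrite !ler_wpM2r ?n1_ge0 //; lra.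
exists (\sum_i K i); first by apply: sumr_ge0 => i _; have [] := HK i.
move=> w w' hw hw'; split.
  rewrite mul_gradmx /n1 big_ord1 mulr_suml; apply: ler_sum => i _; rewrite !mxE.
  by have [_ /(_ w w' hw hw')[]] := HK i.
move=> u; rewrite !mul_gradmx /n1 big_ord1 !mulr_suml; apply: ler_sum => i _.
by rewrite !mxE; have [_ /(_ w w' hw hw')[_ /(_ u)]] := HK i.
Qed.

(** The zeros of F that lie on the graph of A and have the same inner
    product with z as z itself; the columns of E are equations of the
    tangent space of L at z. *)
Definition system (A : 'M[C]_n.+1) (w : V) : 'rV[C]_(c + m.+1) :=
  row_mx (eqvec w) ((w - z - w *m A) *m E).

Definition dsystem (A : 'M[C]_n.+1) (w u : V) : 'rV[C]_(c + m.+1) :=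
  row_mx (u *m gradmx w) ((u - u *m A) *m E).

Variable N : 'M[C]_(c + m.+1, n.+1).
Hypothesis LN : row_mx (gradmx z) E *m N = 1%:M.
Hypothesis NL : N *m row_mx (gradmx z) E = 1%:M.
Hypothesis Fz : eqvec z = 0.

(** What Newton's method provides: N inverts the derivative of the system at
    z up to a factor 1/2, uniformly in points and parameters, hence the
    system is injective, its derivative is invertible, and it is solvable.
    *)
Definition good_radius (r e : R) : Prop :=
  [/\ 0 < r, 0 < e,
   forall A w w', n1 A <= e -> n1 (w - z) <= r -> n1 (w' - z) <= r ->
     n1 ((w - w') - (system A w - system A w') *m N) <= 2^-1 * n1 (w - w'),
   forall A w u, n1 A <= e -> n1 (w - z) <= r ->
     n1 (u - dsystem A w u *m N) <= 2^-1 * n1 u &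
   forall A y, n1 A <= e -> n1 y <= e ->
     exists2 w, n1 (w - z) <= r & system A w = row_mx 0 y].

(** The simplified Newton map, with the inverse N of the derivative at z and
    A = 0, is a contraction for all points near z and all small A. *)
Lemma solve_system (r0 : R) : 0 < r0 -> exists r e, r <= r0 /\ good_radius r e.
Proof.
move=> r00; pose a := n1 N; pose b := n1 E; pose d := n1 z.
have a0 : 0 <= a by apply: n1_ge0.
have b0 : 0 <= b by apply: n1_ge0.
have d0 : 0 <= d by apply: n1_ge0.
have [|K K0 HK] := @eqvec_estimates (d + 1); first by rewrite addr_ge0.
(* With K r a and e b a at most 1/8 the remainder costs at most 3/8 and the
   parameter A at most 1/8 of the increment, in total the contraction factor
   1/2. *)
pose r := Num.min (Num.min r0 1) (2^-1 ^+ 3 / ((K + 1) * (a + 1))).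
have Ka : 0 < (K + 1) * (a + 1) by rewrite mulr_gt0 // ltr_wpDl.
have r_gt0 : 0 < r.
  by rewrite /r !lt_min r00 ltr01 /= divr_gt0 // exprn_gt0.
have [rr0 r1] : r <= r0 /\ r <= 1 by rewrite /r; split; rewrite !ge_min lexx ?orbT.
have rK : (K * r) * a <= 2^-1 ^+ 3.
  have : r <= 2^-1 ^+ 3 / ((K + 1) * (a + 1)) by rewrite /r ge_min lexx orbT.
  rewrite ler_pdivlMr // => h; apply: le_trans h.
  by have := mulr_ge0 (ltW r_gt0) K0; have := mulr_ge0 (ltW r_gt0) a0; nra.
pose q := (d + 1) * (b + 1) * (a + 1).
have q0 : 0 < q by rewrite !mulr_gt0 // ltr_wpDl.
pose e := Num.min (2^-1 ^+ 3) (r / 4) / q.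
have e0 : 0 < e by rewrite divr_gt0 // lt_min exprn_gt0 //= divr_gt0.
have eq : e * q <= 2^-1 ^+ 3 /\ e * q <= r / 4.
  by rewrite /e divfK ?gt_eqF //; split; rewrite ge_min lexx ?orbT.
have ba : (b + 1) * (a + 1) <= q.
  have : 0 <= (b + 1) * (a + 1) by rewrite mulr_ge0 // addr_ge0.
  by rewrite /q -mulrA; nra.
have eba : e * ((b + 1) * (a + 1)) <= 2^-1 ^+ 3.
  by case: eq => h _; apply: le_trans h; rewrite ler_pM2l.
have inball w : n1 (w - z) <= r -> n1 w <= d + 1.
  by move=> h; have := n1D (w - z) z; rewrite subrK -/d; lra.
have zball : n1 z <= d + 1 by rewrite -/d; lra.
have eab x : 0 <= x -> x * e * b * a <= 2^-1 ^+ 3 * x.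
  move=> x0; apply: (@le_trans _ _ (e * ((b + 1) * (a + 1)) * x)); last by rewrite ler_wpM2r.
  have -> : x * e * b * a = (e * (b * a)) * x by ring.
  rewrite ler_wpM2r // ler_pM2l //; nra.
exists r, e; split=> //.
have part1 : forall A w w', n1 A <= e -> n1 (w - z) <= r -> n1 (w' - z) <= r ->
     n1 ((w - w') - (system A w - system A w') *m N) <= 2^-1 * n1 (w - w').
  move=> A w w' hA hw hw'; set u := w - w'.
  have uN : u = row_mx (u *m gradmx z) (u *m E) *m N.
    by rewrite -mul_mx_row -mulmxA LN mulmx1.
  have [h1 _] := HK w' w (inball _ hw') (inball _ hw).
  have [_ h2] := HK z w' zball (inball _ hw').
  have -> : u - (system A w - system A w') *m N =
     row_mx (u *m gradmx z - (eqvec w - eqvec w')) (u *m A *m E) *m N.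
    rewrite {1}uN -mulmxBl; congr (_ *m _).
    rewrite /system !row_mxB; congr row_mx.
    rewrite -mulmxBl -mulmxBl; congr (_ *m _).
    have -> : w - z - w *m A - (w' - z - w' *m A) = u - u *m A.
      rewrite /u mulmxBl; apply/rowP => i; rewrite !mxE; ring.
    by rewrite opprB addrC subrK.
  apply: le_trans (n1M _ _) _; rewrite n1_row_mx -/a.
  have g1 : n1 (u *m gradmx z - (eqvec w - eqvec w')) <= K * (3 * r) * n1 u.
    apply: le_trans (n1_tri (u *m gradmx w') _ _) _.
    rewrite n1C; apply: le_trans (lerD (h2 u) _) _; first by rewrite n1C; exact: h1.
    rewrite -/u; apply: secant_bound => //; first exact: n1_ge0.
    exact: n1_diameter hw hw'.
  have g2 : n1 (u *m A *m E) <= n1 u * e * b.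
    apply: le_trans (n1M _ _) _; rewrite ler_wpM2r //.
    by apply: le_trans (n1M _ _) _; rewrite ler_wpM2l // n1_ge0.
  have u0 := n1_ge0 u.
  apply: newton_bound g1 g2 _ (eab _ u0) => //.
  by apply: ler_wpM2r.
split=> //.
- move=> A w u hA hw.
  have [_ h2] := HK z w zball (inball _ hw).
  have uN : u = row_mx (u *m gradmx z) (u *m E) *m N.
    by rewrite -mul_mx_row -mulmxA LN mulmx1.
  have -> : u - dsystem A w u *m N =
     row_mx (u *m gradmx z - u *m gradmx w) (u *m A *m E) *m N.
    rewrite {1}uN -mulmxBl; congr (_ *m _).
    rewrite /dsystem row_mxB; congr row_mx.
    by rewrite -mulmxBl opprB addrC subrK.
  apply: le_trans (n1M _ _) _; rewrite n1_row_mx -/a n1C.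
  have g2 : n1 (u *m A *m E) <= n1 u * e * b.
    apply: le_trans (n1M _ _) _; rewrite ler_wpM2r //.
    by apply: le_trans (n1M _ _) _; rewrite ler_wpM2l // n1_ge0.
  have u0 := n1_ge0 u.
  have g1 : n1 (u *m gradmx w - u *m gradmx z) <= K * (3 * r) * n1 u.
    by apply: le_trans (h2 u) _; apply: ler_wpM2r => //; apply: ler_wpM2l => //; lra.
  apply: newton_bound g1 g2 _ (eab _ u0) => //.
  by apply: ler_wpM2r.
- move=> A y hA hy; pose T w := w - (system A w - row_mx 0 y) *m N.
  have [||w wr Tw] := @contraction_fixpoint _ _ _ T z r (ltW r_gt0).
  + move=> w w' hw hw'; have := part1 A w w' hA hw hw'.
    congr (n1 _ <= _); rewrite /T.
    move: (system A w) (system A w') => S S'.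
    by rewrite (mulmxBl S) (mulmxBl S) (mulmxBl S'); apply: sub_shift.
  + rewrite /T addrAC subrr sub0r n1N.
    have -> : system A z - row_mx 0 y = row_mx 0 (- (z *m A *m E) - y).
      by rewrite /system Fz row_mxB subr0 subrr sub0r mulNmx.
    apply: le_trans (n1M _ _) _; rewrite n1_row_mx n1_0 add0r -/a.
    have g : n1 (- (z *m A *m E) - y) <= d * e * b + e.
      apply: le_trans (n1B _ _) _; rewrite n1N; apply: lerD => //.
      apply: le_trans (n1M _ _) _; rewrite ler_wpM2r //.
      by apply: le_trans (n1M _ _) _; rewrite ler_wpM2l.
    apply: (@le_trans _ _ (e * q)); last by case: eq => _; lra.
    apply: le_trans (ler_wpM2r a0 g) _.
    have -> : (d * e * b + e) * a = e * ((d * b + 1) * a) by ring.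
    rewrite ler_pM2l // /q; apply: ler_pM => //; rewrite ?addr_ge0 ?mulr_ge0 //; nra.
  exists w => //; apply/eqP; rewrite -subr_eq0.
  have : (system A w - row_mx 0 y) *m N = 0.
    by move: Tw; rewrite /T => /eqP; rewrite -subr_eq0 addrAC subrr sub0r oppr_eq0 => /eqP.
  by move/(congr1 (mulmx^~ (row_mx (gradmx z) E))); rewrite -mulmxA NL mulmx1 mul0mx => ->.
Qed.

End LocalEquations.

(** Multiplying out the recursion bounds s by b exp(a) / k for every k. *)
Lemma discrete_gronwall (R : realType) (s a b : R) : 0 <= a -> 0 <= b ->
  (forall k : nat, (0 < k)%N -> exists u : nat -> R, [/\ u 0%N = 0, u k = s &
     forall j, (j < k)%N -> u j.+1 <= u j * (1 + a / k%:R) + b / k%:R ^+ 2]) ->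
  s <= 0.
Proof.
move=> a0 b0 H; rewrite leNgt; apply/negP => s0.
pose k := (Num.bound (expR a * b / s)).+1.
have k0 : 0 < k%:R :> R by rewrite ltr0n.
have [u [u0 uk uS]] := H k isT.
have q1 : 1 <= 1 + a / k%:R by rewrite lerDl divr_ge0.
have q0 : 0 <= 1 + a / k%:R by apply: le_trans q1.
have b2 : 0 <= b / k%:R ^+ 2 by rewrite divr_ge0 // exprn_ge0.
have num (q qj be v jr : R) : v * q <= qj * (jr * be) * q -> 1 * be <= qj * q * be ->
    v * q + be <= qj * q * ((jr + 1) * be) by lra.
have bnd j : (j <= k)%N -> u j <= (1 + a / k%:R) ^+ j * (j%:R * (b / k%:R ^+ 2)).
  elim: j => [|j IH] jk; first by rewrite u0 mul0r mulr0.
  apply: le_trans (uS j jk) _.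
  move: (ler_wpM2r q0 (IH (ltnW jk))).
  have p1 : 1 <= (1 + a / k%:R) ^+ j.+1 by rewrite exprn_ege1.
  have := ler_wpM2r b2 p1; rewrite (exprSr _ j) -(natr1 j) => h2 h1; exact: num h1 h2.
have := bnd k (leqnn _); rewrite uk; apply/negP; rewrite -ltNge.
have e1 : (1 + a / k%:R) ^+ k <= expR a.
  apply: (@le_trans _ _ (expR (a / k%:R) ^+ k)).
    by rewrite lerXn2r ?nnegrE ?expR_ge0 // expR_ge1Dx.
  by rewrite -expRM_natl mulrC divfK ?gt_eqF.
apply: (@le_lt_trans _ _ (expR a * (b / k%:R))).
  rewrite ler_pM ?exprn_ge0 //.
    by rewrite mulr_ge0 // ler0n.
  have kn0 : k%:R != 0 :> R by rewrite gt_eqF.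
  rewrite le_eqVlt; apply/orP; left; apply/eqP; move: kn0; move: (k%:R) => t t0; by field.
rewrite mulrA ltr_pdivrMr // [ltRHS]mulrC -ltr_pdivrMr //.
have h : expR a * b / s < (Num.bound (expR a * b / s))%:R.
  by apply: archi_boundP; rewrite divr_ge0 ?mulr_ge0 ?expR_ge0 // ltW.
by apply: lt_le_trans h _; rewrite ler_nat.
Qed.

(** * Local equations cut out the variety near a smooth point *)

Section VarietyIsLocus.
Context {R : realType} {n c m : nat}.
Local Notation C := (Cplx R).
Local Notation V := 'rV[C]_n.+1.
Local Notation poly := (mpoly.mpoly n.+1 C).
Local Notation mconst := (@mpoly.mpolyC n.+1 C : {rmorphism C -> poly}).
Local Notation evalr w := (mpoly.meval ((w : V) 0) : {rmorphism poly -> C}).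
Local Notation eval := (@Defs.eval R n).
Variables (X : set V) (F : 'I_c -> poly) (E : 'M[C]_(n.+1, m.+1)) (z : V).
Variable N : 'M[C]_(c + m.+1, n.+1).
Hypothesis varX : proj_variety X.
Hypothesis chX : has_chain X m.
Hypothesis Xz : X z.
Hypothesis FX : forall i, ideal_of X (F i).
Hypothesis LN : row_mx (gradmx F z) E *m N = 1%:M.
Hypothesis NL : N *m row_mx (gradmx F z) E = 1%:M.
Hypothesis cm : (c + m.+1 = n.+1)%N.

(** With the determinant d of the differentials of F and the forms E against
    the matrix N, Cramer's rule expresses d df through them for every f. The
    coefficients of the forms E vanish on Z at generic points: there the
    tangent space has dimension m + 1, equal to that of the kernel of the
    differentials of F, so df vanishes on this kernel, while the forms E are
    independent on it. *)
Lemma conormal_generators : exists2 d : poly, eval d z != 0 & forall f, ideal_of X f ->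
  exists (l : 'I_c -> poly) (l' : 'I_m.+1 -> poly),
    (forall j, ideal_of X (l' j)) /\
    forall x u : V, eval d x * dirder x u f =
      \sum_i eval (l i) x * dirder x u (F i) + \sum_j eval (l' j) x * (u *m E) 0 j.
Proof.
pose Jp : 'M[poly]_(n.+1, c + m.+1) :=
  row_mx (\matrix_(j, i) mpoly.mderiv j (F i)) (map_mx mconst E).
pose Np : 'M[poly]_(c + m.+1, n.+1) := map_mx mconst N.
pose Sq := Jp *m Np; pose d := \det Sq.
have JpE x : map_mx (evalr x) Jp = row_mx (gradmx F x) E.
  rewrite /Jp map_row_mx; congr row_mx; apply/matrixP => i j; rewrite !mxE //.
  exact: evalC.
have NpE x : map_mx (evalr x) Np = N.
  by apply/matrixP => i j; rewrite !mxE; apply: evalC.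
have SqE x : map_mx (evalr x) Sq = row_mx (gradmx F x) E *m N.
  by rewrite map_mxM JpE NpE.
have dE x : eval d x = \det (row_mx (gradmx F x) E *m N).
  by rewrite -SqE det_map_mx.
exists d; first by rewrite dE LN det1 oner_neq0.
move=> f If.
pose g : 'cV[poly]_n.+1 := \col_j mpoly.mderiv j f.
pose lam := Np *m (\adj Sq *m g).
have lamE : Jp *m lam = d *: g.
  by rewrite /lam mulmxA mulmxA mul_mx_adj mul_scalar_mx.
have key x (u : V) : eval d x * dirder x u f =
    \sum_i eval (lam (lshift _ i) 0) x * dirder x u (F i) +
    \sum_j eval (lam (rshift _ j) 0) x * (u *m E) 0 j.
  have -> : eval d x * dirder x u f = (u *m map_mx (evalr x) (d *: g)) 0 0.
    rewrite dirderE mxE mulr_sumr; apply: eq_bigr => j _.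
    by rewrite !mxE mulrCA; congr (_ * _); rewrite -evalM.
  rewrite -lamE map_mxM JpE mulmxA mul_mx_row mxE big_split_ord /=.
  congr (_ + _); apply: eq_bigr => i _.
    by rewrite row_mxEl mul_gradmx !mxE mulrC.
  by rewrite row_mxEr [map_mx _ _ _ _]mxE mulrC.
exists (fun i => lam (lshift _ i) 0), (fun j => lam (rshift _ j) 0); split=> // j.
have [a Ia Ha] := generic_tangent varX chX.
have pI := ideal_of_prime varX; have [idI _ prI] := pI.
(* As d and a are not in the prime ideal, it suffices to consider points
   where neither vanishes. *)
suff H : ideal_of X (d * (a * lam (rshift c j) 0)).
  case: (prI _ _ H) => [Id|/prI[]//].
  by have := Id z Xz; rewrite dE LN det1 => /eqP; rewrite oner_eq0.
move=> p Xp; rewrite !evalM.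
have [->|dp] := eqVneq (eval d p) 0; first by rewrite mul0r.
have [->|ap] := eqVneq (eval a p) 0; first by rewrite mul0r mulr0.
have [K [rK HK]] := Ha p Xp ap.
set Jv := row_mx (gradmx F p) E; have uSq : Jv *m N \in unitmx.
  by rewrite unitmxE unitfE -dE.
have JvE : Jv = Jv *m N *m row_mx (gradmx F z) E by rewrite -mulmxA NL mulmx1.
pose M := N *m invmx (Jv *m N).
have MJ : M *m Jv = 1%:M by rewrite JvE /M -mulmxA [invmx _ *m _]mulmxA mulVmx // mul1mx NL.
have rJ : (c <= \rank (gradmx F p))%N.
  have eM : (1%:M : 'M[C]_c) = usubmx M *m gradmx F p.
    have /(congr1 lsubmx) := MJ; rewrite mul_mx_row row_mxKl => /(congr1 usubmx).
    by rewrite -mul_usub_mx (@scalar_mx_block _ c m.+1) block_mxEh row_mxKl col_mxKu.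
  by rewrite -{1}(mxrank1 C c) eM mxrankM_maxr.
(* The vector u is dual to the form j and is killed by the differentials of
   F. It is tangent, so evaluating the identity at u isolates the
   coefficient j. *)
pose e : 'rV[C]_(c + m.+1) := row_mx 0 (delta_mx 0 j); pose u := e *m M.
have uJ : u *m Jv = e by rewrite /u -mulmxA MJ mulmx1.
have [uj uE] : u *m gradmx F p = 0 /\ u *m E = delta_mx 0 j.
  by move: uJ; rewrite mul_mx_row => /eq_row_mx.
have uK : (u <= K)%MS.
  have sK : (K <= kermx (gradmx F p))%MS.
    apply/sub_kermxP/row_matrixP => i; rewrite row0 row_mul mul_gradmx.
    apply/rowP => l; rewrite !mxE rowE; exact: HK.
  have rk : (\rank (kermx (gradmx F p)) <= \rank K)%N.
    rewrite mxrank_ker; apply: leq_trans rK; rewrite leq_subLR.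
    by apply: leq_trans (eq_leq (esym cm)) _; rewrite leq_add2r.
  have := geq_leqif (mxrank_leqif_sup sK); rewrite rk => /esym kK.
  by apply: submx_trans kK; apply/sub_kermxP.
have [v uv] := submxP uK.
have := key p u; rewrite uv HK // mulr0 -uv uE big1 ?add0r => [|i _]; last first.
  by rewrite uv HK ?mulr0.
rewrite (bigD1 j) //= big1 ?addr0 => [|i ij]; last first.
  by rewrite [delta_mx _ _ _ _]mxE eqxx (negPf ij) mulr0.
by rewrite [delta_mx _ _ _ _]mxE !eqxx mulr1 => <-; rewrite !mulr0.
Qed.

(** Quantitative injectivity of the system. *)
Lemma n1_le_system r e A w w' : good_radius F E z N r e -> n1 A <= e ->
  n1 (w - z) <= r -> n1 (w' - z) <= r ->
  n1 (w - w') <= 2 * (n1 N * n1 (system F E z A w - system F E z A w')).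
Proof.
move=> [_ _ H _ _] hA hw hw'; have := H A w w' hA hw hw'.
set D := _ - _ *m N; have : n1 (w - w') <= n1 D + n1 ((system F E z A w - system F E z A w') *m N).
  by rewrite -{1}(subrK ((system F E z A w - system F E z A w') *m N) (w - w')) n1D.
have := n1M (system F E z A w - system F E z A w') N.
move: (n1 (_ *m N)) (n1 D) (n1 (w - w')) (n1 (_ - _)) (n1 N) => x y t s k; lra.
Qed.

Lemma one_step_bound (d0 x dl t2 : R) : 0 < d0 -> d0 / 2 * x <= dl -> dl <= t2 -> x <= 2 / d0 * t2.
Proof.
move=> d0p h1 h2; have := le_trans h1 h2.
by rewrite mulrAC ler_pdivrMr // mulrC -ler_pdivlMr // => h; apply: le_trans h _; lra.
Qed.

(** The zeros of F near z are parametrized by (w - z) E, so z and w are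
    joined by a path of zeros. The total size S of the generators of the
    ideal changes along a step of length t by at most a constant times S t +
    t^2, since their differentials are combinations of dF_i, which vanish to
    second order on zeros of F, and of forms with coefficients in the ideal.
    *)
Lemma locus_in_ideal : exists2 rho : R, 0 < rho & forall w : V, n1 (w - z) <= rho ->
  eqvec F w = 0 -> forall f, ideal_of X f -> eval f w = 0.
Proof.
have [d dz Hd] := conormal_generators.
have [s [sI sgen]] := hilbert_basis (mpoly_polysub (R := R) (n := n)) (ideal_ofP X).
(* The quantity S w bounds every member of the ideal at w up to a constant.
   *)
pose S w : R := \sum_(i < size s) cmod (eval s`_i w).
have S0 w : 0 <= S w by apply: sumr_ge0 => i _; apply: cmod_ge0.
pose d0 := cmod (eval d z).
have d0p : 0 < d0 by rewrite lt_neqAle eq_sym cmod_eq0 dz cmod_ge0.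
pose b := n1 z + 1.
have b0 : 0 <= b by rewrite addr_ge0 // n1_ge0.
have zb : n1 z <= b by rewrite lerDl.
have [Kd Kd0 HKd] := poly_estimates d b0.
pose r1 := Num.min 1 (d0 / 2 / (Kd + 1)).
have Kd1 : 0 < Kd + 1 by rewrite ltr_wpDl.
have r1p : 0 < r1 by rewrite lt_min ltr01 !divr_gt0.
have inb x : n1 (x - z) <= r1 -> n1 x <= b.
  move=> h; apply: (@le_trans _ _ (n1 (x - z) + n1 z)).
    by rewrite -{1}(subrK z x) n1D.
  by rewrite addrC lerD2l; apply: le_trans h _; rewrite ge_min lexx.
have dlow x : n1 (x - z) <= r1 -> d0 / 2 <= cmod (eval d x).
  move=> h; have [_ hl _ _] := HKd z x zb (inb _ h).
  have h1 : Kd * n1 (x - z) <= d0 / 2.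
    apply: (@le_trans _ _ ((Kd + 1) * r1)).
      by apply: ler_pM; rewrite ?n1_ge0 // lerDl.
    by rewrite mulrC -ler_pdivlMr // ge_min lexx orbT.
  have := cmodD (eval d x) (eval d z - eval d x); rewrite addrC subrK -/d0.
  rewrite -opprB cmodN => h2; have := le_trans hl h1; move: h2.
  move: (cmod (_ - _)) (cmod _) => p q; lra.
have bndI f : ideal_of X f -> exists2 B, 0 <= B &
    forall x, n1 (x - z) <= r1 -> cmod (eval f x) <= B * S x.
  move=> /sgen[h fE].
  have /choice[B HB] : forall i, exists B, 0 <= B /\
      forall x, n1 (x - z) <= r1 -> cmod (eval (h i) x) <= B.
    move=> i; have [K K0 HK] := poly_estimates (h i) b0; exists K; split=> // x xb.
    by have [] := HK x x (inb _ xb) (inb _ xb).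
  have B0 : 0 <= \sum_i B i by apply: sumr_ge0 => i _; have [] := HB i.
  exists (\sum_i B i) => // x xb.
  have -> : eval f x = \sum_i eval (h i) x * eval s`_i x.
    rewrite fE /Defs.eval rmorph_sum; apply: eq_bigr => i _; exact: evalM.
  apply: le_trans (cmod_sum _ _ _) _; rewrite mulr_suml; apply: ler_sum => i _.
  have [Bi HBi] := HB i; rewrite cmodM; apply: ler_pM; rewrite ?cmod_ge0 //.
    exact: HBi.
  by rewrite /S (bigD1 i) //= lerDl; apply: sumr_ge0 => *; apply: cmod_ge0.
have [KF KF0 HKF] := eqvec_estimates F b0.
(* The growth of a member of the ideal between two zeros of F. *)
have step1 f : ideal_of X f -> exists2 B, 0 <= B & forall x x' : V,
    n1 (x - z) <= r1 -> n1 (x' - z) <= r1 -> eqvec F x = 0 -> eqvec F x' = 0 ->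
    cmod (eval f x') <= cmod (eval f x) + B * (S x * n1 (x' - x) + n1 (x' - x) ^+ 2).
  move=> If; have [l [l' [Il' Hl]]] := Hd f If.
  have /choice[Kl HKl] : forall i, exists B, 0 <= B /\
      forall x, n1 (x - z) <= r1 -> cmod (eval (l i) x) <= B.
    move=> i; have [K K0 HK] := poly_estimates (l i) b0; exists K; split=> // x xb.
    by have [] := HK x x (inb _ xb) (inb _ xb).
  have /choice[Kl' HKl'] : forall j, exists B, 0 <= B /\
      forall x, n1 (x - z) <= r1 -> cmod (eval (l' j) x) <= B * S x.
    by move=> j; have [B B0 HB] := bndI _ (Il' j); exists B.
  have [Kf Kf0 HKf] := poly_estimates f b0.
  pose B1 := \sum_i Kl i; pose B2 := \sum_j Kl' j.
  have B10 : 0 <= B1 by apply: sumr_ge0 => i _; have [] := HKl i.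
  have B20 : 0 <= B2 by apply: sumr_ge0 => i _; have [] := HKl' i.
  have E0 : 0 <= n1 E by apply: n1_ge0.
  exists (Kf + 2 / d0 * (B1 * KF + B2 * n1 E)).
    apply: addr_ge0 => //; apply: mulr_ge0; first by rewrite divr_ge0 // ltW.
    by apply: addr_ge0; apply: mulr_ge0.
  move=> x x' hx hx' ex ex'; set u := x' - x; set t := n1 u.
  have t0 : 0 <= t by apply: n1_ge0.
  have [_ _ _ hq] := HKf x x' (inb _ hx) (inb _ hx').
  have hF i : cmod (dirder x u (F i)) <= KF * t ^+ 2.
    have [h _] := HKF x x' (inb _ hx) (inb _ hx').
    apply: le_trans h; rewrite ex ex' subrr sub0r n1N mul_gradmx.
    by have := n1_entry (\row_i dirder x u (F i)) 0 i; rewrite mxE.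
  have hd : cmod (dirder x u f) <= 2 / d0 * ((B1 * KF + B2 * n1 E) * (S x * t + t ^+ 2)).
    apply: (@one_step_bound _ _ (cmod (eval d x * dirder x u f))) => //.
      by rewrite cmodM; apply: ler_wpM2r; [apply: cmod_ge0|apply: dlow].
    rewrite Hl; apply: le_trans (cmodD _ _) _.
    apply: (@le_trans _ _ (B1 * KF * t ^+ 2 + B2 * n1 E * (S x * t))).
      apply: lerD.
        apply: le_trans (cmod_sum _ _ _) _; rewrite -mulrA mulr_suml.
        apply: ler_sum => i _; rewrite cmodM; have [_ h] := HKl i.
        by apply: ler_pM; rewrite ?cmod_ge0 //; apply: h.
      apply: le_trans (cmod_sum _ _ _) _; rewrite -mulrA mulr_suml.
      apply: ler_sum => j _; rewrite cmodM; have [h0 h] := HKl' j.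
      rewrite mulrCA mulrA mulrC -mulrA.
      have hE : cmod ((u *m E) 0 j) <= n1 E * t.
        by apply: le_trans (n1_entry _ _ _) _; rewrite mulrC; apply: n1M.
      rewrite [X in _ <= X](_ : _ = (Kl' j * S x) * (n1 E * t)); last by ring.
      by rewrite mulrC; apply: ler_pM; rewrite ?cmod_ge0 //; apply: h.
    rewrite mulrDl !mulrDr.
    have : 0 <= B1 * KF * (S x * t) by rewrite !mulr_ge0.
    have : 0 <= B2 * n1 E * t ^+ 2 by rewrite !mulr_ge0 // exprn_ge0.
    move: (B1 * _ * _) (B2 * _ * _) (B1 * _ * _) (B2 * _ * _) => ? ? ? ?; lra.
  have := cmodD (eval f x) (dirder x u f + (eval f x' - eval f x - dirder x u f)).
  have -> : eval f x + (dirder x u f + (eval f x' - eval f x - dirder x u f)) = eval f x'.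
    by rewrite [dirder _ _ _ + _]addrC subrK addrC subrK.
  have := cmodD (dirder x u f) (eval f x' - eval f x - dirder x u f).
  move: hq hd; rewrite -/u -/t mulrDl mulrA.
  have : 0 <= Kf * (S x * t) by rewrite !mulr_ge0.
  move: (cmod (_ + _)) (cmod (_ - _)) (cmod (dirder _ _ _)) (cmod (eval f x')) (cmod (eval f x)) => *.
  by lra.
have /choice[B HB] : forall i : 'I_(size s), exists B, 0 <= B /\ forall x x' : V,
    n1 (x - z) <= r1 -> n1 (x' - z) <= r1 -> eqvec F x = 0 -> eqvec F x' = 0 ->
    cmod (eval s`_i x') <= cmod (eval s`_i x) + B * (S x * n1 (x' - x) + n1 (x' - x) ^+ 2).
  by move=> i; have [B B0 HB] := step1 _ (sI _ (mem_nth 0 (ltn_ord i))); exists B.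
pose BB := \sum_i B i.
have BB0 : 0 <= BB by apply: sumr_ge0 => i _; have [] := HB i.
have step x x' : n1 (x - z) <= r1 -> n1 (x' - z) <= r1 -> eqvec F x = 0 -> eqvec F x' = 0 ->
    S x' <= S x + BB * (S x * n1 (x' - x) + n1 (x' - x) ^+ 2).
  move=> hx hx' ex ex'; rewrite /S mulr_suml -big_split /=.
  by apply: ler_sum => i _; have [_] := HB i; apply.
have Fz : eqvec F z = 0 by apply/rowP => i; rewrite !mxE; apply: FX.
have [r [e [rr1 gr]]] := solve_system LN NL Fz r1p.
have [r0 e0 _ _ Hsol] := gr.
pose rho := Num.min r (e / (n1 E + 1)).
have E1 : 0 < n1 E + 1 by rewrite ltr_wpDl // n1_ge0.
exists rho; first by rewrite lt_min r0 divr_gt0.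
move=> w hw Fw f If; suff Sw : S w <= 0.
  have [Bf Bf0 HBf] := bndI f If; apply/eqP; rewrite -cmod_eq0 eq_le cmod_ge0 andbT.
  have wr1 : n1 (w - z) <= r1.
    by apply: le_trans hw _; apply: le_trans rr1; rewrite ge_min lexx.
  by apply: le_trans (HBf w wr1) _; rewrite mulr_ge0_le0.
pose y := (w - z) *m E.
have ye : n1 y <= e.
  apply: le_trans (n1M _ _) _; apply: (@le_trans _ _ (rho * (n1 E + 1))).
    by apply: ler_pM; rewrite ?n1_ge0 // lerDl.
  by rewrite -ler_pdivlMr // ge_min lexx orbT.
have wr : n1 (w - z) <= r by apply: le_trans hw _; rewrite ge_min lexx.
have zr : n1 (z - z) <= r by rewrite subrr n1_0 ltW.
have A0 : n1 (0 : 'M[C]_n.+1) <= e by rewrite n1_0 ltW.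
pose tau := 2 * (n1 N * n1 y).
have tau0 : 0 <= tau by rewrite !mulr_ge0 ?n1_ge0.
apply: (@discrete_gronwall _ _ (BB * tau) (BB * tau ^+ 2)).
- by rewrite mulr_ge0.
- by rewrite mulr_ge0 // exprn_ge0.
move=> k k0.
have kp : 0 < k%:R :> R by rewrite ltr0n.
(* Points of the path over the multiples of y by j / k; the minimum keeps
   the factor at most 1 for the indices beyond k. *)
pose q j : C := ((Num.min (j%:R / k%:R) 1)%:C)%C.
have q1 j : cmod (q j) <= 1.
  by rewrite cmod_real ger0_norm ?ge_min ?lexx ?orbT // le_min ler01 andbT divr_ge0.
have /choice[x Hx] : forall j, exists x, n1 (x - z) <= r /\ system F E z 0 x = row_mx 0 (q j *: y).
  move=> j; have [|x xr xE] := Hsol 0 (q j *: y) A0.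
    by rewrite n1Z; apply: le_trans ye; rewrite ler_piMl ?n1_ge0.
  by exists x.
have sys0 x' : system F E z 0 x' = row_mx (eqvec F x') ((x' - z) *m E).
  by rewrite /system mulmx0 subr0.
have Fx j : eqvec F (x j) = 0.
  by have [_] := Hx j; rewrite sys0 => /eq_row_mx[].
have x0 : x 0%N = z.
  have [h1 h2] := Hx 0%N.
  apply/eqP; rewrite -subr_eq0; apply/eqP/n1_le0.
  apply: le_trans (n1_le_system gr A0 h1 zr) _.
  rewrite h2 sys0 Fz subrr mul0mx /q mul0r.
  have -> : Num.min 0 1 = 0 :> R by rewrite min_l.
  by rewrite rmorph0 scale0r subrr n1_0 !mulr0.
have xk : x k = w.
  have [h1 h2] := Hx k.
  apply/eqP; rewrite -subr_eq0; apply/eqP/n1_le0.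
  apply: le_trans (n1_le_system gr A0 h1 wr) _.
  rewrite h2 sys0 Fw /q divff ?gt_eqF //.
  have -> : Num.min 1 1 = 1 :> R by rewrite min_l.
  by rewrite rmorph1 scale1r subrr n1_0 !mulr0.
exists (fun j => S (x j)); rewrite x0 xk; split=> //.
  rewrite /S big1 // => i _; apply/eqP; rewrite cmod_eq0; apply/eqP.
  exact: sI (mem_nth 0 (ltn_ord i)) _ Xz.
move=> j jk; have [h1 e1] := Hx j; have [h2 e2] := Hx j.+1.
have ht : n1 (x j.+1 - x j) <= tau / k%:R.
  apply: le_trans (n1_le_system gr A0 h2 h1) _.
  rewrite e2 e1 row_mxB subrr -scalerBl n1_row_mx n1_0 add0r n1Z.
  have -> : q j.+1 - q j = ((k%:R^-1)%:C)%C.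
    rewrite /q -rmorphB /= !min_l; first by rewrite -mulrBl -natrB // subSnn mul1r.
      by rewrite ler_pdivrMr // mul1r ler_nat ltnW.
    by rewrite ler_pdivrMr // mul1r ler_nat.
  rewrite cmod_real ger0_norm ?invr_ge0 ?ler0n // /tau.
  by rewrite (mulrC k%:R^-1) !mulrA.
apply: le_trans (step _ _ (le_trans h1 rr1) (le_trans h2 rr1) (Fx j) (Fx j.+1)) _.
have t0 := n1_ge0 (x j.+1 - x j).
have g1 : S (x j) * n1 (x j.+1 - x j) <= S (x j) * (tau / k%:R) by apply: ler_wpM2l.
have g2 : n1 (x j.+1 - x j) ^+ 2 <= (tau / k%:R) ^+ 2.
  by rewrite lerXn2r ?nnegrE // divr_ge0.
have := ler_wpM2l BB0 (lerD g1 g2).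
rewrite expr_div_n; move: (n1 (_ - _)) (S _) (k%:R^-1) (k%:R ^- 2) => *; lra.
Qed.

End VarietyIsLocus.

(** * Hermitian inner products, norms and orthogonal projections *)

Section HermitianNorms.
Context {R : realType}.
Local Notation C := (Cplx R).

(** The inner product, and below the norms and the orthogonal projection,
    are replaced by opaque copies, so that no rewriting step unfolds them.
    *)
Lemma hdot_key k : {f : 'rV[C]_k -> 'rV[C]_k -> C | forall u v, f u v = dotmx u v}.
Proof. by exists (@dotmx _ k). Qed.

Definition hdot k := sval (hdot_key k).

Lemma hdot_dotmx k (u v : 'rV[C]_k) : hdot u v = dotmx u v.
Proof. exact: (svalP (hdot_key k)). Qed.

Lemma hdotE k (u v : 'rV[C]_k) : hdot u v = (u *m v ^t*) 0 0.
Proof. by rewrite hdot_dotmx dotmxE. Qed.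

Lemma adjmM p q r (A : 'M[C]_(p, q)) (B : 'M[C]_(q, r)) : (A *m B) ^t* = B ^t* *m A ^t*.
Proof. by rewrite trmx_mul map_mxM. Qed.

Lemma adjmD p q (A B : 'M[C]_(p, q)) : (A + B) ^t* = A ^t* + B ^t*.
Proof. by rewrite linearD map_mxD. Qed.

Lemma adjmZ p q a (A : 'M[C]_(p, q)) : (a *: A) ^t* = (a^* )%R *: A ^t*.
Proof. by rewrite linearZ map_mxZ. Qed.

Lemma adjmN p q (A : 'M[C]_(p, q)) : (- A) ^t* = - A ^t*.
Proof. by rewrite -scaleN1r adjmZ rmorphN1 scaleN1r. Qed.

Lemma adjmB p q (A B : 'M[C]_(p, q)) : (A - B) ^t* = A ^t* - B ^t*.
Proof. by rewrite adjmD adjmN. Qed.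

Lemma adjm1 p : (1%:M : 'M[C]_p) ^t* = 1%:M.
Proof. by rewrite trmx1 map_mx1. Qed.

Lemma adjm0 p q : (0 : 'M[C]_(p, q)) ^t* = 0.
Proof. by rewrite trmx0 map_mx0. Qed.

Section Dot.
Variable k : nat.
Implicit Types u v w : 'rV[C]_k.

Lemma dotDl u v w : hdot (u + v) w = hdot u w + hdot v w.
Proof. by rewrite !hdotE mulmxDl mxE. Qed.

Lemma dotDr u v w : hdot w (u + v) = hdot w u + hdot w v.
Proof. by rewrite !hdotE raddfD map_mxD mulmxDr mxE. Qed.

Lemma dotZl a u v : hdot (a *: u) v = a * hdot u v.
Proof. by rewrite !hdotE -scalemxAl mxE. Qed.

Lemma dotZr a u v : hdot u (a *: v) = (a^* )%R * hdot u v.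
Proof. by rewrite !hdotE linearZ map_mxZ -scalemxAr mxE. Qed.

Lemma dotNl u v : hdot (- u) v = - hdot u v.
Proof. by rewrite -scaleN1r dotZl mulN1r. Qed.

Lemma dotNr u v : hdot u (- v) = - hdot u v.
Proof. by rewrite -scaleN1r dotZr rmorphN1 mulN1r. Qed.

Lemma dotBl u v w : hdot (u - v) w = hdot u w - hdot v w.
Proof. by rewrite dotDl dotNl. Qed.

Lemma dotBr u v w : hdot w (u - v) = hdot w u - hdot w v.
Proof. by rewrite dotDr dotNr. Qed.

Lemma dot0l u : hdot 0 u = 0.
Proof. by rewrite -(scale0r u) dotZl mul0r. Qed.

Lemma dot0r u : hdot u 0 = 0.
Proof. by rewrite -(scale0r u) dotZr rmorph0 mul0r. Qed.

Lemma dotC u v : hdot u v = ((hdot v u)^* )%R.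
Proof.
rewrite !hdotE !mxE rmorph_sum; apply: eq_bigr => i _.
by rewrite !mxE rmorphM /= conjCK mulrC.
Qed.

Lemma dot_eq0C u v : hdot u v = 0 -> hdot v u = 0.
Proof. by move=> H; rewrite dotC H rmorph0. Qed.

Lemma dot_self u : hdot u u = ((\sum_i cmod (u 0 i) ^+ 2)%:C)%C.
Proof.
rewrite hdotE mxE rmorph_sum; apply: eq_bigr => i _.
by rewrite !mxE -normCK rmorphXn /= cmodE.
Qed.
End Dot.

Lemma dot_adj p q (u : 'rV[C]_p) (v : 'rV[C]_q) (A : 'M[C]_(p, q)) :
  hdot (u *m A) v = hdot u (v *m A ^t*).
Proof. by rewrite !hdotE trmx_mul map_mxM trmxCK mulmxA. Qed.

Lemma dot_ext p q (A B : 'M[C]_(p, q)) :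
  (forall u v, hdot (u *m A) v = hdot (u *m B) v) -> A = B.
Proof.
move=> H; apply/matrixP => i j.
have := H (delta_mx 0 i) (delta_mx 0 j); rewrite !hdotE -!rowE.
have -> : (delta_mx 0 j : 'rV[C]_q) ^t* = delta_mx j 0.
  by apply/matrixP => a b; rewrite !mxE /= rmorph_nat andbC.
by rewrite -!colE !mxE.
Qed.

Context {n : nat}.
Local Notation V := 'rV[C]_n.+1.
Local Notation M := 'M[C]_n.+1.
Implicit Types (u v w : V) (A B : M).

Lemma vnorm_key : {f : V -> R | forall v, f v = hnorm v}.
Proof. by exists hnorm. Qed.

Definition vnorm := sval vnorm_key.

Lemma vnormE v : vnorm v = hnorm v. Proof. exact: (svalP vnorm_key). Qed.

Lemma fnorm_key : {f : M -> R | forall A, f A = frobnorm A}.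
Proof. by exists frobnorm. Qed.

Definition fnorm := sval fnorm_key.

Lemma fnormE A : fnorm A = frobnorm A. Proof. exact: (svalP fnorm_key). Qed.

Lemma vnorm_sqE u : vnorm u ^+ 2 = \sum_i cmod (u 0 i) ^+ 2.
Proof.
rewrite vnormE /hnorm -hdot_dotmx dot_self /= sqr_sqrtr //.
by apply: sumr_ge0 => i _; rewrite exprn_ge0 // cmod_ge0.
Qed.

Lemma vnorm_sqRe u : vnorm u ^+ 2 = complex.Re (hdot u u).
Proof. by rewrite dot_self vnorm_sqE. Qed.

Lemma ReD (x y : C) : complex.Re (x + y) = complex.Re x + complex.Re y.
Proof. by case: x => a b; case: y. Qed.

Lemma complexRe_conj (x : C) : complex.Re ((x^* )%R : C) = complex.Re x.
Proof. by case: x. Qed.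

Lemma dot_vnorm u : hdot u u = ((vnorm u ^+ 2)%:C)%C.
Proof. by rewrite dot_self vnorm_sqE. Qed.

Lemma vnorm_ge0 u : 0 <= vnorm u. Proof. by rewrite vnormE sqrtr_ge0. Qed.

Lemma vnorm_eq0 u : (vnorm u == 0) = (u == 0).
Proof.
rewrite -(dnorm_eq0 (@dotmx _ n.+1)) /= -hdot_dotmx dot_vnorm -(inj_eq (@complexI R)).
by rewrite (inj_eq (@complexI R)) (inj_eq (@complexI R)) sqrf_eq0.
Qed.

Lemma vnorm0 : vnorm (0 : V) = 0. Proof. by apply/eqP; rewrite vnorm_eq0. Qed.

Lemma vnorm_gt0 u : (0 < vnorm u) = (u != 0).
Proof. by rewrite lt_def vnorm_eq0 vnorm_ge0 andbT. Qed.

Lemma eq_vnorm u (r : R) : 0 <= r -> vnorm u ^+ 2 = r ^+ 2 -> vnorm u = r.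
Proof. by move=> r0 /eqP; rewrite eqrXn2 ?vnorm_ge0 // => /eqP. Qed.

Lemma vnormZ a u : vnorm (a *: u) = cmod a * vnorm u.
Proof.
apply: eq_vnorm; first by rewrite mulr_ge0 ?vnorm_ge0 // cmod_ge0.
rewrite !vnorm_sqE exprMn vnorm_sqE mulr_sumr; apply: eq_bigr => i _.
by rewrite mxE cmodM exprMn.
Qed.

Lemma vnormN u : vnorm (- u) = vnorm u.
Proof. by rewrite -scaleN1r vnormZ cmodN cmod1 mul1r. Qed.

Lemma pythagoras u v : hdot u v = 0 -> vnorm (u + v) ^+ 2 = vnorm u ^+ 2 + vnorm v ^+ 2.
Proof.
move=> uv; rewrite !vnorm_sqRe dotDl !dotDr uv (dot_eq0C uv) addr0 add0r.
exact: ReD.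
Qed.

Lemma cauchy_schwarz u v : cmod (hdot u v) <= vnorm u * vnorm v.
Proof.
have [->|v0] := eqVneq v 0; first by rewrite dot0r cmod0 mulr_ge0 ?vnorm_ge0.
have b0 : 0 < vnorm v ^+ 2 by rewrite exprn_gt0 // vnorm_gt0.
set d := hdot u v; set b := vnorm v ^+ 2 in b0 *.
rewrite -(@ler_pXn2r _ 2) ?nnegrE ?cmod_ge0 ?mulr_ge0 ?vnorm_ge0 // exprMn -/b.
have : vnorm ((b%:C)%C *: u - d *: v) ^+ 2 = b * (b * vnorm u ^+ 2 - cmod d ^+ 2).
  rewrite vnorm_sqRe dotBl !dotBr !dotZl !dotZr (dot_vnorm u) (dot_vnorm v) -/b -/d.
  have -> : hdot v u = (d^* )%R by rewrite /d [in RHS]dotC conjCK.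
  have -> : (((b%:C)%C : C)^* )%R = (b%:C)%C by apply/CrealP/complex_realP; exists b.
  have -> : cmod d ^+ 2 = complex.Re (d * (d^* )%R).
    by rewrite -normCK -cmodE -(rmorphXn (real_complex R)).
  move: d (vnorm u ^+ 2) b {b0} => [x y] a b /=; ring.
move=> h; have := exprn_ge0 2 (vnorm_ge0 ((b%:C)%C *: u - d *: v)).
by rewrite h pmulr_rge0 // subr_ge0 mulrC.
Qed.

Lemma fnorm_sqE A : fnorm A ^+ 2 = \sum_i vnorm (row i A) ^+ 2.
Proof.
have e : \tr (A *m A ^t*) = ((\sum_i vnorm (row i A) ^+ 2)%:C)%C.
  rewrite /mxtrace rmorph_sum; apply: eq_bigr => i _.
  by rewrite /= -dot_vnorm hdotE !mxE; apply: eq_bigr => j _; rewrite !mxE.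
rewrite fnormE /frobnorm e /= sqr_sqrtr //.
by apply: sumr_ge0 => i _; rewrite exprn_ge0 // vnorm_ge0.
Qed.

Lemma fnorm_ge0 A : 0 <= fnorm A. Proof. by rewrite fnormE sqrtr_ge0. Qed.

Lemma fnorm_entries A : fnorm A ^+ 2 = \sum_i \sum_j cmod (A i j) ^+ 2.
Proof.
rewrite fnorm_sqE; apply: eq_bigr => i _; rewrite vnorm_sqE.
by apply: eq_bigr => j _; rewrite mxE.
Qed.

Lemma fnorm_adj A : fnorm (A ^t*) = fnorm A.
Proof.
apply/eqP; rewrite -(@eqrXn2 _ 2) ?fnorm_ge0 // !fnorm_entries exchange_big.
by apply/eqP; apply: eq_bigr => i _; apply: eq_bigr => j _; rewrite !mxE cmod_conj.
Qed.

Lemma vnorm_mulmx v A : vnorm (v *m A) <= vnorm v * fnorm A.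
Proof.
rewrite -(@ler_pXn2r _ 2) ?nnegrE ?mulr_ge0 ?vnorm_ge0 ?fnorm_ge0 //.
rewrite exprMn -(fnorm_adj A) fnorm_sqE mulr_sumr vnorm_sqE.
apply: ler_sum => j _; rewrite -exprMn lerXn2r ?nnegrE ?cmod_ge0 ?mulr_ge0 ?vnorm_ge0 //.
have -> : (v *m A) 0 j = hdot v (row j (A ^t*)).
  by rewrite hdotE !mxE; apply: eq_bigr => i _; rewrite !mxE conjCK.
exact: cauchy_schwarz.
Qed.

Lemma fnorm_rank1 (u v : V) : fnorm (u ^t* *m v) = vnorm u * vnorm v.
Proof.
apply/eqP; rewrite -(@eqrXn2 _ 2) ?fnorm_ge0 ?mulr_ge0 ?vnorm_ge0 //.
rewrite fnorm_entries exprMn !vnorm_sqE mulr_suml; apply/eqP; apply: eq_bigr => i _.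
rewrite mulr_sumr; apply: eq_bigr => j _.
by rewrite mxE big_ord1 !mxE cmodM cmod_conj exprMn.
Qed.

Lemma specnorm_ge v A : vnorm v <= 1 -> vnorm (v *m A) <= specnorm A.
Proof.
move=> v1; rewrite vnormE; apply: ub_le_sup; last by exists v => //=; rewrite -vnormE.
exists (fnorm A) => _ [w /= w1 <-]; rewrite -vnormE in w1; rewrite -vnormE.
by apply: le_trans (vnorm_mulmx _ _) _; rewrite ler_piMl ?fnorm_ge0.
Qed.

(** The supremum is taken over a set that contains 0. *)
Lemma specnorm_le A (r : R) : (forall v, vnorm v <= 1 -> vnorm (v *m A) <= r) ->
  specnorm A <= r.
Proof.
move=> H; apply: ge_sup; last by move=> _ [v /= v1 <-]; rewrite -vnormE in v1; rewrite -vnormE; apply: H.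
by exists (hnorm ((0 : V) *m A)); exists 0 => //=; rewrite -vnormE vnorm0 ler01.
Qed.

Lemma specnorm_ge0 A : 0 <= specnorm A.
Proof.
by apply: le_trans (vnorm_ge0 (0 *m A)) _; apply: specnorm_ge; rewrite vnorm0 ler01.
Qed.

Lemma vnorm_le_n1 u : vnorm u <= n1 u.
Proof.
rewrite -(@ler_pXn2r _ 2) ?nnegrE ?vnorm_ge0 ?n1_ge0 // vnorm_sqE {1}/n1 big_ord1.
rewrite [leRHS]expr2 mulr_sumr; apply: ler_sum => i _; rewrite expr2.
apply: ler_wpM2r; first exact: cmod_ge0.
by have := n1_entry u 0 i; rewrite /n1 big_ord1.
Qed.

Lemma oproj_key : {f : {vspace V} -> M | forall L, f L = orthoproj L}.
Proof. by exists orthoproj. Qed.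

Definition oproj := sval oproj_key.

Lemma oprojE L : oproj L = orthoproj L. Proof. exact: (svalP oproj_key). Qed.

Section OrthoProj.
Variable L : {vspace V}.
Local Notation P := (oproj L).
Let B : 'M[C]_(\dim L, n.+1) := \matrix_(i < \dim L) (vbasis L)`_i.

Lemma mem_basis_mx v : (v <= B)%MS = (v \in L).
Proof.
apply/submxP/idP => [[D ->]|vL].
  rewrite mulmx_sum_row; apply: memv_suml => i _; apply: memvZ.
  by rewrite rowK vbasis_mem // mem_nth // size_tuple.
exists (\row_i coord (vbasis L) i v); rewrite mulmx_sum_row {1}(coord_vbasis vL).
by apply: eq_bigr => i _; rewrite mxE rowK.
Qed.

Lemma orthoproj_mem v : v *m P \in L.
Proof. by rewrite -mem_basis_mx oprojE proj_ortho_sub. Qed.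

Lemma orthoproj_id v : v \in L -> v *m P = v.
Proof. by rewrite -mem_basis_mx oprojE => /proj_ortho_id. Qed.

Lemma orthoproj_idem : P *m P = P.
Proof. by rewrite oprojE; apply: proj_ortho_proj. Qed.

Lemma orthoprojP v : (v \in L) = (v *m P == v).
Proof. by apply/idP/eqP => [/orthoproj_id //|<-]; apply: orthoproj_mem. Qed.

Lemma orthoproj_ortho v w : w \in L -> hdot (v - v *m P) w = 0.
Proof.
rewrite -mem_basis_mx oprojE => /submxP[D ->].
have /orthomx1P H := proj_ortho_compl_sub B v.
by rewrite hdotE trmx_mul map_mxM mulmxA [_ *m B ^t*]H mul0mx mxE.
Qed.

Lemma orthoproj_herm : P ^t* = P.
Proof.
suff H u v : hdot (u *m P) v = hdot u (v *m P).
  by apply: dot_ext => u v; rewrite dot_adj trmxCK H.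
have h1 : hdot (u *m P) v = hdot (u *m P) (v *m P).
  apply/eqP; rewrite -subr_eq0 -dotBr; apply/eqP/dot_eq0C/orthoproj_ortho.
  exact: orthoproj_mem.
rewrite h1; apply/eqP; rewrite eq_sym -subr_eq0 -dotBl; apply/eqP/orthoproj_ortho.
exact: orthoproj_mem.
Qed.

Lemma dot_orthoproj u v : hdot (u *m P) v = hdot u (v *m P).
Proof. by rewrite dot_adj orthoproj_herm. Qed.

Lemma orthoproj_pythagoras v :
  vnorm v ^+ 2 = vnorm (v *m P) ^+ 2 + vnorm (v *m (1%:M - P)) ^+ 2.
Proof.
rewrite -pythagoras mulmxBr mulmx1; first by rewrite addrC subrK.
by apply/dot_eq0C/orthoproj_ortho; apply: orthoproj_mem.
Qed.

Lemma vnorm_orthoproj v : vnorm (v *m P) <= vnorm v.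
Proof.
rewrite -(@ler_pXn2r _ 2) ?nnegrE ?vnorm_ge0 // (orthoproj_pythagoras v) lerDl.
by rewrite exprn_ge0 // vnorm_ge0.
Qed.

Lemma vnorm_orthoprojC v : vnorm (v *m (1%:M - P)) <= vnorm v.
Proof.
rewrite -(@ler_pXn2r _ 2) ?nnegrE ?vnorm_ge0 // (orthoproj_pythagoras v) lerDr.
by rewrite exprn_ge0 // vnorm_ge0.
Qed.
End OrthoProj.

(** A hermitian idempotent is determined by its image. *)
Lemma orthoproj_uniq (L : {vspace V}) Q : Q *m Q = Q -> Q ^t* = Q ->
  (forall v, v \in L <-> v *m Q = v) -> oproj L = Q.
Proof.
move=> QQ Qh HQ; have PQ : oproj L *m Q = oproj L.
  by apply/row_matrixP => i; rewrite row_mul; apply/HQ; rewrite rowE orthoproj_mem.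
have QP : Q *m oproj L = Q.
  apply/row_matrixP => i; rewrite row_mul; apply: orthoproj_id; apply/HQ.
  by rewrite -row_mul QQ.
have := congr1 (fun D : M => D ^t*) PQ.
by rewrite trmx_mul map_mxM Qh orthoproj_herm QP => <-.
Qed.

End HermitianNorms.

(** * Graphs and charts of the Grassmannian *)

Section Graphs.
Context {R : realType} {n : nat}.
Local Notation C := (Cplx R).
Local Notation V := 'rV[C]_n.+1.
Local Notation M := 'M[C]_n.+1.
Variable L : {vspace V}.
Local Notation P := (oproj L).
Implicit Types (v w : V) (A B k : M).

Lemma mem_image_mulmx (k : M) (U : {vspace V}) w :
  reflect (exists2 x, x \in U & w = x *m k) (w \in (linfun (mulmxr k : V -> V) @: U)%VS).
Proof.
by apply: (iffP memv_imgP) => -[x xU ->]; exists x; rewrite ?lfunE.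
Qed.

Lemma hom_perpE A : hom_perp L A <-> P *m A = A /\ A *m P = 0.
Proof. by rewrite oprojE. Qed.

Lemma to_hom_perpE A : to_hom_perp L A = P *m A *m (1%:M - P).
Proof. by rewrite oprojE. Qed.

Lemma to_hom_perp_id A : hom_perp L A -> to_hom_perp L A = A.
Proof. by move=> /hom_perpE[h1 h2]; rewrite to_hom_perpE h1 mulmxBr mulmx1 h2 subr0. Qed.

Lemma hom_perp0 : hom_perp L 0.
Proof. by apply/hom_perpE; split; rewrite ?mulmx0 ?mul0mx. Qed.

Lemma hom_perpZ a A : hom_perp L A -> hom_perp L (a *: A).
Proof. by move=> /hom_perpE[h1 h2]; apply/hom_perpE; split; rewrite -?scalemxAr -?scalemxAl ?h1 ?h2 ?scaler0. Qed.

Lemma hom_perp_sq0 A B : hom_perp L A -> hom_perp L B -> A *m B = 0.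
Proof. by move=> /hom_perpE[_ h] /hom_perpE[h1 _]; rewrite -h1 mulmxA h mul0mx. Qed.

Lemma mem_graph A w : hom_perp L A -> (w \in graph L A) = (w - w *m A \in L).
Proof.
move=> hA; have /hom_perpE[h1 h2] := hA; apply/mem_image_mulmx/idP => [[x xL ->]|H].
  have -> : x *m (1%:M + A) - x *m (1%:M + A) *m A = x.
    by rewrite mulmxDr mulmx1 mulmxDl -(mulmxA x A A) (@hom_perp_sq0 A A) // mulmx0 addr0 addrK.
  by [].
exists (w - w *m A) => //; rewrite mulmxDr mulmx1 mulmxBl -mulmxA (@hom_perp_sq0 A A) //.
by rewrite mulmx0 subr0 subrK.
Qed.

Lemma mem_graphE A w : hom_perp L A -> (w \in graph L A) = (w *m (1%:M - P) == w *m A).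
Proof.
move=> hA; have /hom_perpE[h1 h2] := hA; rewrite mem_graph // orthoprojP mulmxBl -(mulmxA w A) h2 mulmx0 subr0.
by rewrite mulmxBr mulmx1 eq_sym subr_eq addrC eq_sym subr_eq.
Qed.

Lemma graph0 : graph L 0 = L.
Proof.
apply/vspaceP => w; rewrite mem_graph; last exact: hom_perp0.
by rewrite mulmx0 subr0.
Qed.

Lemma dim_graph A : hom_perp L A -> \dim (graph L A) = \dim L.
Proof.
move=> hA; apply: limg_dim_eq; apply/eqP; rewrite -subv0; apply/subvP => w.
rewrite memv_cap memv_ker lfunE /= memv0 => /andP[_ /eqP].
rewrite mulmxDr mulmx1 => e; apply/eqP.
have : (w + w *m A) *m (1%:M - A) = 0 by rewrite e mul0mx.
rewrite mulmxBr mulmx1 mulmxDl -mulmxA (hom_perp_sq0 hA hA) mulmx0 addr0.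
by rewrite addrK.
Qed.

(** The coordinate of a subspace is unique because w (1 - P) = w A
    determines A on the projection of the graph, which is all of L. *)
Lemma graph_inj A B : hom_perp L A -> hom_perp L B -> graph L A = graph L B -> A = B.
Proof.
move=> hA hB e; have /hom_perpE[a1 a2] := hA; have /hom_perpE[b1 b2] := hB.
apply/row_matrixP => i; rewrite !rowE; set x := delta_mx _ _ : V.
have : x *m (P + A) \in graph L A.
  rewrite mem_graph // mulmxDr mulmxDl -!mulmxA a1 (hom_perp_sq0 hA hA) mulmx0 addr0.
  by rewrite addrK orthoproj_mem.
have e1 : (P + A) *m (1%:M - P) = A.
  by rewrite mulmxDl !mulmxBr !mulmx1 orthoproj_idem a2 subrr subr0 add0r.
have e2 : (P + A) *m B = B by rewrite mulmxDl b1 (hom_perp_sq0 hA hB) addr0.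
by rewrite e mem_graphE // -!mulmxA e1 e2 => /eqP.
Qed.

(** The coordinate in the chart centered at L of the image of L under k: the
    part of k from L to L must be inverted, and 1 - P completes it to an
    invertible matrix of full size. *)
Definition graph_coord k : M := invmx (P *m k *m P + (1%:M - P)) *m (P *m k *m (1%:M - P)).

Lemma graph_coordP k : P *m k *m P + (1%:M - P) \in unitmx ->
  hom_perp L (graph_coord k) /\
  graph L (graph_coord k) = (linfun (mulmxr k : V -> V) @: L)%VS.
Proof.
set Q := _ + _ => uQ.
have PP := orthoproj_idem L.
have PQ : P *m Q = P *m k *m P.
  by rewrite /Q mulmxDr !mulmxA PP mulmxBr mulmx1 PP subrr addr0.
have QP : Q *m P = P *m k *m P.
  by rewrite /Q mulmxDl -mulmxA PP mulmxBl mul1mx PP subrr addr0.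
have Pi : P *m invmx Q = invmx Q *m P.
  apply: (can_inj (mulKmx uQ)); rewrite mulKVmx // mulmxA QP -PQ.
  by rewrite -mulmxA mulmxV // mulmx1.
have hF : hom_perp L (graph_coord k).
  apply/hom_perpE; split; rewrite /graph_coord -/Q.
    by rewrite mulmxA Pi -!mulmxA (mulmxA P P) PP.
  by rewrite -!mulmxA mulmxBl mul1mx PP subrr !mulmx0.
have key y : y \in L -> y *m Q *m (1%:M + graph_coord k) = y *m k.
  move=> yL; rewrite mulmxDr mulmx1 /graph_coord -/Q -(mulmxA y) mulKVmx //.
  rewrite -{1}(orthoproj_id yL) -(mulmxA y P) PQ -mulmxDr -mulmxDr.
  by rewrite [P + _]addrC subrK mulmx1 mulmxA (orthoproj_id yL).
split=> //; apply/vspaceP => w; apply/mem_image_mulmx/mem_image_mulmx => -[x xL ->].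
  have x'L : x *m invmx Q \in L.
    by rewrite orthoprojP -mulmxA -Pi mulmxA (orthoproj_id xL).
  by exists (x *m invmx Q) => //; rewrite -key // mulmxKV.
exists (x *m Q); last by rewrite key.
by rewrite orthoprojP -mulmxA QP -PQ mulmxA (orthoproj_id xL).
Qed.

(** The right side is hermitian, and idempotent because (P + A)(P + A)^* = P
    + A A^*. *)
Lemma orthoproj_graph A : hom_perp L A -> 1%:M + A *m A ^t* \in unitmx ->
  oproj (graph L A) = (P + A ^t*) *m invmx (1%:M + A *m A ^t*) *m (P + A).
Proof.
move=> hA; have /hom_perpE[a1 a2] := hA; set X := A *m A ^t*; set W := invmx _ => uX.
have PP := orthoproj_idem L; have Ph := orthoproj_herm L.
have a1' : A ^t* *m P = A ^t* by rewrite -{1}Ph -adjmM a1.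
have a2' : P *m A ^t* = 0 by rewrite -{1}Ph -adjmM a2 adjm0.
have PX : P *m X = X by rewrite /X mulmxA a1.
have XP : X *m P = X by rewrite /X -mulmxA a1'.
have PW : P *m W = W *m P.
  apply: (can_inj (mulKmx uX)); rewrite mulKVmx // mulmxA mulmxDl mul1mx XP.
  by rewrite -[X in (_ + X)]PX -{1}[P]mulmx1 -mulmxDr -mulmxA mulmxV // mulmx1.
have PG : P *m (P + A) = P + A by rewrite mulmxDr PP a1.
have GG : (P + A) *m (P + A ^t*) = P + X.
  by rewrite mulmxDr !mulmxDl PP a2 a2' addr0 add0r.
have key : (P + X) *m W *m (P + A) = P + A.
  have e : P + X = P *m (1%:M + X) by rewrite mulmxDr mulmx1 PX.
  by rewrite e -(mulmxA P) mulmxV // mulmx1 PG.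
apply: orthoproj_uniq.
- rewrite -!mulmxA; congr (_ *m (_ *m _)).
  by rewrite !mulmxA GG key.
- rewrite !adjmM !adjmD trmxCK Ph mulmxA; congr (_ *m _ *m _).
  have Wh : W *m (1%:M + X) = 1%:M by rewrite mulVmx.
  have Xh : (1%:M + X) ^t* = 1%:M + X by rewrite adjmD adjm1 /X adjmM trmxCK.
  have := congr1 (fun D : M => D ^t*) Wh; rewrite adjmM Xh adjm1 => e.
  by rewrite -[LHS]mul1mx -Wh -mulmxA e mulmx1.
- move=> v; split=> [/mem_image_mulmx[x xL ->]|<-].
    have -> : x *m (1%:M + A) = x *m (P + A) by rewrite !mulmxDr mulmx1 orthoproj_id.
    by rewrite !mulmxA -(mulmxA x) GG -!mulmxA (mulmxA (P + X)) key.
  apply/mem_image_mulmx; exists (v *m (P + A ^t*) *m W *m P); first exact: orthoproj_mem.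
  by rewrite !mulmxA -(mulmxA _ P) mulmxDr mulmx1 a1.
Qed.

(** Only the inverse in the formula for the projection contributes beyond
    first order, and it differs from 1 by terms quadratic in A. *)
Lemma orthoproj_graph_expand : exists2 K : R, 0 <= K &
  forall A, hom_perp L A -> n1 A <= 2^-1 ->
    n1 (oproj (graph L A) - (P + A + A ^t*)) <= K * n1 A ^+ 2.
Proof.
pose d := 2 * n1 (1%:M : M); pose q := n1 P + 1.
have d0 : 0 <= d by rewrite mulr_ge0 // n1_ge0.
have q0 : 0 <= q by rewrite addr_ge0 // n1_ge0.
exists (1 + q * d * q); first by rewrite addr_ge0 // mulr_ge0 // mulr_ge0.
move=> A hA sA; have /hom_perpE[a1 a2] := hA.
have X2 : n1 (A *m A ^t*) <= n1 A ^+ 2.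
  by apply: le_trans (n1M _ _) _; rewrite n1_adj expr2.
have A0 := n1_ge0 A.
have Xh : n1 (A *m A ^t*) <= 2^-1.
  by apply: le_trans X2 _; rewrite expr2; move: (n1 A) sA A0 => a ? ?; nra.
have [uX _ hZ _] := neumann Xh.
rewrite orthoproj_graph //; set Z := invmx _ - 1%:M in hZ.
have -> : invmx (1%:M + A *m A ^t*) = 1%:M + Z by rewrite /Z addrCA subrr addr0.
have PP := orthoproj_idem L; have Ph := orthoproj_herm L.
have a1' : A ^t* *m P = A ^t* by rewrite -{1}Ph -adjmM a1.
have -> : (P + A ^t*) *m (1%:M + Z) *m (P + A) - (P + A + A ^t*) =
   A ^t* *m A + (P + A ^t*) *m Z *m (P + A).
  have e1 : (P + A ^t*) *m (P + A) = P + A + A ^t* + A ^t* *m A.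
    by rewrite mulmxDl !mulmxDr PP a1 a1' addrA.
  rewrite [_ *m (1%:M + Z)]mulmxDr mulmx1 mulmxDl e1; set S := P + A + _.
  by rewrite -(addrA S) addrAC subrr add0r.
apply: le_trans (n1D _ _) _; rewrite mulrDl mul1r; apply: lerD.
  by apply: le_trans (n1M _ _) _; rewrite n1_adj expr2.
have qA B : n1 B <= n1 A -> n1 (P + B) <= q.
  by move=> h; apply: le_trans (n1D _ _) _; rewrite /q lerD2l; lra.
apply: le_trans (n1M _ _) _; rewrite [leRHS]mulrAC.
apply: ler_pM; rewrite ?n1_ge0 //; last exact: qA.
apply: le_trans (n1M _ _) _; rewrite -mulrA.
apply: ler_pM; rewrite ?n1_ge0 //; first by apply: qA; rewrite n1_adj.
by apply: le_trans hZ _; rewrite -/d ler_wpM2l.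
Qed.

End Graphs.

(** * Topology of matrix spaces through the entry sum norm *)

Section Topology.
Context {R : realType}.
Local Notation C := (Cplx R).

Lemma mx_norm_n1 p q (A : 'M[C]_(p.+1, q.+1)) : `|A| <= ((n1 A)%:C)%C.
Proof.
rewrite /Num.norm /= mx_normE.
have -> : ((n1 A)%:C)%C = (NngNum (ltac:(by rewrite lecR n1_ge0) : 0 <= ((n1 A)%:C)%C :> C))%:num by [].
rewrite num_le; apply/bigmax_leP; split; first by rewrite -num_le /= lecR n1_ge0.
by move=> i _; rewrite -num_le /= -cmodE lecR n1_entry.
Qed.

Lemma n1_mx_norm p q (A : 'M[C]_(p.+1, q.+1)) (e : R) :
  `|A| < (e%:C)%C -> n1 A <= p.+1%:R * q.+1%:R * e.
Proof.
move=> h; have hij i j : cmod (A i j) <= e.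
  rewrite cmod_le; apply: le_trans (ltW h).
  rewrite [leRHS]/Num.norm /= mx_normE.
  have -> : `|A i j| = (`|A i j|%:nng)%:num by [].
  by rewrite num_le; apply/bigmax_geP; right; exists (i, j).
apply: (@le_trans _ _ (\sum_(i < p.+1) \sum_(j < q.+1) e)).
  by apply: ler_sum => i _; apply: ler_sum => j _.
by rewrite !sumr_const !card_ord -mulrA !mulr_natl.
Qed.

(** The topology of matrix spaces is that of the entry sum norm. *)
Lemma near_n1 p q (A0 : 'M[C]_(p.+1, q.+1)) (S : set 'M[C]_(p.+1, q.+1)) (e : R) : 0 < e ->
  (forall A, n1 (A - A0) < e -> S A) -> \forall A \near A0, S A.
Proof.
move=> e0 H; pose d := e / (p.+1%:R * q.+1%:R) / 2.
have pq : 0 < p.+1%:R * q.+1%:R :> R by rewrite mulr_gt0.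
have d0 : 0 < d by rewrite !divr_gt0.
apply/nbhs_ballP; exists ((d%:C)%C : C); first by rewrite /= ltcR.
move=> A; rewrite -ball_normE /= distrC => h; apply: H.
apply: le_lt_trans (n1_mx_norm h) _.
rewrite /d [X in X < _](_ : _ = e / 2); last first.
  by move: (_ * _) pq => t t0; field; rewrite gt_eqF.
lra.
Qed.

Lemma n1_near p q (A0 : 'M[C]_(p.+1, q.+1)) (S : set 'M[C]_(p.+1, q.+1)) :
  (\forall A \near A0, S A) -> exists2 e : R, 0 < e & forall A, n1 (A - A0) < e -> S A.
Proof.
move=> /nbhs_ballP[e /= e0 H]; have er : e = ((complex.Re e)%:C)%C.
  by rewrite RRe_real // gtr0_real.
exists (complex.Re e); first by rewrite -ltcR -er.
move=> A h; apply: H; rewrite -ball_normE /= distrC er.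
by apply: le_lt_trans (mx_norm_n1 _) _; rewrite ltcR.
Qed.

Lemma cvg_n1 {T : Type} (F : set_system T) {FF : Filter F} p q
    (f : T -> 'M[C]_(p.+1, q.+1)) (l : 'M[C]_(p.+1, q.+1)) :
  f @ F --> l <-> forall e : R, 0 < e -> \forall t \near F, n1 (f t - l) < e.
Proof.
split=> [H e e0|H].
  by apply: (H [set A | n1 (A - l) < e]); apply: (near_n1 e0).
by move=> S /n1_near[e e0 HS]; apply: filterS (H e e0) => t /HS.
Qed.
End Topology.

Lemma rank_row_mx_gt (K : fieldType) p q r (A : 'M[K]_(p, q)) (B : 'M[K]_(p, r)) (u : 'rV_p) :
  u *m A = 0 -> u *m B <> 0 -> (\rank A < \rank (row_mx A B))%N.
Proof.
move=> uA uB; have : (kermx (row_mx A B) < kermx A)%MS.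
  apply/andP; split.
    apply/sub_kermxP; have := mulmx_ker (row_mx A B).
    by rewrite mul_mx_row -row_mx0 => /eq_row_mx[].
  apply/negP => /(submx_trans (_ : (u <= kermx A)%MS)) h.
  have /sub_kermxP : (u <= kermx (row_mx A B))%MS by apply: h; apply/sub_kermxP.
  by rewrite mul_mx_row -row_mx0 => /eq_row_mx[_ /uB].
rewrite ltmxErank => /andP[_]; rewrite !mxrank_ker.
move: (rank_leq_row A) (rank_leq_row (row_mx A B)).
by move: (\rank A) (\rank _) => a b; lia.
Qed.

(** * Tangent spaces, conormal equations and transversality *)

Section TangentData.
Local Notation transversal := Defs.transversal.
Context {R : realType} {n : nat}.
Local Notation C := (Cplx R).
Local Notation V := 'rV[C]_n.+1.
Local Notation poly := (mpoly.mpoly n.+1 C).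
Local Notation eval := (@Defs.eval R n).

Lemma has_chain_le (X : set V) a b : (b <= a)%N -> has_chain X a -> has_chain X b.
Proof.
move=> ba [W [vW lW WX]]; exists W; split=> [i ib|i ib|].
- by apply: vW; apply: leq_trans ba.
- by apply: lW; apply: leq_trans ba.
- apply: subset_trans WX; move: ba => /subnKC; move: (a - b)%N => d.
  move=> e; have : forall d', (d' <= d)%N -> W b `<=` W (b + d')%N; last by rewrite -e; apply.
  elim=> [|d' IH] d'd; first by rewrite addn0.
  apply: subset_trans (IH (ltnW d'd)) _; rewrite addnS.
  have lt : (b + d' < a)%N by rewrite -e ltn_add2l.
  by have [] := lW _ lt.
Qed.

(** Chains can be truncated, so lengths of chains are closed downwards. *)
Lemma proj_dim_uniq (X : set V) a b : proj_dim X a -> proj_dim X b -> a = b.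
Proof.
move=> [ha na] [hb nb]; case: (ltngtP a b) => // lt.
  by case: na; apply: has_chain_le hb.
by case: nb; apply: has_chain_le ha.
Qed.

Lemma tangent_spaceE (X : set V) z w :
  tangent_space X z w <->
  hdot w z = 0 /\ forall f, vanishing_ideal X f -> dirder z w f = 0.
Proof.
have sE f : \sum_i eval (mpoly.mderiv i f) z * w 0 i = dirder z w f.
  by rewrite dirderE; apply: eq_bigr => i _; rewrite mulrC.
rewrite /tangent_space hdot_dotmx /=; split=> -[h1 h2]; split=> // f /h2.
  by rewrite sE.
by rewrite -sE.
Qed.

(** Used to conclude from first order estimates. *)
Lemma le_linear_small (a K : R) : (forall t, 0 < t -> t <= 1 -> a <= K * t) -> a <= 0.
Proof.
move=> H; rewrite leNgt; apply/negP => a0.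
pose k := `|K| + 1; have k0 : 0 < k by rewrite ltr_wpDl.
pose t := Num.min 1 (a / k / 2).
have t0 : 0 < t by rewrite lt_min ltr01 !divr_gt0.
have t1 : t <= 1 by rewrite ge_min lexx.
have := H t t0 t1; apply/negP; rewrite -ltNge.
apply: (@le_lt_trans _ _ (k * t)).
  by rewrite ler_pM2r //; apply: le_trans (ler_norm _) _; rewrite lerDl.
rewrite mulrC -ltr_pdivlMr //; apply: (@le_lt_trans _ _ (a / k / 2)).
  by rewrite ge_min lexx orbT.
by rewrite ltr_pdivrMr // ltr_pMr ?divr_gt0 //; lra.
Qed.

Lemma vanishing_ideal_of (X : set V) f : vanishing_ideal X f -> ideal_of X f.
Proof. by case. Qed.

Lemma dirderZu (z : V) a u f : dirder z (a *: u) f = a * dirder z u f.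
Proof. by rewrite /dirder -scalemxAl mxE. Qed.

Lemma dirderDu (z u v : V) f : dirder z (u + v) f = dirder z u f + dirder z v f.
Proof. by rewrite /dirder mulmxDl mxE. Qed.

(** Along the line through z the polynomial f vanishes identically. *)
Lemma euler (X : set V) z f : proj_closed X -> X z -> ideal_of X f -> dirder z z f = 0.
Proof.
move=> cX Xz If; apply/eqP; rewrite -cmod_eq0 eq_le cmod_ge0 andbT.
pose r := 2 * n1 z; have r0 : 0 <= r by rewrite mulr_ge0 // n1_ge0.
have [K K0 HK] := poly_estimates f r0.
apply: (@le_linear_small _ (K * n1 z ^+ 2)) => t t0 t1.
have zr : n1 z <= r by rewrite /r mulr_natl lerDl n1_ge0.
have cE : cmod ((t%:C)%C : C) = t by rewrite cmod_real ger0_norm // ltW.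
have wE : (1 + (t%:C)%C) *: z - z = (t%:C)%C *: z by rewrite scalerDl scale1r addrC addKr.
have wr : n1 ((1 + (t%:C)%C) *: z) <= r.
  rewrite scalerDl scale1r; apply: le_trans (n1D _ _) _.
  by rewrite n1Z cE /r mulr_natl lerD2l ler_piMl // n1_ge0.
have [_ _ _] := HK z _ zr wr; rewrite wE n1Z cE.
have -> : eval f ((1 + (t%:C)%C) *: z) = 0.
  apply: If; apply: proj_closed_cone => //.
  rewrite -(rmorph1 (real_complex R)) -rmorphD /= eq_complex /= negb_and.
  by rewrite gt_eqF // addr_gt0.
rewrite [eval f z]If // subrr sub0r cmodN dirderZu cmodM cE.
have -> : K * (t * n1 z) ^+ 2 = t * (K * n1 z ^+ 2 * t) by ring.
by rewrite ler_pM2l.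
Qed.

Lemma rank_basis_mx (U : {vspace V}) :
  \rank (\matrix_(i < \dim U) (vbasis U)`_i) = \dim U.
Proof.
apply/eqP; rewrite -[_ == _]/(row_free _) -kermx_eq0.
apply/eqP/row_matrixP => i; rewrite row0; set v := row i _.
have : v *m (\matrix_(i < \dim U) (vbasis U)`_i) = 0 by rewrite /v -row_mul mulmx_ker row0.
rewrite mulmx_sum_row => h; apply/rowP => j; rewrite [RHS]mxE.
have /freeP H := basis_free (vbasisP U); apply: (H (fun j => v 0 j)).
by rewrite -[RHS]h; apply: eq_bigr => l _; rewrite rowK.
Qed.

Lemma gradmx_extend c (F : 'I_c -> poly) f z :
  gradmx (fun i : 'I_(c + 1) => match fintype.split i with inl i => F i | inr _ => f end) z =
  row_mx (gradmx F z) (gradient f z)^T.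
Proof.
apply/matrixP => i j; rewrite !mxE; case: (fintype.split j) => j'; rewrite !mxE //.
Qed.

(** A maximal family of equations with independent differentials at z has
    the common kernel of all differentials; this kernel is T plus the line
    of z. *)
Lemma conormal_basis (X : set V) z m (T : {vspace V}) :
  proj_closed X -> X z -> (m <= n)%N -> \dim T = m ->
  (forall w, w \in T <-> tangent_space X z w) ->
  exists c (F : 'I_c -> poly), [/\ (c + m.+1 = n.+1)%N, forall i, vanishing_ideal X (F i) &
    forall u, u *m gradmx F z = 0 <-> exists t a, t \in T /\ u = t + a *: z].
Proof.
move=> cX Xz mn dT HT.
have z0 : z != 0 by apply: proj_closed_neq0 Xz.
pose Q r := `[< exists F : 'I_r -> poly,
   (forall i, vanishing_ideal X (F i)) /\ \rank (gradmx F z) = r >].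
have exQ : exists r, Q r.
  exists 0%N; apply/asboolP; exists (fun i : 'I_0 => 0); split; first by case.
  by apply/eqP; rewrite -leqn0 rank_leq_col.
have ubQ r : Q r -> (r <= n.+1)%N.
  by move=> /asboolP[F [_ <-]]; apply: rank_leq_row.
case: (ex_maxnP exQ ubQ) => c /asboolP[F [vF rF]] maxc.
have kerF u f : u *m gradmx F z = 0 -> vanishing_ideal X f -> dirder z u f = 0.
  move=> uF vf; apply: contrapT => uf.
  suff : (c + 1 <= c)%N by rewrite addn1 ltnn.
  apply: maxc; apply/asboolP.
  exists (fun i : 'I_(c + 1) => match fintype.split i with inl i => F i | inr _ => f end).
  split; last first.
    apply/eqP; rewrite (gradmx_extend F f z) eqn_leq rank_leq_col /=.
    have uB : u *m (gradient f z)^T <> 0 by move=> e; apply: uf; rewrite /dirder e mxE.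
    have := rank_row_mx_gt uF uB; rewrite rF; apply: leq_trans.
    by rewrite addn1.
  by move=> i; case: (fintype.split i).
have kerE u : u *m gradmx F z = 0 <-> exists t a, t \in T /\ u = t + a *: z.
  split=> [uF|[t [a [/HT/tangent_spaceE[_ ht] ->]]]]; last first.
    apply/rowP => i; rewrite mul_gradmx !mxE dirderDu dirderZu (euler cX Xz).
      by rewrite mulr0 addr0 ht.
    exact/vanishing_ideal_of.
  have zz : hdot z z != 0.
    by rewrite dot_vnorm (inj_eq (@complexI R) _ 0) sqrf_eq0 vnorm_eq0.
  pose a := hdot u z / hdot z z; exists (u - a *: z), a; rewrite subrK; split=> //.
  apply/HT/tangent_spaceE; split; first by rewrite dotBl dotZl /a divfK // subrr.
  move=> f vf; rewrite dirderBu dirderZu (kerF u f) // (euler cX Xz).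
    by rewrite mulr0 subrr.
  exact/vanishing_ideal_of.
exists c, F; split=> //.
pose U := (T + <[z]>)%VS; pose B := \matrix_(i < \dim U) (vbasis U)`_i.
have eqK : (B == kermx (gradmx F z))%MS.
  apply/andP; split.
    apply/sub_kermxP/row_matrixP => i; rewrite row0 row_mul; apply/kerE.
    have : row i B \in U by rewrite -mem_basis_mx row_sub.
    by move=> /memv_addP[t tT [_ /vlineP[a ->] ->]]; exists t, a.
  apply/row_subP => i.
  have : row i (kermx (gradmx F z)) *m gradmx F z = 0 by rewrite -row_mul mulmx_ker row0.
  move=> /kerE[t [a [tT ->]]]; rewrite mem_basis_mx.
  by apply: memv_add => //; apply: memvZ; rewrite memv_line.
have dU : \dim U = m.+1.
  rewrite dimv_disjoint_sum ?dT ?dim_vline ?z0 ?addn1 //.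
  apply/eqP; rewrite -subv0; apply/subvP => w; rewrite memv_cap memv0 => /andP[wT /vlineP[a wa]].
  have /HT/tangent_spaceE[+ _] := wT; rewrite wa dotZl => /eqP.
  rewrite mulf_eq0 => /orP[/eqP ->|]; first by rewrite scale0r.
  by rewrite dot_vnorm (inj_eq (@complexI R) _ 0) sqrf_eq0 vnorm_eq0 (negPf z0).
have := eqmx_rank eqK; rewrite rank_basis_mx dU mxrank_ker rF.
by have := rank_leq_row (gradmx F z); rewrite rF; lia.
Qed.

Lemma mem_hperp (z v : V) : (v \in orthov (@dotmx C n.+1) <[z]>) = (hdot v z == 0).
Proof. by rewrite mem_orthov1 hdot_dotmx. Qed.

(** The form given by z is not zero on U. *)
Lemma dim_hperp (z : V) (U : {vspace V}) : z \in U -> z != 0 ->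
  \dim (U :&: orthov (@dotmx C n.+1) <[z]>)%VS = (\dim U).-1.
Proof.
move=> zU z0; rewrite -eq_dim_orthov1 //; apply/negP => /mem_orthovP /(_ z zU) /eqP.
by rewrite dnorm_eq0 (negPf z0).
Qed.

Definition tlinear (L : {vspace V}) (z : V) : {vspace V} :=
  (L :&: orthov (@dotmx C n.+1) <[z]>)%VS.

Lemma mem_tlinear L z w : w \in tlinear L z <-> tangent_linear L z w.
Proof.
rewrite memv_cap mem_hperp hdot_dotmx; split=> [/andP[wL /eqP]|[-> ->]] //.
by rewrite eqxx.
Qed.

(** A subspace is the kernel of its cokernel matrix, of which d columns are
    a basis. *)
Lemma kernel_equations (U : {vspace V}) d : (\dim U + d = n.+1)%N ->
  exists E : 'M[C]_(n.+1, d), forall u, u *m E = 0 <-> u \in U.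
Proof.
move=> dU; pose B := \matrix_(i < \dim U) (vbasis U)`_i.
have [r [E [rd HE]]] : exists r (E : 'M[C]_(n.+1, r)), r = d /\ forall u, u *m E = 0 <-> u \in U.
  exists (\rank (cokermx B)), (col_base (cokermx B)); split.
    by rewrite mxrank_coker rank_basis_mx; move: dU; move: (\dim U) => k; lia.
  move=> u; rewrite -mem_basis_mx submxE -/B.
  have -> : u *m cokermx B = u *m col_base (cokermx B) *m row_base (cokermx B).
    by rewrite -mulmxA mulmx_base.
  rewrite mulmx_free_eq0 ?row_base_free //.
  by split=> [->|/eqP].
by case: d / rd dU => _; exists E.
Qed.

Section Transversality.
Variables (m : nat) (X : set V) (z : V) (L T : {vspace V}).
Hypothesis mn : (m < n)%N.
Hypothesis z0 : z != 0.
Hypothesis zL : z \in L.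
Hypothesis dL : \dim L = (n - m).+1.
Hypothesis dT : \dim T = m.
Hypothesis HT : forall w, w \in T <-> tangent_space X z w.

Lemma dim_tlinear : \dim (tlinear L z) = (n - m)%N.
Proof. by rewrite dim_hperp // dL. Qed.

(** The dimensions of T and of the tangent space of L are complementary in
    that of the orthogonal complement of z, so their sum is everything
    exactly when they meet in 0. *)
Lemma transversal_disjoint : transversal X L z <-> (T :&: tlinear L z = 0)%VS.
Proof.
have dH : \dim (orthov (@dotmx C n.+1) <[z]>) = n.
  by rewrite -(capfv (orthov _ _)) dim_hperp ?memvf // dimvf dim_matrix mul1r.
have sub : (T + tlinear L z <= orthov (@dotmx C n.+1) <[z]>)%VS.
  rewrite subv_add; apply/andP; split; apply/subvP => w.
    by move=> /HT/tangent_spaceE[+ _]; rewrite mem_hperp => ->.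
  by rewrite memv_cap => /andP[].
have sum := dimv_sum_cap T (tlinear L z); rewrite dim_tlinear dT subnKC ?(ltnW mn) // in sum.
split=> [tr|cap0].
  have sup : (orthov (@dotmx C n.+1) <[z]> <= T + tlinear L z)%VS.
    apply/subvP => w; rewrite mem_hperp hdot_dotmx => /eqP /tr[u [v [tu tv ->]]].
    by apply: memv_add; [apply/HT|apply/mem_tlinear].
  apply/eqP; rewrite -dimv_eq0; have := dimvS sup; rewrite dH => h.
  by move: sum h; move: (\dim (_ + _)) (\dim (_ :&: _)) => a b; lia.
move=> w; rewrite -hdot_dotmx => wz.
have : w \in (T + tlinear L z)%VS.
  have -> : (T + tlinear L z)%VS = orthov (@dotmx C n.+1) <[z]>.
    by apply/eqP; rewrite eqEdim sub dH; move: sum; rewrite cap0 dimv0 addn0 => ->; rewrite leqnn.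
  by rewrite mem_hperp wz eqxx.
by move=> /memv_addP[u uT [v vL ->]]; exists u, v; split=> //; [apply/HT|apply/mem_tlinear].
Qed.

(** Together the differentials of F and the equations E of the tangent space
    of L have a common kernel 0, and there are n + 1 of them, so that they
    form an invertible matrix with inverse N. *)
Lemma local_equations : proj_closed X -> X z -> transversal X L z ->
  exists c (F : 'I_c -> poly) (E : 'M[C]_(n.+1, m.+1)) (N : 'M[C]_(c + m.+1, n.+1)),
   [/\ (c + m.+1 = n.+1)%N, forall i, vanishing_ideal X (F i),
     forall u, u *m E = 0 <-> u \in tlinear L z,
     row_mx (gradmx F z) E *m N = 1%:M & N *m row_mx (gradmx F z) E = 1%:M].
Proof.
move=> cX Xz /transversal_disjoint cap0.
have [c [F [cm vF kF]]] := conormal_basis cX Xz (ltnW mn) dT HT.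
have [|E HE] := @kernel_equations (tlinear L z) m.+1.
  by rewrite dim_tlinear addnS subnK // ltnW.
have fr : row_free (row_mx (gradmx F z) E).
  rewrite -kermx_eq0; apply/eqP/row_matrixP => i; rewrite row0; set v := row i _.
  have : v *m row_mx (gradmx F z) E = 0 by rewrite /v -row_mul mulmx_ker row0.
  rewrite mul_mx_row -row_mx0 => /eq_row_mx[/kF[t [a [tT va]]] /HE vL].
  have a0 : a = 0.
    have /mem_tlinear[_] := vL; rewrite -hdot_dotmx va dotDl dotZl.
    have /HT/tangent_spaceE[-> _] := tT; rewrite add0r => /eqP.
    rewrite mulf_eq0 dot_vnorm (inj_eq (@complexI R) _ 0) sqrf_eq0 vnorm_eq0 (negPf z0) orbF.
    by move=> /eqP.
  have : v \in (T :&: tlinear L z)%VS.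
    by rewrite memv_cap vL va a0 scale0r addr0 tT.
  by rewrite cap0 memv0 => /eqP.
have fu : row_full (row_mx (gradmx F z) E).
  by move: fr; rewrite /row_free /row_full => /eqP ->; rewrite cm.
have /row_freeP[N LN] := fr; have /row_fullP[N' NL] := fu.
have e : N' = N by rewrite -[N']mulmx1 -LN mulmxA NL mul1mx.
by exists c, F, E, N; split=> //; rewrite -e.
Qed.
End Transversality.
End TangentData.

(** * Differentials through quadratic estimates *)

Section Differentials.
Context {R : realType}.
Local Notation C := (Cplx R).
Lemma n1_le_norm p q (A : 'M[C]_(p.+1, q.+1)) : ((n1 A)%:C)%C <= (p.+1%:R * q.+1%:R) * `|A|.
Proof.
have e : `|A| = ((complex.Re `|A|)%:C)%C by rewrite RRe_real // normr_real.
have hij i j : cmod (A i j) <= complex.Re `|A|.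
  rewrite cmod_le -e [leRHS]/Num.norm /= mx_normE.
  have -> : `|A i j| = (`|A i j|%:nng)%:num by [].
  by rewrite num_le; apply/bigmax_geP; right; exists (i, j).
have : n1 A <= p.+1%:R * q.+1%:R * complex.Re `|A|.
  apply: (@le_trans _ _ (\sum_(i < p.+1) \sum_(j < q.+1) complex.Re `|A|)).
    by apply: ler_sum => i _; apply: ler_sum => j _.
  by rewrite !sumr_const !card_ord -mulrA !mulr_natl.
by rewrite -lecR !rmorphM !rmorph_nat /= -e.
Qed.

Variables p q p' q' : nat.
Local Notation V := 'M[C]_(p.+1, q.+1).
Local Notation W := 'M[C]_(p'.+1, q'.+1).

Lemma pos_complex (e : C) : 0 < e -> 0 < complex.Re e /\ e = ((complex.Re e)%:C)%C.
Proof.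
move=> e0; have er : e = ((complex.Re e)%:C)%C by rewrite RRe_real // gtr0_real.
by split=> //; rewrite -ltcR -er.
Qed.

(** The remainder is of second order and in particular negligible. *)
Lemma differentiable_quadratic (f : V -> W) (l : {linear V -> W}) (K1 K2 e : R) :
  0 < e -> 0 <= K1 -> 0 <= K2 ->
  (forall B, n1 (l B) <= K1 * n1 B) ->
  (forall B, n1 B < e -> n1 (f B - f 0 - l B) <= K2 * n1 B ^+ 2) ->
  differentiable f (0 : V).
Proof.
move=> e0 K10 K20 Hl Hf.
have cl : continuous l.
  move=> x; apply/(@cvg_n1 _ _ (nbhs x) (nbhs_filter x)) => d d0; apply: (near_n1 (e := d / (K1 + 1))).
    by rewrite divr_gt0 // ltr_wpDl.
  move=> A hA; have -> : l A - l x = l (A - x) by rewrite linearB.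
  apply: le_lt_trans (Hl _) _.
  apply: (@le_lt_trans _ _ ((K1 + 1) * n1 (A - x))).
    by rewrite ler_wpM2r ?n1_ge0 // lerDl.
  by rewrite mulrC -ltr_pdivlMr // ltr_wpDl.
have fl : f \o shift 0 = cst (f 0) + l +o_ (0 : V) id.
  apply/eqaddoP => eps eps0; have [r0 er] := pos_complex eps0.
  set r := complex.Re eps in r0 er.
  pose k : R := p.+1%:R * q.+1%:R.
  have k0 : 0 < k by rewrite mulr_gt0.
  have d0 : 0 < r / k / (K2 + 1) by rewrite !divr_gt0 // ltr_wpDl.
  apply: (near_n1 (e := Num.min e (r / k / (K2 + 1)))); first by rewrite lt_min e0.
  move=> B; rewrite subr0 lt_min => /andP[Be Bd] /=.
  have -> : (f \o shift 0 - (cst (f 0) + l)) B = f B - f 0 - l B.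
    by rewrite -[LHS]/(f (B + 0) - (f 0 + l B)) addr0 opprD addrA.
  apply: le_trans (mx_norm_n1 _) _.
  apply: (@le_trans _ _ (((r / k * n1 B)%:C)%C)).
    rewrite lecR; apply: le_trans (Hf _ Be) _; rewrite expr2 mulrA.
    apply: ler_wpM2r; first exact: n1_ge0.
    apply: (@le_trans _ _ ((K2 + 1) * n1 B)).
      by rewrite ler_wpM2r ?n1_ge0 // lerDl.
    by rewrite mulrC -ler_pdivlMr ?ltr_wpDl // ltW.
  rewrite rmorphM /= er.
  have rk : 0 <= ((r / k)%:C)%C :> C by rewrite ler0c divr_ge0 // ltW.
  apply: le_trans (ler_wpM2l rk (n1_le_norm B)) _.
  rewrite mulrA; apply: ler_wpM2r => //.
  have -> : (p.+1%:R * q.+1%:R : C) = ((k)%:C)%C by rewrite /k rmorphM !rmorph_nat.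
  by rewrite -rmorphM /= divfK // gt_eqF.
have dE := diff_unique cl fl.
by apply/diff_locallyP; split; rewrite dE.
Qed.

(** Only real multiples of a fixed direction are needed in the sequel, which
    avoids little-o notation there. *)
Lemma differentiable_expand (f : V -> W) (A : V) (e : R) : differentiable f (0 : V) -> 0 < e ->
  exists2 d : R, 0 < d & forall t : R, 0 < t -> t < d ->
    n1 (f ((t%:C)%C *: A) - f 0 - (t%:C)%C *: 'd f (0 : V) A) <= e * t.
Proof.
move=> /diff_locallyP[_ /eqaddoP H] e0.
pose k : R := p'.+1%:R * q'.+1%:R.
have k0 : 0 < k by rewrite mulr_gt0.
pose r := e / k / (n1 A + 1).
have A1 : 0 < n1 A + 1 by rewrite ltr_wpDl // n1_ge0.
have r0 : 0 < r by rewrite !divr_gt0.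
have {}H := H ((r%:C)%C : C) ltac:(by rewrite ltcR).
have [d d0 Hd] := n1_near H.
exists (d / (n1 A + 1)); first by rewrite divr_gt0.
move=> t t0 td.
have nt : n1 ((t%:C)%C *: A) = t * n1 A by rewrite n1Z cmod_real gtr0_norm.
have hd : n1 ((t%:C)%C *: A - 0) < d.
  rewrite subr0 nt; apply: (@le_lt_trans _ _ (t * (n1 A + 1))).
    by rewrite ler_pM2l // lerDl.
  by rewrite -ltr_pdivlMr.
have := Hd _ hd => /=.
have -> : (f \o shift 0 - (cst (f 0) + 'd f (0 : V))) ((t%:C)%C *: A) =
    f ((t%:C)%C *: A) - f 0 - (t%:C)%C *: 'd f (0 : V) A.
  by rewrite -linearZ /= -[LHS]/(f (((t%:C)%C *: A) + 0) - (f 0 + 'd f (0 : V) ((t%:C)%C *: A))) addr0 opprD addrA.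
set Y := _ - _ - _ => hY.
rewrite -lecR; apply: le_trans (n1_le_norm Y) _.
have kE : (p'.+1%:R * q'.+1%:R : C) = (k%:C)%C by rewrite /k rmorphM !rmorph_nat.
have k1 : 0 <= (k%:C)%C :> C by rewrite ler0c ltW.
rewrite kE; apply: le_trans (ler_wpM2l k1 hY) _.
have r1 : 0 <= (r%:C)%C :> C by rewrite ler0c ltW.
apply: le_trans (ler_wpM2l k1 (ler_wpM2l r1 (mx_norm_n1 _))) _.
rewrite nt -!rmorphM lecR.
apply: (@le_trans _ _ (k * (r * (t * (n1 A + 1))))).
  by rewrite !ler_pM2l // lerDl.
rewrite /r; move: (n1 A + 1) A1 => x x0.
by rewrite le_eqVlt; apply/orP; left; apply/eqP; field; rewrite !gt_eqF.
Qed.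
End Differentials.

(** * Chart transitions and the solution map *)

Section Transition.
Context {R : realType} {n : nat}.
Local Notation C := (Cplx R).
Local Notation V := 'rV[C]_n.+1.
Local Notation M := 'M[C]_n.+1.

(** The chart centered at graph L A, read in the chart centered at L, is
    differentiable at its center: the new coordinate is an affine function
    of B up to a quadratic error. *)
Lemma chart_transition (L : {vspace V}) (A : M) : hom_perp L A ->
  exists (S S' : M) (K e : R), [/\ 0 < e, 0 <= K & forall B : M, n1 B < e ->
    exists D, [/\ hom_perp L D, chart (graph L A) B = graph L D &
      n1 (D - A - S *m B *m S') <= K * n1 B ^+ 2]].
Proof.
move=> hA; have /hom_perpE[a1 a2] := hA.
set P := oproj L in a1 a2; have PP : P *m P = P := orthoproj_idem L.
pose P1 := oproj (graph L A).
pose G := P *m (1%:M + A).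
pose S := G *m P1; pose Sq := (1%:M - P1) *m P; pose Ss := (1%:M - P1) *m (1%:M - P).
pose d := 2 * n1 (1%:M : M).
have d0 : 0 <= d by rewrite mulr_ge0 // n1_ge0.
pose kq := n1 S * n1 Sq; pose ks := n1 S * n1 Ss.
have kq0 : 0 <= kq by rewrite mulr_ge0 // n1_ge0.
have ks0 : 0 <= ks by rewrite mulr_ge0 // n1_ge0.
pose e := Num.min 1 (2^-1 / (kq + 1)).
have e0 : 0 < e by rewrite lt_min ltr01 divr_gt0 // ltr_wpDl.
exists S, (Ss - Sq *m A), (kq * ks + d * kq ^+ 2 * (n1 A + ks)), e; split=> //.
  by rewrite addr_ge0 ?mulr_ge0 ?addr_ge0 ?exprn_ge0 ?n1_ge0.
move=> B; rewrite lt_min => /andP[B1 Be].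
(* The subspace with coordinate B is the image of L under k, whose
   coordinate is the inverse of 1 + q times A + s, with q and s linear in B.
   *)
pose k := (1%:M + A) *m (1%:M + to_hom_perp (graph L A) B).
pose q := S *m B *m Sq; pose s := S *m B *m Ss.
have B0 := n1_ge0 B.
have hq : n1 q <= kq * n1 B.
  apply: le_trans (n1M _ _) _; rewrite /kq mulrAC; apply: ler_wpM2r; first exact: n1_ge0.
  exact: n1M.
have hs : n1 s <= ks * n1 B.
  apply: le_trans (n1M _ _) _; rewrite /ks mulrAC; apply: ler_wpM2r; first exact: n1_ge0.
  exact: n1M.
have q2 : n1 q <= 2^-1.
  apply: le_trans hq _; apply: (@le_trans _ _ ((kq + 1) * n1 B)).
    by rewrite ler_wpM2r // lerDl.
  by rewrite mulrC -ler_pdivlMr ?ltr_wpDl // ltW.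
have Pk : P *m k = G + S *m B *m (1%:M - P1).
  by rewrite /k to_hom_perpE -/P1 mulmxA -/G mulmxDr mulmx1 /S !mulmxA.
have GP : G *m P = P by rewrite /G mulmxDr mulmx1 a1 mulmxDl PP a2 addr0.
have GP' : G *m (1%:M - P) = A by rewrite mulmxBr mulmx1 GP /G mulmxDr mulmx1 a1 addrC addKr.
have PkP : P *m k *m P = P + q by rewrite Pk mulmxDl GP -mulmxA.
have PkP' : P *m k *m (1%:M - P) = A + s by rewrite Pk mulmxDl GP' -mulmxA.
have [uQ _ _ hZ] := neumann q2.
have QE : P *m k *m P + (1%:M - P) = 1%:M + q by rewrite PkP addrAC; congr (_ + _); rewrite addrC subrK.
have uQ' : P *m k *m P + (1%:M - P) \in unitmx by rewrite QE.
have [hD gD] := graph_coordP uQ'.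
exists (graph_coord L k); split=> //.
  rewrite gD /chart /graph; apply/vspaceP => w; apply/mem_image_mulmx/mem_image_mulmx.
    move=> [x /mem_image_mulmx[y yL ->] ->]; exists y => //.
    by rewrite /k mulmxA.
  move=> [y yL ->]; exists (y *m (1%:M + A)); last by rewrite /k mulmxA.
  by apply/mem_image_mulmx; exists y.
rewrite /graph_coord -/P QE PkP'.
set Z := invmx _ - 1%:M + q in hZ.
have -> : invmx (1%:M + q) = 1%:M - q + Z.
  by rewrite /Z; move: (invmx _) => I; apply/matrixP => i j; rewrite !mxE; ring.
have -> : (1%:M - q + Z) *m (A + s) - A - S *m B *m (Ss - Sq *m A) =
   Z *m (A + s) - q *m s.
  rewrite (mulmxBr (S *m B) Ss) (mulmxA (S *m B) Sq A) -/q -/s mulmxDl mulmxBl mul1mx mulmxDr.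
  move: (Z *m (A + s)) (q *m A) (q *m s) => z' a b.
  apply/matrixP => i j; rewrite !mxE; ring.
apply: le_trans (n1B _ _) _; rewrite addrC [leRHS]mulrDl; apply: lerD.
  apply: le_trans (n1M _ _) _.
  have -> : kq * ks * n1 B ^+ 2 = (kq * n1 B) * (ks * n1 B) by ring.
  by apply: ler_pM; rewrite ?n1_ge0.
apply: le_trans (n1M _ _) _.
have -> : d * kq ^+ 2 * (n1 A + ks) * n1 B ^+ 2 = (d * (kq * n1 B) ^+ 2) * (n1 A + ks) by ring.
apply: (ler_pM (n1_ge0 _) (n1_ge0 _)).
  apply: le_trans hZ _; move: hq (n1_ge0 q) d0; rewrite -/d.
  by move: (n1 q) (kq * n1 B) d => x y d' xy x0 d0'; rewrite ler_wpM2l // lerXn2r ?nnegrE // (le_trans x0 xy).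
apply: (le_trans (n1D _ _)); rewrite lerD2l; apply: (le_trans hs).
by apply: ler_piMr => //; apply: ltW.
Qed.
End Transition.

Section SolutionMap.
Context {R : realType} {n c m : nat}.
Local Notation C := (Cplx R).
Local Notation V := 'rV[C]_n.+1.
Local Notation M := 'M[C]_n.+1.
Local Notation poly := (mpoly.mpoly n.+1 C).
Local Notation eval := (@Defs.eval R n).
Variables (X : set V) (F : 'I_c -> poly) (E : 'M[C]_(n.+1, m.+1)) (z : V).
Variables (N : 'M[C]_(c + m.+1, n.+1)) (L : {vspace V}).
Hypothesis varX : proj_variety X.
Hypothesis chX : has_chain X m.
Hypothesis Xz : X z.
Hypothesis zL : z \in L.
Hypothesis FX : forall i, ideal_of X (F i).
Hypothesis HE : forall u, u *m E = 0 <-> u \in tlinear L z.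
Hypothesis LN : row_mx (gradmx F z) E *m N = 1%:M.
Hypothesis NL : N *m row_mx (gradmx F z) E = 1%:M.
Hypothesis cm : (c + m.+1 = n.+1)%N.

(** The columns of E are equations of the tangent space of L at z, and w - w
    A lies in L exactly when w lies in the graph of A. *)
Lemma incidence_equation A w : hom_perp L A ->
  (w - z - w *m A) *m E = 0 <-> w \in graph L A /\ hdot (w - z) z = 0.
Proof.
move=> hA; have /hom_perpE[a1 a2] := hA.
have Az : hdot (w *m A) z = 0.
  by rewrite -(orthoproj_id zL) -dot_orthoproj -mulmxA a2 mulmx0 dot0l.
rewrite HE mem_tlinear /tangent_linear /= -hdot_dotmx dotBl Az subr0 mem_graph //.
have -> : w - z - w *m A = w - w *m A - z by rewrite addrAC.
split=> -[h1 h2]; split=> //.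
  by rewrite -(subrK z (w - w *m A)); apply: memvD.
exact: memvB.
Qed.

Lemma dsystemE A w u : dsystem F E A w u = u *m row_mx (gradmx F w) ((1%:M - A) *m E).
Proof. by rewrite /dsystem mul_mx_row mulmxA mulmxBr mulmx1. Qed.

(** Subtracting the equations at (A, w) and at (A0, w0) leaves the
    derivative at w0 applied to w - w0, the term w0 (A - A0) E, and
    quadratic errors; the derivative is invertible. *)
Lemma solution_expand r e (w0 : V) A0 : good_radius F E z N r e -> n1 A0 <= e ->
  n1 (w0 - z) <= r -> system F E z A0 w0 = 0 ->
  exists (S : M) (K : R), 0 <= K /\ forall A w, n1 A <= e -> n1 (w - z) <= r ->
    system F E z A w = 0 -> n1 (w - w0 - w0 *m (A - A0) *m S) <= K * n1 (A - A0) ^+ 2.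
Proof.
move=> gr hA0 hw0 s0; have [r0 _ _ Hd _] := gr.
pose G := row_mx (gradmx F w0) ((1%:M - A0) *m E) *m N.
have uG : G \in unitmx.
  rewrite -row_free_unit -kermx_eq0; apply/eqP/row_matrixP => i; rewrite row0.
  set v := row i _; have vG : v *m G = 0 by rewrite /v -row_mul mulmx_ker row0.
  apply: n1_le0; have := Hd A0 w0 v hA0 hw0.
  by rewrite dsystemE -mulmxA -/G vG subr0; have := n1_ge0 v; lra.
pose b := n1 z + r; have b0 : 0 <= b by rewrite addr_ge0 ?n1_ge0 // ltW.
have inb w : n1 (w - z) <= r -> n1 w <= b.
  by move=> h; rewrite -(subrK z w) addrC; apply: le_trans (n1D _ _) _; rewrite lerD2l.
have [KF KF0 HKF] := eqvec_estimates F b0.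
pose lip := 2 * (n1 N * (b * n1 E)).
have lip0 : 0 <= lip by rewrite !mulr_ge0 ?n1_ge0.
exists (E *m dsubmx N *m invmx G), ((KF * lip ^+ 2 + lip * n1 E) * (n1 N * n1 (invmx G))).
split; first by rewrite !mulr_ge0 ?addr_ge0 ?mulr_ge0 ?exprn_ge0 ?n1_ge0.
move=> A w hA hw sA; set D := A - A0; set u := w - w0.
have hu : n1 u <= lip * n1 D.
  apply: le_trans (n1_le_system gr hA0 hw hw0) _; rewrite s0 subr0.
  have -> : system F E z A0 w = row_mx 0 (w *m D *m E).
    have /eq_row_mx[e1 e2] : row_mx (eqvec F w) ((w - z - w *m A) *m E) = row_mx 0 0.
      by rewrite row_mx0; apply: sA.
    rewrite /system e1; congr row_mx; rewrite -[LHS]subr0 -e2 -mulmxBl; congr (_ *m E).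
    rewrite [RHS]mulmxBr; move: (w *m A0) (w *m A) => xa xb.
    by apply/rowP => i; rewrite !mxE; ring.
  have st : n1 (w *m D *m E) <= (b * n1 E) * n1 D.
    rewrite mulrAC; apply: (le_trans (n1M _ _)); apply: ler_wpM2r; first exact: n1_ge0.
    apply: (le_trans (n1M _ _)); apply: ler_wpM2r; [exact: n1_ge0|exact: inb].
  rewrite n1_row_mx n1_0 add0r /lip.
  have -> : 2 * (n1 N * (b * n1 E)) * n1 D = 2 * (n1 N * (b * n1 E * n1 D)) by rewrite -!mulrA.
  by rewrite ler_pM2l //; apply: (ler_wpM2l (n1_ge0 N) st).
have [hq _] := HKF w0 w (inb _ hw0) (inb _ hw).
have [f0 g0] : eqvec F w0 = 0 /\ (w0 - z - w0 *m A0) *m E = 0.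
  by apply/eq_row_mx; rewrite row_mx0; apply: s0.
have [f1 g1] : eqvec F w = 0 /\ (w - z - w *m A) *m E = 0.
  by apply/eq_row_mx; rewrite row_mx0; apply: sA.
have ds : u *m row_mx (gradmx F w0) ((1%:M - A0) *m E) =
   row_mx (u *m gradmx F w0) (w0 *m D *m E + u *m D *m E).
  rewrite mul_mx_row mulmxA; congr row_mx.
  rewrite -mulmxDl -mulmxDl; apply/eqP; rewrite -subr_eq0 -mulmxBl; apply/eqP.
  rewrite -[RHS](subrr 0) -{1}g1 -g0 -mulmxBl; congr (_ *m E).
  have -> : w0 + u = w by rewrite addrC subrK.
  rewrite /u /D !mulmxBr mulmx1 !mulmxBl; move: (w *m A) (w *m A0) (w0 *m A0) => x y t.
  by apply/rowP => i; rewrite !mxE; ring.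
have uE : u = row_mx (u *m gradmx F w0) (w0 *m D *m E + u *m D *m E) *m N *m invmx G.
  by rewrite -ds -(mulmxA u _ N) -/G mulmxK.
have -> : u - w0 *m D *m (E *m dsubmx N *m invmx G) =
   row_mx (u *m gradmx F w0) (u *m D *m E) *m N *m invmx G.
  rewrite {1}uE !mulmxA -mulmxBl; congr (_ *m _).
  have -> : w0 *m D *m E *m dsubmx N = row_mx 0 (w0 *m D *m E) *m N.
    by rewrite -{2}(vsubmxK N) mul_row_col mul0mx add0r.
  by rewrite -mulmxBl row_mxB subr0 [_ + u *m D *m E]addrC addrK.
have sh (k x y d : R) : k * (x * y) * d = k * d * x * y by ring.
apply: (le_trans (n1M _ _)); rewrite sh.
apply: ler_wpM2r; first exact: n1_ge0.
apply: (le_trans (n1M _ _)); apply: ler_wpM2r; first exact: n1_ge0.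
have D0 := n1_ge0 D; have u0 := n1_ge0 u.
rewrite n1_row_mx [leRHS]mulrDl; apply: lerD.
  move: hq; rewrite f1 f0 subrr sub0r n1N => hq; apply: le_trans hq _.
  have h2 : n1 u ^+ 2 <= (lip * n1 D) ^+ 2 by rewrite ler_sqr ?nnegrE //; apply: (mulr_ge0 lip0 D0).
  by apply: (le_trans (ler_wpM2l KF0 h2)); rewrite exprMn mulrA.
apply: le_trans (n1M _ _) _.
have -> : lip * n1 E * n1 D ^+ 2 = (lip * n1 D) * n1 D * n1 E by ring.
apply: ler_wpM2r; first exact: n1_ge0.
by apply: le_trans (n1M _ _) _; apply: ler_wpM2r.
Qed.

(** The solution of the system with parameter A is, up to scaling, the point
    of Z near z on the graph of A. Points are normalized by their inner
    product with z, and the open cone on which normalized points are close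
    to z serves as the neighborhood. *)
Lemma exists_solution_map : exists g, solution_map X L z g.
Proof.
have cX : proj_closed X by case: varX.
have z0 : z != 0 by apply: proj_closed_neq0 Xz.
have nz0 : 0 < n1 z by rewrite lt_neqAle eq_sym n1_eq0 z0 n1_ge0.
have [rho rho0 Hrho] := locus_in_ideal varX chX Xz FX LN NL cm.
have Fz : eqvec F z = 0 by apply/rowP => i; rewrite !mxE; apply: FX.
have r00 : 0 < Num.min rho (n1 z / 2) by rewrite lt_min rho0 divr_gt0.
have [r [e [rr0 gr]]] := solve_system LN NL Fz r00.
have [r0 e0 _ _ Hsol] := gr.
have XF w : n1 (w - z) <= r -> (eqvec F w = 0 <-> X w).
  move=> hw; split=> [Fw|Xw]; last by apply/rowP => i; rewrite !mxE; apply: FX.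
  have [S [hS XS]] := cX; rewrite XS; split.
    apply: contraTneq hw => ->; rewrite sub0r n1N -ltNge.
    apply: le_lt_trans rr0 _; rewrite gt_min; apply/orP; right; lra.
  move=> f Sf; apply: (Hrho w) => //.
    by apply: le_trans hw _; apply: le_trans rr0 _; rewrite ge_min lexx.
  by move=> w'; rewrite XS => -[_]; apply.
have sysP A w : hom_perp L A -> n1 (w - z) <= r ->
    (system F E z A w = 0 <-> [/\ X w, w \in graph L A & hdot (w - z) z = 0]).
  move=> hA hw; rewrite /system -row_mx0; split.
    by move=> /eq_row_mx[/(XF w hw) Xw /(incidence_equation _ hA)[h1 h2]].
  move=> [/(XF w hw) -> h1 h2]; congr row_mx.
  by apply/(incidence_equation _ hA).
have /choice[ga Hga] : forall A : M, exists w, n1 A <= e ->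
    n1 (w - z) <= r /\ system F E z A w = 0.
  move=> A; have [hA|] := boolP (n1 A <= e); last by exists 0.
  have [|w hw sw] := Hsol A 0 hA; first by rewrite n1_0 ltW.
  by exists w => _; rewrite sw row_mx0.
have gauniq A w : n1 A <= e -> n1 (w - z) <= r -> system F E z A w = 0 -> w = ga A.
  move=> hA hw sw; have [h1 h2] := Hga A hA; apply/eqP; rewrite -subr_eq0; apply/eqP/n1_le0.
  by apply: le_trans (n1_le_system gr hA hw h1) _; rewrite sw h2 subrr n1_0 !mulr0.
pose c1 := 2 * (n1 N * (n1 z * n1 E)).
have c10 : 0 <= c1 by rewrite !mulr_ge0 ?n1_ge0.
pose e1 := Num.min e (r / (c1 + 1)).
have e10 : 0 < e1 by rewrite lt_min e0 divr_gt0 // ltr_wpDl.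
have e1e (A : M) : n1 A < e1 -> n1 A <= e by move=> /ltW h; apply: le_trans h _; rewrite ge_min lexx.
have zr : n1 (z - z) <= r by rewrite subrr n1_0 ltW.
have gar (A : M) : n1 A < e1 -> n1 (ga A - z) < r.
  move=> hA; have [h1 h2] := Hga A (e1e _ hA).
  apply: le_lt_trans (n1_le_system gr (e1e _ hA) h1 zr) _.
  rewrite h2 sub0r n1N /system Fz subrr sub0r n1_row_mx n1_0 add0r mulNmx n1N.
  apply: (@le_lt_trans _ _ (c1 * n1 A)).
    have st : n1 (z *m A *m E) <= (n1 z * n1 E) * n1 A.
      rewrite mulrAC; apply: (le_trans (n1M _ _)); apply: ler_wpM2r; first exact: n1_ge0.
      exact: n1M.
    have -> : c1 * n1 A = 2 * (n1 N * (n1 z * n1 E * n1 A)) by rewrite /c1 -!mulrA.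
    by rewrite ler_pM2l //; apply: (ler_wpM2l (n1_ge0 N) st).
  apply: (@le_lt_trans _ _ ((c1 + 1) * n1 A)).
    by rewrite ler_wpM2r ?n1_ge0 // lerDl.
  by move: hA; rewrite lt_min => /andP[_]; rewrite ltr_pdivlMr ?ltr_wpDl // mulrC.
(* A subspace near L is the graph of exactly one A, which the choice
   recovers. *)
pose g (L' : {vspace V}) := ga (xget 0 [set A | hom_perp L A /\ graph L A = L']).
have gE A : hom_perp L A -> g (graph L A) = ga A.
  move=> hA; rewrite /g.
  have [h1 h2] : [set A' | hom_perp L A' /\ graph L A' = graph L A]
      (xget 0 [set A' | hom_perp L A' /\ graph L A' = graph L A]).
    by apply: xgetPex; exists A.
  by congr ga; apply: graph_inj h2.
pose U := [set L' | exists A, [/\ hom_perp L A, n1 A < e1 & L' = graph L A]].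
have h0 := hom_perp0 L.
have n10 : n1 (0 : M) < e1 by rewrite n1_0.
have UL : U L by exists 0; split=> //; rewrite graph0.
(* The open cone of the vectors v for which <z, z> v - <v, z> z is small
   compared with <v, z>; on vectors with <v, z> = <z, z> it is the ball
   around z. *)
pose D : M := ((hdot z z)%:M - z ^t* *m z).
pose O := [set v : V | n1 (v *m D) < r * n1 (v *m z ^t*)].
have zz0 : hdot z z != 0.
  by rewrite dot_vnorm (inj_eq (@complexI R) _ 0) sqrf_eq0 vnorm_eq0.
have vD v : v *m D = hdot z z *: v - hdot v z *: z.
  rewrite /D mulmxBr mul_mx_scalar mulmxA; congr (_ - _).
  by rewrite [v *m _]mx11_scalar mul_scalar_mx hdotE.
have vz v : n1 (v *m z ^t*) = cmod (hdot v z) by rewrite /n1 !big_ord1 hdotE.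
have OP v : O v <-> n1 (hdot z z *: v - hdot v z *: z) < r * cmod (hdot v z).
  by rewrite /O /= vD vz.
have Onorm v : hdot v z = hdot z z -> O v <-> n1 (v - z) < r.
  move=> h; rewrite OP h -scalerBr n1Z mulrC ltr_pM2r //.
  by rewrite lt_neqAle eq_sym cmod_eq0 zz0 cmod_ge0.
have OZ a v : a != 0 -> O v -> O (a *: v).
  move=> a0; rewrite !OP dotZl -(scalerA a (hdot v z) z) (scalerA (hdot z z) a v) (mulrC (hdot z z) a) -(scalerA a (hdot z z) v) -scalerBr n1Z cmodM.
  by rewrite mulrCA ltr_pM2l // lt_neqAle eq_sym cmod_eq0 a0 cmod_ge0.
have Oopen : open O.
  rewrite openE => v /= Ov; rewrite /O /= in Ov.
  pose k := n1 D + r * n1 (z ^t*) + 1.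
  have k0 : 0 < k by rewrite ltr_wpDl // addr_ge0 ?mulr_ge0 ?n1_ge0 // ltW.
  apply: (near_n1 (e := (r * n1 (v *m z ^t*) - n1 (v *m D)) / k)).
    by rewrite divr_gt0 // subr_gt0.
  move=> v'; rewrite ltr_pdivlMr // => hv.
  have t1 : n1 (v' *m D) <= n1 (v' - v) * n1 D + n1 (v *m D).
    rewrite -{1}(subrK v v') mulmxDl; apply: le_trans (n1D _ _) _; rewrite lerD2r; exact: n1M.
  have t2 : n1 (v *m z ^t*) <= n1 (v' - v) * n1 (z ^t*) + n1 (v' *m z ^t*).
    rewrite n1C -{1}(subrK v' v) mulmxDl; apply: le_trans (n1D _ _) _; rewrite lerD2r; exact: n1M.
  have t3 := ler_wpM2l (ltW r0) t2; have := n1_ge0 (v' - v).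
  rewrite /O /=; move: hv t1 t3; rewrite /k.
  move: (n1 (v' - v)) (n1 D) (n1 (z ^t*)) (n1 (v' *m D)) (n1 (v *m D)) (n1 (v *m _)) (n1 (v' *m _)).
  by move=> *; nra.
have dotg A : hom_perp L A -> n1 A < e1 -> [/\ X (ga A), ga A \in graph L A, n1 (ga A - z) < r &
     hdot (ga A) z = hdot z z].
  move=> hA hAe; have [h1 h2] := Hga A (e1e _ hAe).
  have [x1 x2 x3] := (sysP A _ hA h1).1 h2; split=> //; first exact: gar.
  by apply/eqP; rewrite -subr_eq0 -dotBl x3.
have trans A : hom_perp L A -> n1 A < e1 -> exists (S S' : M) (K d : R),
    [/\ 0 < d, 0 <= K & forall B : M, n1 B < d -> exists A', [/\ hom_perp L A', n1 A' < e1,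
      chart (graph L A) B = graph L A' & n1 (A' - A - S *m B *m S') <= K * n1 B ^+ 2]].
  move=> hA hAe; have [S [S' [K [d [d0 K0 H]]]]] := chart_transition hA.
  pose k := n1 S * n1 S' + K + 1.
  have k0 : 0 < k by rewrite ltr_wpDl // addr_ge0 // mulr_ge0 // n1_ge0.
  pose d' := Num.min (Num.min d 1) ((e1 - n1 A) / k).
  exists S, S', K, d'; split=> //; first by rewrite !lt_min d0 ltr01 divr_gt0 // subr_gt0.
  move=> B; rewrite !lt_min => /andP[/andP[Bd B1] Bk].
  have [A' [hA' cA' qA']] := H B Bd; exists A'; split=> //.
  have t1 : n1 (A' - A) <= n1 B * k.
    have := n1D (A' - A - S *m B *m S') (S *m B *m S'); rewrite subrK.
    have s1 : n1 (S *m B *m S') <= n1 S * n1 B * n1 S'.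
      apply: le_trans (n1M _ _) _; apply: ler_wpM2r; [exact: n1_ge0|exact: n1M].
    have s2 : K * n1 B ^+ 2 <= K * n1 B.
      by apply: ler_wpM2l => //; rewrite expr2 ler_piMr ?n1_ge0 // ltW.
    move: qA' s1 s2 (n1_ge0 B); rewrite /k; move: (n1 (A' - A - _)) (n1 (A' - A)) (n1 (S *m B *m S')).
    by move=> x y t; move: (n1 S) (n1 S') (n1 B) (n1 B ^+ 2) => *; lra.
  move: Bk; rewrite ltr_pdivlMr // => Bk.
  have := n1D (A' - A) A; rewrite subrK; move: t1 Bk.
  by move: (n1 (A' - A)) (n1 A') (n1 B * k) => *; lra.
exists g; split.
  have <- : graph L 0 = L := graph0 L.
  rewrite gE //; apply/esym/gauniq => //; first exact: e1e.
  by rewrite /system Fz subrr sub0r mulmx0 oppr0 mul0mx row_mx0.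
exists U, (X `&` O); split=> //.
- split=> [L' [A [hA hAe ->]]|L' [A [hA _ ->]]] /=; last exact: dim_graph.
  have [S [S' [K [d [d0 K0 H]]]]] := trans A hA hAe.
  apply: (near_n1 d0) => B; rewrite subr0 => /H[A' [hA' hA'e -> _]].
  by exists A'.
- split; first by exists O.
  by split=> //; apply/(Onorm z) => //; rewrite subrr n1_0.
- move=> L' [A [hA hAe ->]].
  have [S [S' [K [d [d0 K0 H]]]]] := trans A hA hAe.
  have [h1 h2] := Hga A (e1e _ hAe).
  have [S3 [K' [K'0 H3]]] := solution_expand gr (e1e _ hAe) h1 h2.
  set w0 := ga A in h1 h2 H3.
  have gch B : n1 B < d -> exists A', [/\ (g \o chart (graph L A)) B = ga A', n1 A' < e1 &
      n1 (A' - A - S *m B *m S') <= K * n1 B ^+ 2].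
    by move=> /H[A' [hA' hA'e cA' q]]; exists A'; split=> //=; rewrite cA' gE.
  have g0 : (g \o chart (graph L A)) 0 = w0.
    have e0' : chart (graph L A) 0 = graph L A.
      by rewrite /chart to_hom_perpE mulmx0 mul0mx graph0.
    by rewrite /= e0' gE.
  pose l : {linear M -> V} := mulmxr (S' *m S3) \o mulmx (w0 *m S).
  have lE B : l B = w0 *m (S *m B *m S') *m S3 by rewrite /l /= !mulmxA.
  pose a := n1 S * n1 S' + K.
  have a0 : 0 <= a by rewrite addr_ge0 // mulr_ge0 // n1_ge0.
  apply: (@differentiable_quadratic _ _ _ _ _ _ l (n1 (w0 *m S) * n1 (S' *m S3))
     (n1 w0 * K * n1 S3 + K' * a ^+ 2) (Num.min d 1)).
  + by rewrite lt_min d0 ltr01.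
  + by rewrite mulr_ge0 // n1_ge0.
  + by rewrite addr_ge0 ?mulr_ge0 ?exprn_ge0 ?n1_ge0.
  + move=> B; rewrite /l /=; apply: le_trans (n1M _ _) _; rewrite mulrAC.
    by apply: ler_wpM2r; [apply: n1_ge0|apply: n1M].
  move=> B; rewrite lt_min => /andP[Bd B1]; rewrite g0.
  have [A' [-> hA'e q]] := gch B Bd; have [k1 k2] := Hga A' (e1e _ hA'e).
  have q' := H3 A' _ (e1e _ hA'e) k1 k2.
  rewrite lE.
  have -> : ga A' - w0 - w0 *m (S *m B *m S') *m S3 =
     (ga A' - w0 - w0 *m (A' - A) *m S3) + w0 *m (A' - A - S *m B *m S') *m S3.
    by rewrite [w0 *m (A' - A - _)]mulmxBr mulmxBl addrA subrK.
  apply: le_trans (n1D _ _) _; rewrite addrC mulrDl; apply: lerD.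
    apply: le_trans (n1M _ _) _; rewrite mulrAC; apply: ler_wpM2r; first exact: n1_ge0.
    apply: le_trans (n1M _ _) _; rewrite -mulrA; apply: ler_wpM2l => //; exact: n1_ge0.
  apply: le_trans q' _; rewrite -mulrA -exprMn; apply: ler_wpM2l => //.
  rewrite lerXn2r ?nnegrE ?mulr_ge0 ?n1_ge0 //.
  have := n1D (A' - A - S *m B *m S') (S *m B *m S'); rewrite subrK.
  have s1 : n1 (S *m B *m S') <= n1 S * n1 B * n1 S'.
    apply: le_trans (n1M _ _) _; apply: ler_wpM2r; [exact: n1_ge0|exact: n1M].
  have s2 : K * n1 B ^+ 2 <= K * n1 B.
    by apply: ler_wpM2l => //; rewrite expr2 ler_piMr ?n1_ge0 // ltW.
  move: q s1 s2; rewrite /a; move: (n1 (A' - A - _)) (n1 (A' - A)) (n1 (S *m B *m S')).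
  by move=> x y t; move: (n1 S) (n1 S') (n1 B) (n1 B ^+ 2) => *; lra.
- move=> L' [A [hA hAe ->]] w; rewrite gE //; have [x1 x2 x3 x4] := dotg A hA hAe.
  split=> [[[Xw Ow] wL]|[a a0 ->]]; last first.
    split; last exact: memvZ.
    split; first exact: proj_closed_cone.
    by apply: OZ => //; apply/Onorm.
  have wz0 : hdot w z != 0.
    move: Ow; rewrite OP; apply: contraTneq => ->.
    by rewrite cmod0 mulr0 -leNgt n1_ge0.
  pose a := hdot z z / hdot w z; have a0 : a != 0 by rewrite mulf_neq0 // invr_eq0.
  have wz : hdot (a *: w) z = hdot z z by rewrite dotZl divfK.
  exists a^-1; first by rewrite invr_eq0.
  suff <- : a *: w = ga A by rewrite scalerA mulVf // scale1r.
  have hr : n1 (a *: w - z) < r by apply/(Onorm (a *: w) wz); apply: OZ.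
  apply: gauniq; [exact: e1e|exact: ltW|].
  apply/sysP => //; first exact: ltW.
  split; first exact: proj_closed_cone.
    exact: memvZ.
  by rewrite dotBl wz subrr.
Qed.
End SolutionMap.

(** * The condition number *)

Section ConditionNumber.
Local Notation transversal := Defs.transversal.
Context {R : realType} {n : nat}.
Local Notation C := (Cplx R).
Local Notation V := 'rV[C]_n.+1.
Local Notation M := 'M[C]_n.+1.
Implicit Types (L T : {vspace V}) (A B : M) (u w z : V).

Lemma eq_ler (x y : R) : x = y -> x <= y.
Proof. by move=> ->. Qed.

Lemma le_linear_eq0 p q (A : 'M[C]_(p, q)) (K : R) :
  (forall e, 0 < e -> e <= 1 -> n1 A <= K * e) -> A = 0.
Proof. by move=> H; apply: n1_le0; apply: le_linear_small H. Qed.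

(** Along A the lift is z + t D + o(t). Inserting this into f = 0 for the
    equations f of Z, and into w (1 - P) = t w A, gives df(D) = 0 and D (1 -
    P) = z A; the Euler relation and z in L allow D to be projected
    orthogonally to z. *)
Lemma solution_derivative (X : set V) L z g A : proj_closed X -> X z -> z \in L ->
  solution_map X L z g -> hom_perp L A ->
  tangent_space X z (Dsolution L z g A) /\
  Dsolution L z g A *m (1%:M - oproj L) = z *m A.
Proof.
move=> cX Xz zL [gL [U [W [[Uo Usub] UL [exO Wz] hol Hg]]]] hA; have [Om [_ _ WE]] := exO.
have Wsub w : W w -> X w by rewrite WE => -[].
have ch t : chart L (t *: A) = graph L (t *: A).
  by rewrite /chart to_hom_perp_id //; apply: hom_perpZ.
have [d0 d00 Hd0] := n1_near (Uo L UL).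
pose h := g \o chart L.
have hz : h 0 = z by rewrite /h /= -(scale0r A) ch scale0r graph0.
pose P := oproj L.
have [D DE] : exists D, D = 'd h (0 : M) A by eexists.
(* Points w of Z on the graphs of small real multiples of A. *)
have small (e : R) : 0 < e -> exists t w, [/\ 0 < t, t <= e,
    X w, w *m (1%:M - P) = (t%:C)%C *: (w *m A) & n1 (w - z - (t%:C)%C *: D) <= e * t].
  move=> e0; have [d d_0 Hd] := differentiable_expand A (hol L UL) e0.
  pose k := n1 A + 1; have k0 : 0 < k by rewrite ltr_wpDl // n1_ge0.
  pose t := Num.min (Num.min (d / 2) e) (d0 / 2 / k).
  have t0 : 0 < t by rewrite !lt_min e0 !divr_gt0.
  have td : t < d.
    by apply: (@le_lt_trans _ _ (d / 2)); [rewrite !ge_min lexx|move: d_0; clear; lra].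
  have te : t <= e by rewrite !ge_min lexx orbT.
  have tk : t * n1 A < d0.
    apply: (@le_lt_trans _ _ (d0 / 2 / k * k)).
      apply: ler_pM; [exact: ltW|exact: n1_ge0|by rewrite !ge_min lexx !orbT|by rewrite lerDl].
    by rewrite divfK ?gt_eqF //; move: d00; clear; lra.
  have Ut : U (chart L ((t%:C)%C *: A)).
    by apply: Hd0; rewrite subr0 n1Z cmod_real ger0_norm // ltW.
  have [Ww wL] : W (h ((t%:C)%C *: A)) /\ h ((t%:C)%C *: A) \in chart L ((t%:C)%C *: A).
    by apply/(Hg _ Ut); exists 1; rewrite ?oner_neq0 ?scale1r.
  exists t, (h ((t%:C)%C *: A)); split=> //; first exact: Wsub.
    move: wL; rewrite ch mem_graphE; last exact: hom_perpZ.
    by rewrite -scalemxAr => /eqP.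
  by have := Hd t t0 td; rewrite -/h hz -DE.
pose nD := n1 D; have nD0 : 0 <= nD := n1_ge0 D.
have wz (e t : R) w : e <= 1 -> 0 < t -> n1 (w - z - (t%:C)%C *: D) <= e * t -> n1 (w - z) <= (nD + 1) * t.
  move=> e1 t0 h1; have := n1D (w - z - (t%:C)%C *: D) ((t%:C)%C *: D).
  rewrite subrK n1Z cmod_real gtr0_norm // -/nD; move: h1 e1 t0; clear.
  by move: (n1 _) (n1 _) nD => *; nra.
have DP : D *m (1%:M - P) = z *m A.
  apply/eqP; rewrite -subr_eq0; apply/eqP.
  apply: (@le_linear_eq0 _ _ _ (n1 (1%:M - P) + (nD + 1) * n1 A)) => e e0 e1.
  have [t [w [t0 te Xw wP hw]]] := small e e0.
  rewrite -(ler_pM2l t0) -{1}(gtr0_norm t0) -cmod_real -n1Z.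
  have -> : (t%:C)%C *: (D *m (1%:M - P) - z *m A) =
     (t%:C)%C *: ((w - z) *m A) - (w - z - (t%:C)%C *: D) *m (1%:M - P).
    rewrite [(w - z - _) *m _]mulmxBl [(w - z) *m (1%:M - P)]mulmxBl wP.
    have -> : z *m (1%:M - P) = 0 by rewrite mulmxBr mulmx1 orthoproj_id // subrr.
    rewrite -scalemxAl mulmxBl; move: (D *m _) (w *m A) (z *m A) => a b c.
    by apply/rowP => i; rewrite !mxE; ring.
  apply: (le_trans (n1B _ _)); rewrite n1Z cmod_real (gtr0_norm t0).
  have s1 := n1M (w - z) A; have s2 := n1M (w - z - (t%:C)%C *: D) (1%:M - P).
  have s3 := ler_wpM2r (n1_ge0 A) (wz e t w e1 t0 hw).
  have s4 := ler_wpM2r (n1_ge0 (1%:M - P)) hw.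
  have s5 : t * n1 ((w - z) *m A) <= t * ((nD + 1) * e * n1 A).
    rewrite ler_pM2l //; apply: (le_trans s1); apply: (le_trans s3).
    by apply: ler_wpM2r; [exact: n1_ge0|apply: ler_wpM2l => //; rewrite addr_ge0].
  apply: (le_trans (lerD s5 (le_trans s2 s4))); clear.
  by move: (n1 A) (n1 _) => a b; apply/eq_ler; ring.
have Df f : ideal_of X f -> dirder z D f = 0.
  move=> If; have b0 : 0 <= n1 z + (nD + 1) by rewrite !addr_ge0 ?n1_ge0.
  have [K K0 HK] := poly_estimates f b0.
  apply/eqP; rewrite -cmod_eq0 eq_le cmod_ge0 andbT.
  apply: (@le_linear_small _ _ (K * (nD + 1) ^+ 2 + K)) => e e0 e1.
  have [t [w [t0 te Xw wP hw]]] := small e e0.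
  have hwz := wz e t w e1 t0 hw.
  have zb : n1 z <= n1 z + (nD + 1) by rewrite lerDl addr_ge0.
  have wb : n1 w <= n1 z + (nD + 1).
    rewrite -(subrK z w) addrC; apply: (le_trans (n1D _ _)); rewrite lerD2l.
    by apply: (le_trans hwz); rewrite ler_piMr ?addr_ge0 // (le_trans te).
  have [_ _ h3 h4] := HK z w zb wb.
  rewrite (If z Xz) (If w Xw) subrr sub0r cmodN in h4.
  have := h3 (w - z - (t%:C)%C *: D).
  have e2 : (t%:C)%C * dirder z D f = dirder z (w - z) f - dirder z (w - z - (t%:C)%C *: D) f.
    have := dirderDu z (w - z - (t%:C)%C *: D) ((t%:C)%C *: D) f.
    by rewrite subrK dirderZu => ->; rewrite addrAC subrr add0r.
  move=> h5; rewrite -(ler_pM2l t0) -{1}(gtr0_norm t0) -cmod_real -cmodM e2.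
  apply: (le_trans (cmodD _ _)); rewrite cmodN.
  have h6 : n1 (w - z) ^+ 2 <= ((nD + 1) * t) ^+ 2.
    by rewrite ler_sqr ?nnegrE ?n1_ge0 // mulr_ge0 ?addr_ge0 // ltW.
  have h7 := le_trans h4 (ler_wpM2l K0 h6).
  have h8 := le_trans h5 (ler_wpM2l K0 hw).
  apply: (le_trans (lerD h7 h8)).
  rewrite exprMn; move: K0 t0 te (sqr_ge0 (nD + 1)); clear; move: ((nD + 1) ^+ 2) => y K0 t0 te y0.
  have : t * (K * y) * t <= t * (K * y) * e by rewrite ler_wpM2l // !mulr_ge0 // ltW.
  by rewrite expr2; lra.
have zP : z *m (1%:M - P) = 0 by rewrite mulmxBr mulmx1 orthoproj_id // subrr.
have uE : Dsolution L z g A = D - D *m oproj <[z]>%VS.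
  by rewrite /Dsolution -/h -DE -oprojE mulmxBr mulmx1.
have [a aE] := vlineP _ _ (orthoproj_mem <[z]>%VS D).
split; last by rewrite uE aE mulmxBl DP -scalemxAl zP scaler0 subr0.
apply/tangent_spaceE; split; first by rewrite uE; apply: orthoproj_ortho; apply: memv_line.
move=> f /vanishing_ideal_of If; rewrite uE aE -scaleNr dirderDu dirderZu Df // add0r.
by rewrite (euler cX Xz If) mulr0.
Qed.

(** The sine of the smallest angle between T and L. *)
Definition gap L T : R :=
  inf [set vnorm (u *m (1%:M - oproj L)) | u in [set u | u \in T /\ vnorm u = 1]].

Lemma unit_vector u : u != 0 -> vnorm (((vnorm u)^-1%:C)%C *: u) = 1.
Proof.
move=> u0; have v0 : 0 < vnorm u by rewrite vnorm_gt0.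
by rewrite vnormZ cmod_real ger0_norm ?invr_ge0 ?vnorm_ge0 // mulVf // gt_eqF.
Qed.

Lemma gap_nonempty L T : T != 0%VS ->
  [set vnorm (u *m (1%:M - oproj L)) | u in [set u | u \in T /\ vnorm u = 1]] !=set0.
Proof.
rewrite -vpick0 => T0; eexists; exists (((vnorm (vpick T))^-1%:C)%C *: vpick T) => //=.
by split; [apply: memvZ; apply: memv_pick|apply: unit_vector].
Qed.

Lemma gap_lbound L T :
  has_lbound [set vnorm (u *m (1%:M - oproj L)) | u in [set u | u \in T /\ vnorm u = 1]].
Proof. by exists 0 => _ [u _ <-]; apply: vnorm_ge0. Qed.

Lemma gap_ge0 L T : T != 0%VS -> 0 <= gap L T.
Proof.
by move=> T0; apply: lb_le_inf; [apply: gap_nonempty|move=> _ [u _ <-]; apply: vnorm_ge0].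
Qed.

Lemma gap_le L T u : u \in T -> gap L T * vnorm u <= vnorm (u *m (1%:M - oproj L)).
Proof.
move=> uT; have [->|u0] := eqVneq u 0; first by rewrite mul0mx vnorm0 mulr0.
have v0 : 0 < vnorm u by rewrite vnorm_gt0.
rewrite -ler_pdivlMr //; apply: ge_inf; first exact: gap_lbound.
exists (((vnorm u)^-1%:C)%C *: u); first by split; [apply: memvZ|apply: unit_vector].
by rewrite -scalemxAl vnormZ cmod_real ger0_norm ?invr_ge0 ?vnorm_ge0 // mulrC.
Qed.

Lemma gap_lt L T (r : R) : T != 0%VS -> gap L T < r ->
  exists u, [/\ u \in T, vnorm u = 1 & vnorm (u *m (1%:M - oproj L)) < r].
Proof.
by move=> T0 /(inf_lt (gap_nonempty L T0))[_ [u [uT u1] <-] lt]; exists u.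
Qed.

Lemma gap_eq0 L T : (T :&: L)%VS != 0%VS -> gap L T = 0.
Proof.
rewrite -vpick0; set u := vpick _ => u0; have /memv_capP[uT uL] := memv_pick (T :&: L)%VS.
have T0 : T != 0%VS by apply: contraNneq u0 => T0; rewrite -memv0 -T0.
apply/eqP; rewrite eq_le gap_ge0 // andbT -(pmulr_lle0 _ (_ : 0 < vnorm u)) ?vnorm_gt0 //.
by apply: le_trans (gap_le L uT) _; rewrite mulmxBr mulmx1 orthoproj_id // subrr vnorm0.
Qed.

(** On T the map u -> u (1 - P) is injective, so it has a left inverse,
    whose norm bounds the gap from below; this replaces a compactness
    argument. *)
Lemma gap_gt0 L T : T != 0%VS -> (T :&: L = 0)%VS -> 0 < gap L T.
Proof.
move=> T0 TL; pose B : 'M[C]_(\dim T, n.+1) := \matrix_(i < \dim T) (vbasis T)`_i.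
pose P := oproj L.
have BT v : (v <= B)%MS = (v \in T) := mem_basis_mx T v.
have freeB : row_free B by rewrite /row_free rank_basis_mx.
have /row_freeP[Q BQ] : row_free (B *m (1%:M - P)).
  rewrite -kermx_eq0; apply/eqP/row_matrixP => i; rewrite row0.
  set v := row i _; have v0 : v *m (B *m (1%:M - P)) = 0.
    by rewrite /v -row_mul mulmx_ker row0.
  suff vB : v *m B = 0 by apply: (row_free_inj freeB); rewrite vB mul0mx.
  apply/eqP; rewrite -memv0 -TL memv_cap -BT submxMl orthoprojP /=.
  by move/eqP: v0; rewrite mulmxA mulmxBr mulmx1 subr_eq0 eq_sym.
pose G : M := Q *m B; pose k := fnorm G + 1; have k0 : 0 < k by rewrite ltr_wpDl // fnorm_ge0.
apply: (@lt_le_trans _ _ k^-1); first by rewrite invr_gt0.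
apply: lb_le_inf; first exact: gap_nonempty.
move=> _ [u [uT u1] <-]; have /submxP[x xE] : (u <= B)%MS by rewrite BT.
have uE : u = u *m (1%:M - P) *m G.
  by rewrite /G mulmxA; rewrite {1}xE; congr (_ *m B); rewrite xE -(mulmxA x) -(mulmxA x) BQ mulmx1.
rewrite -[k^-1]mul1r ler_pdivrMr // -u1 {1}uE.
apply: le_trans (vnorm_mulmx _ _) _; apply: ler_wpM2l; first exact: vnorm_ge0.
by rewrite lerDl.
Qed.

Lemma gap_le1 L T : T != 0%VS -> gap L T <= 1.
Proof.
move=> T0; have [_ [u [uT u1] _]] := gap_nonempty L T0.
by have := gap_le L uT; rewrite u1 mulr1 => h; apply: le_trans h _; rewrite -u1 vnorm_orthoprojC.
Qed.

Section Kappa.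
Variables (X : set V) (z : V) (L T : {vspace V}).
Hypothesis cX : proj_closed X.
Hypothesis smX : smooth_point X z.
Hypothesis zL : z \in L.
Hypothesis HT : forall w, w \in T <-> tangent_space X z w.
Hypothesis T0 : T != 0%VS.

Lemma tangent_cap_linear : (T :&: tlinear L z = T :&: L)%VS.
Proof.
apply/vspaceP => w; rewrite [LHS]memv_cap [RHS]memv_cap; apply/andP/andP => -[wT].
  by move=> h; have [] := (mem_tlinear L z w).1 h.
move=> wL; split=> //; apply: (mem_tlinear L z w).2; split=> //.
by rewrite -hdot_dotmx; have [] := (tangent_spaceE X z w).1 ((HT w).1 wT).
Qed.

(** Since u lies in T and u (1 - P) = z A, the norm of u is at most |z A| /
    gap. Equality is approached by the rank one maps A sending z to a
    multiple of u (1 - P), for u almost minimizing the gap. *)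
Lemma kappa_transversal : transversal X L z -> (T :&: L = 0)%VS ->
  (exists g, solution_map X L z g) -> kappa X L z = ((gap L T)^-1)%:E.
Proof.
move=> tr TL [g0 Hg0]; have Xz : X z by case: smX.
have z0 : z != 0 by apply: proj_closed_neq0 Xz.
have nz : 0 < vnorm z by rewrite vnorm_gt0.
have s0 := gap_gt0 T0 TL; set s := gap L T in s0 *.
rewrite /kappa asboolT //; set g := xget _ _.
have Hg : solution_map X L z g by apply: (xgetPex (fun=> 0)); exists g0.
have HD A : hom_perp L A -> Dsolution L z g A \in T /\
    Dsolution L z g A *m (1%:M - oproj L) = z *m A.
  by move=> /(solution_derivative cX Xz zL Hg)[/HT].
set S := [set _ | _ in _].
have ubS : ubound S (s^-1)%:E.
  move=> _ [A [hA A1] <-]; rewrite lee_fin -!vnormE ler_pdivrMr //.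
  have [DT DE] := HD A hA; rewrite mulrC ler_pdivlMr // mulrC.
  apply: le_trans (gap_le L DT) _; rewrite DE; apply: le_trans (vnorm_mulmx _ _) _.
  by rewrite ler_piMr ?vnorm_ge0 // fnormE.
have S_ge u : u \in T -> vnorm u = 1 ->
    0 < vnorm (u *m (1%:M - oproj L)) /\ ((vnorm (u *m (1%:M - oproj L)))^-1%:E <= ereal_sup S)%E.
  move=> uT u1; set b := u *m _.
  have b0 : 0 < vnorm b by apply: lt_le_trans s0 _; rewrite -[s]mulr1 -u1; apply: gap_le.
  split=> //; apply: ereal_sup_ubound.
  (* The rank one map of norm 1 sending z to |z| times the direction of b.
     *)
  pose w := ((vnorm z)^-1%:C)%C *: z; pose d := ((vnorm b)^-1%:C)%C *: b.
  have b_neq0 : b != 0 by rewrite -vnorm_gt0.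
  pose A : M := w ^t* *m d.
  have hA : hom_perp L A.
    apply/hom_perpE; split.
      rewrite mulmxA -{1}(orthoproj_herm L) -adjmM orthoproj_id //; exact: memvZ.
    by rewrite /A /d -scalemxAr -scalemxAl /b -!mulmxA mulmxBl mul1mx orthoproj_idem subrr !mulmx0 scaler0.
  have [DT DE] := HD A hA.
  have zA : z *m A = ((vnorm z)%:C)%C *: d.
    rewrite /A mulmxA [z *m _]mx11_scalar mul_scalar_mx -hdotE; congr (_ *: _).
    rewrite dotC dotZl dot_vnorm -rmorphM /= expr2 mulrA mulVf ?gt_eqF // mul1r.
    exact: conjc_real.
  exists A; first by split=> //; rewrite -fnormE fnorm_rank1 !unit_vector // mulr1.
  have DA : Dsolution L z g A = ((vnorm z)%:C)%C *: (((vnorm b)^-1%:C)%C *: u).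
    apply/eqP; rewrite -subr_eq0 -memv0 -TL memv_cap; apply/andP; split.
      by apply: memvB => //; apply/memvZ/memvZ.
    rewrite orthoprojP eq_sym -subr_eq0 -[X in X - _]mulmx1 -mulmxBr mulmxBl DE zA /d.
    by rewrite -!scalemxAl subrr.
  congr (_%:E); rewrite -!vnormE DA !vnormZ u1 mulr1 !cmod_real.
  rewrite !ger0_norm ?invr_ge0 ?vnorm_ge0 // mulrAC mulfV ?gt_eqF // mul1r.
  by [].
have supS : (ereal_sup S <= (s^-1)%:E)%E by apply: ge_ereal_sup.
apply/eqP; rewrite eq_le supS /= leNgt; apply/negP => lt.
have [_ [u [uT u1] _]] := gap_nonempty L T0.
have [b0 bS] := S_ge u uT u1.
move: lt bS S_ge supS; case: (ereal_sup S) => [r| |] // lt bS S_ge _.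
rewrite lte_fin in lt; rewrite lee_fin in bS.
have r0 : 0 < r by apply: lt_le_trans bS; rewrite invr_gt0.
have [|u' [u'T u'1 u'lt]] := @gap_lt L T r^-1 T0.
  by rewrite -/s -[s]invrK ltf_pV2 ?posrE ?invr_gt0.
have [b'0] := S_ge u' u'T u'1; rewrite lee_fin leNgt => /negP; apply.
by rewrite -[r]invrK ltf_pV2 ?posrE ?invr_gt0.
Qed.
End Kappa.
End ConditionNumber.

(** Real scalars read in Cplx R rather than in R[i]: the two carry different
    ring structures, and identities mixing them cannot be checked in a
    single one. *)
Definition rc {R : realType} (x : R) : Cplx R := (x%:C)%C.

Section RealScalars.
Context {R : realType}.
Implicit Types x y : R.
Lemma rcB x y : rc (x - y) = rc x - rc y. Proof. exact: rmorphB. Qed.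
Lemma rcD x y : rc (x + y) = rc x + rc y. Proof. exact: rmorphD. Qed.
Lemma rcN x : rc (- x) = - rc x. Proof. exact: rmorphN. Qed.
Lemma rcM x y : rc (x * y) = rc x * rc y. Proof. exact: rmorphM. Qed.
Lemma rc1 : rc (1 : R) = 1. Proof. by []. Qed.
Lemma rc0 : rc (0 : R) = 0. Proof. by []. Qed.
Lemma conj_rc x : ((rc x)^* )%R = rc x. Proof. exact: conjc_real. Qed.
Lemma cmod_rc x : cmod (rc x) = `|x|. Proof. exact: cmod_real. Qed.
End RealScalars.

(** * Rotations in a plane *)

Section Rotation.
Context {R : realType} {n : nat}.
Local Notation C := (Cplx R).
Local Notation V := 'rV[C]_n.+1.
Local Notation M := 'M[C]_n.+1.
Variables (L : {vspace V}) (a b : V).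
Local Notation P := (oproj L).
Hypothesis aL : a *m P = a.
Hypothesis bL : b *m P = 0.
Hypothesis aa : hdot a a = 1.
Hypothesis bb : hdot b b = 1.

Let ab : hdot a b = 0.
Proof. by rewrite -aL dot_orthoproj bL dot0r. Qed.
Let ba : hdot b a = 0.
Proof. exact: dot_eq0C. Qed.

Lemma mul_rank1 (p q r t : V) : (p ^t* *m q) *m (r ^t* *m t) = hdot q r *: (p ^t* *m t).
Proof. by rewrite mulmxA -(mulmxA _ q) [q *m _]mx11_scalar mul_mx_scalar -scalemxAl hdotE. Qed.

Definition rotG : M := a ^t* *m a + b ^t* *m b.
Definition rotJ : M := a ^t* *m b - b ^t* *m a.

Lemma cos2Dsin2_C (s : R) : rc (sin s) * rc (sin s) = 1 - rc (cos s) * rc (cos s) :> C.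
Proof. by rewrite -!rcM -rc1 -rcB -(cos2Dsin2 s) -!expr2 addrC addKr. Qed.

Lemma rotGG : rotG *m rotG = rotG.
Proof.
by rewrite /rotG mulmxDl !mulmxDr !mul_rank1 aa bb ab ba !scale1r !scale0r addr0 add0r.
Qed.
Lemma rotGJ : rotG *m rotJ = rotJ.
Proof.
by rewrite /rotG /rotJ mulmxDl !mulmxBr !mul_rank1 aa bb ab ba !scale1r !scale0r subr0 sub0r.
Qed.
Lemma rotJG : rotJ *m rotG = rotJ.
Proof.
by rewrite /rotG /rotJ mulmxBl !mulmxDr !mul_rank1 aa bb ab ba !scale1r !scale0r add0r addr0.
Qed.
Lemma rotJJ : rotJ *m rotJ = - rotG.
Proof.
rewrite /rotG /rotJ mulmxBl !mulmxBr !mul_rank1 aa bb ab ba !scale1r !scale0r.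
by rewrite subr0 !sub0r opprD.
Qed.

(** The rotation by s in the plane of a and b, the exponential of s J. *)
Definition rotm (s : R) : M := 1%:M + rc (cos s - 1) *: rotG + rc (sin s) *: rotJ.

Lemma rotmD s r : rotm s *m rotm r = rotm (s + r).
Proof.
move: rotGG rotGJ rotJG rotJJ; rewrite /rotm; move: rotG rotJ => G J GG GJ JG JJ.
rewrite !mulmxDl !mulmxDr -!scalemxAl -!scalemxAr !mul1mx !mulmx1 GG GJ JG JJ.
rewrite cosD sinD !(rcD, rcN, rcM) !rc1 {GG GJ JG JJ}.
move: (rc (cos s)) (rc (cos r)) (rc (sin s)) (rc (sin r)) => x y z t.
by apply/matrixP => i j; rewrite !mxE; ring.
Qed.

Lemma rotm0 : rotm 0 = 1%:M.
Proof. by rewrite /rotm cos0 sin0 subrr !scale0r !addr0. Qed.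

Lemma rot_adj s : (rotm s) ^t* = rotm (- s).
Proof.
have GA : rotG ^t* = rotG by rewrite /rotG adjmD !adjmM !trmxCK.
have JA : rotJ ^t* = - rotJ by rewrite /rotJ adjmB !adjmM !trmxCK opprB.
rewrite /rotm; move: rotG rotJ GA JA => G J GA JA.
by rewrite !adjmD !adjmZ adjm1 !conj_rc cosN sinN GA JA rcN scaleNr scalerN.
Qed.

Lemma rotmK s : rotm s *m (rotm s) ^t* = 1%:M.
Proof. by rewrite rot_adj rotmD subrr rotm0. Qed.

Lemma rotmVK s : (rotm s) ^t* *m rotm s = 1%:M.
Proof. by rewrite rot_adj rotmD addNr rotm0. Qed.

Lemma rotJ_comm s : rotJ *m rotm s = rotm s *m rotJ.
Proof.
move: rotGJ rotJG; rewrite /rotm; move: rotG rotJ => G J GJ JG.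
by rewrite mulmxDl mulmxDr mulmxDl mulmxDr -!scalemxAl -!scalemxAr mul1mx mulmx1 GJ JG.
Qed.

Definition rotL s : {vspace V} := (linfun (mulmxr (rotm s) : V -> V) @: L)%VS.

Lemma mem_rotL s w : (w \in rotL s) = (w *m (rotm s) ^t* \in L).
Proof.
apply/mem_image_mulmx/idP => [[x xL ->]|wL]; first by rewrite -mulmxA rotmK mulmx1.
by exists (w *m (rotm s) ^t*); rewrite // -mulmxA rotmVK mulmx1.
Qed.

Lemma oproj_rotL s : oproj (rotL s) = (rotm s) ^t* *m P *m rotm s.
Proof.
apply: orthoproj_uniq.
- by rewrite !mulmxA -(mulmxA _ (rotm s)) rotmK mulmx1 -(mulmxA _ P P) orthoproj_idem.
- by rewrite !adjmM trmxCK orthoproj_herm !mulmxA.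
move=> v; rewrite mem_rotL orthoprojP; split=> [/eqP h|h].
  by rewrite !mulmxA h -mulmxA rotmVK mulmx1.
by apply/eqP; rewrite -{2}h !mulmxA -(mulmxA _ (rotm s)) rotmK mulmx1.
Qed.

Lemma dim_rotL s : \dim (rotL s) = \dim L.
Proof.
apply: limg_dim_eq; apply/eqP; rewrite -subv0; apply/subvP => w.
rewrite memv_cap memv_ker lfunE /= memv0 => /andP[_ /eqP w0].
by rewrite -[w]mulmx1 -(rotmK s) mulmxA w0 mul0mx.
Qed.

Lemma vnorm_rot s w : vnorm (w *m rotm s) = vnorm w.
Proof.
apply: eq_vnorm; first exact: vnorm_ge0.
by rewrite !vnorm_sqRe dot_adj -mulmxA rotmK mulmx1.
Qed.

Lemma rot_act s w : w *m rotm s = w +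
  ((rc (cos s - 1) * hdot w a - rc (sin s) * hdot w b) *: a +
   (rc (cos s - 1) * hdot w b + rc (sin s) * hdot w a) *: b).
Proof.
have wr (p q : V) : w *m (p ^t* *m q) = hdot w p *: q.
  by rewrite mulmxA [w *m _]mx11_scalar mul_scalar_mx hdotE.
rewrite /rotm !mulmxDr mulmx1 -!scalemxAr /rotG /rotJ mulmxDr mulmxBr !wr.
move: (rc (cos s - 1)) (rc (sin s)) (hdot w a) (hdot w b) => x y t r.
by apply/rowP => i; rewrite !mxE; ring.
Qed.

Lemma rot_fix s w : hdot w a = 0 -> hdot w b = 0 -> w *m rotm s = w.
Proof. by move=> wa wb; rewrite rot_act wa wb !mulr0 subr0 addr0 !scale0r !addr0. Qed.

Lemma rot_a s : a *m rotm s = rc (cos s) *: a + rc (sin s) *: b.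
Proof.
rewrite rot_act aa ab mulr0 subr0 mulr0 !mulr1 add0r addrA -{1}(scale1r a) -scalerDl.
by congr (_ + _); rewrite rcB rc1 addrC subrK.
Qed.

(** The difference of the two projections acts on the plane of a and b as
    sin(s) times an isometry, and vanishes on its complement. *)
Lemma oproj_rotLB s (x : V) : x *m (oproj L - oproj (rotL s)) =
  rc (sin s) *: ((rc (sin s) * hdot x a - rc (cos s) * hdot x b) *: a +
                    (- rc (cos s) * hdot x a - rc (sin s) * hdot x b) *: b).
Proof.
have xa : hdot (x *m P) a = hdot x a by rewrite dot_orthoproj aL.
have xb : hdot (x *m P) b = 0 by rewrite dot_orthoproj bL dot0r.
have e1 : x *m rotm (- s) *m P = x *m P +
    (rc (cos s - 1) * hdot x a + rc (sin s) * hdot x b) *: a.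
  rewrite rot_act mulmxDl [X in _ + X]mulmxDl -!scalemxAl bL aL scaler0 addr0 cosN sinN.
  by rewrite rcN mulNr opprK.
rewrite oproj_rotL rot_adj mulmxBr !mulmxA e1 mulmxDl -scalemxAl rot_a rot_act xa xb.
rewrite !rcB rc1 {xa xb e1}; have cs := cos2Dsin2_C s; move: cs.
move: (x *m P) (rc (cos s)) (rc (sin s)) (hdot x a) (hdot x b) => y c t r q cs.
apply/rowP => i; rewrite !mxE; move: (y _ _) (a _ _) (b _ _) => u v w.
ring: cs.
Qed.

Lemma dproj_rotL s : 0 <= sin s -> dproj L (rotL s) <= sin s.
Proof.
move=> s0; rewrite /dproj -!oprojE; apply: specnorm_le => x x1.
set y : V := hdot x a *: a + hdot x b *: b.
have y1 : vnorm y <= 1.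
  apply: le_trans x1; rewrite -ler_sqr ?nnegrE ?vnorm_ge0 //.
  have xy : hdot (x - y) y = 0.
    rewrite /y dotBl !dotDl !dotDr !dotZl !dotZr aa bb ab ba; ring.
  by have := pythagoras xy; rewrite subrK => ->; rewrite lerDr sqr_ge0.
rewrite oproj_rotLB vnormZ cmod_rc ger0_norm // ler_piMr //; apply: le_trans y1.
rewrite le_eqVlt; apply/orP; left; apply/eqP/eq_vnorm; first exact: vnorm_ge0.
rewrite !vnorm_sqRe /y; congr complex.Re.
have cs := cos2Dsin2_C s.
have cB (p q : C) : ((p - q)^* = p^* - q^*)%R by exact: rmorphB.
have cM (p q : C) : ((p * q)^* = p^* * q^*)%R by exact: rmorphM.
have cN (p : C) : ((- p)^* = - p^*)%R by exact: rmorphN.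
rewrite !dotDl !dotDr !dotZl !dotZr aa bb ab ba !cB !cM !cN !conj_rc.
move: (rc (cos s)) (rc (sin s)) cs => c t cs.
move: (hdot x a) (hdot x b) ((hdot x a)^*)%R ((hdot x b)^*)%R => p q p' q'.
ring: cs.
Qed.
End Rotation.

(** * Velocities of curves in the Grassmannian *)

Section Velocities.
Context {R : realType} {n : nat}.
Local Notation C := (Cplx R).
Local Notation V := 'rV[C]_n.+1.
Local Notation M := 'M[C]_n.+1.

Lemma near_real (x : R) (S : set R) : (\forall h \near x, S h) <->
  exists2 d : R, 0 < d & forall h, `|h - x| < d -> S h.
Proof.
split=> [/nbhs_ballP[d /= d0 H]|[d d0 H]].
  by exists d => // h hd; apply: H; rewrite /ball /= distrC.
by apply/nbhs_ballP; exists d => // h; rewrite /ball /= distrC; apply: H.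
Qed.

(** Derivatives with respect to a real parameter, while the entries are
    complex: the matrix space is normed over the complex numbers only. *)
Definition has_mxderiv p q (k : R -> 'M[C]_(p, q)) (t : R) (k' : 'M[C]_(p, q)) : Prop :=
  forall e : R, 0 < e -> exists2 d : R, 0 < d &
    forall h, `|h| < d -> n1 (k (t + h) - k t - rc h *: k') <= e * `|h|.

Definition mxcontinuous p q (k : R -> 'M[C]_(p, q)) (t : R) : Prop :=
  forall e : R, 0 < e -> exists2 d : R, 0 < d & forall h, `|h| < d -> n1 (k (t + h) - k t) < e.

Lemma mxderiv_continuous p q (k : R -> 'M[C]_(p, q)) t k' :
  has_mxderiv k t k' -> mxcontinuous k t.
Proof.
move=> /(_ 1 ltr01)[d d0 H] e e0; pose b := n1 k' + 2; have b0 : 0 < b.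
  by rewrite /b ltr_wpDl ?n1_ge0.
exists (Num.min d (e / b)); first by rewrite lt_min d0 divr_gt0.
move=> h; rewrite lt_min => /andP[hd]; rewrite ltr_pdivlMr // => hb.
have := n1D (k (t + h) - k t - rc h *: k') (rc h *: k'); rewrite subrK n1Z cmod_rc.
move: (H h hd) hb (n1_ge0 k') (normr_ge0 h); rewrite /b mul1r; clear.
move: (n1 (k (t + h) - k t - rc h *: k')) (n1 (k (t + h) - k t)) (n1 k') `|h| => *; nra.
Qed.

Implicit Types (c : R -> {vspace V}) (t : R) (v : M).

(** At h = 0 the coordinate is 0, as the center of the chart has a unique
    coordinate. *)
Lemma velocity_expand c t v : has_velocity c t v -> forall e : R, 0 < e ->
  exists2 d : R, 0 < d & forall h, `|h| < d ->
    exists F, [/\ hom_perp (c t) F, c (t + h) = graph (c t) F & n1 (F - rc h *: v) <= e * `|h|].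
Proof.
move=> [F [/near_real[d1 d10 H1] /cvg_n1 H2]] e e0.
have /near_real[d2 d20 {}H2] := H2 e e0.
exists (Num.min d1 d2); first by rewrite lt_min d10.
move=> h; rewrite lt_min => /andP[hd1 hd2].
have [hF cF] : hom_perp (c t) (F h) /\ c (t + h) = graph (c t) (F h) by apply: H1; rewrite subr0.
exists (F h); split=> //; have [h0|h0] := eqVneq h 0.
  have F0 : F h = 0.
    apply: (graph_inj hF (hom_perp0 (c t))); rewrite -cF h0 addr0 graph0 //.
  by rewrite F0 h0 rc0 scale0r subr0 n1_0 normr0 mulr0.
have := H2 h; rewrite subr0 => /(_ hd2 h0) /ltW hb.
have hc : rc h != 0 by rewrite -cmod_eq0 cmod_rc normr_eq0.
have -> : F h - rc h *: v = rc h *: (rc h^-1 *: F h - v).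
  rewrite scalerBr scalerA -rcM mulfV // scale1r //.
by rewrite n1Z cmod_rc mulrC ler_wpM2r.
Qed.

Lemma velocity_intro c t v (F : R -> M) :
  (exists2 d : R, 0 < d & forall h, `|h| < d ->
     hom_perp (c t) (F h) /\ c (t + h) = graph (c t) (F h)) ->
  (forall e : R, 0 < e -> exists2 d : R, 0 < d & forall h, `|h| < d ->
     n1 (F h - rc h *: v) <= e * `|h|) ->
  has_velocity c t v.
Proof.
move=> [d d0 H1] H2; exists F; split.
  by apply/near_real; exists d => // h; rewrite subr0; apply: H1.
apply/cvg_n1 => e e0; have e20 : 0 < e / 2 by rewrite divr_gt0.
have [d2 d20 {}H2] := H2 _ e20.
apply/near_real; exists d2 => // h; rewrite subr0 => hd h0.
have hc : rc h != 0 by rewrite -cmod_eq0 cmod_rc normr_eq0.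
have hn : 0 < `|h| by rewrite normr_gt0.
rewrite -(ltr_pM2l hn) -{1}cmod_rc -n1Z scalerBr scalerA -rcM mulfV // scale1r.
apply: le_lt_trans (H2 h hd) _; rewrite mulrC ltr_pM2l //; move: e0; clear; lra.
Qed.

(** The conditions defining [hom_perp] are closed. *)
Lemma hom_perp_velocity c t v : has_velocity c t v -> hom_perp (c t) v.
Proof.
move=> /velocity_expand H; pose P := oproj (c t).
have key e : 0 < e -> exists F, [/\ P *m F = F, F *m P = 0 & n1 (v - F) <= e].
  move=> e0; have [d d0 Hd] := H e e0; pose h := d / 2.
  have h0 : 0 < h by rewrite divr_gt0.
  have [|F [/hom_perpE[F1 F2] _ F3]] := Hd h.
    by rewrite gtr0_norm // /h; move: d0; clear; lra.
  exists (rc h^-1 *: F); split.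
  - by rewrite -scalemxAr F1.
  - by rewrite -scalemxAl F2 scaler0.
  have hc : rc h != 0 by rewrite -cmod_eq0 cmod_rc normr_eq0 gt_eqF.
  have e1 : v - rc h^-1 *: F = - (rc h^-1 *: (F - rc h *: v)).
    by rewrite scalerBr scalerA -rcM mulVf ?gt_eqF // scale1r opprB.
  rewrite e1 n1N n1Z cmod_rc normfV mulrC ler_pdivrMr ?normr_gt0 ?gt_eqF //.
apply/hom_perpE; split.
  apply/eqP; rewrite -subr_eq0; apply/eqP.
  apply: (@le_linear_eq0 _ _ _ _ (n1 P + 1)) => e e0 _; have [F [F1 F2 F3]] := key e e0.
  have -> : P *m v - v = P *m (v - F) - (v - F) by rewrite mulmxBr F1 opprB addrA subrK.
  apply: le_trans (n1B _ _) _; rewrite mulrDl mul1r; apply: lerD => //.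
  by apply: le_trans (n1M _ _) _; rewrite ler_wpM2l ?n1_ge0.
apply: (@le_linear_eq0 _ _ _ _ (n1 P)) => e e0 _; have [F [F1 F2 F3]] := key e e0.
rewrite -[v](subrK F) mulmxDl F2 addr0.
by apply: le_trans (n1M _ _) _; rewrite mulrC ler_wpM2l ?n1_ge0.
Qed.

(** The differential of the projection at the center of a chart is A + A^*.
    *)
Lemma oproj_velocity c t v : has_velocity c t v ->
  has_mxderiv (oproj \o c) t (v + v ^t*).
Proof.
move=> hv e e0; have [K K0 HK] := orthoproj_graph_expand (c t).
have e30 : 0 < Num.min 1 (e / 4) by rewrite lt_min ltr01 divr_gt0.
have [d d0 Hd] := velocity_expand hv e30.
pose b := n1 v + 1; have b0 : 0 < b by rewrite /b ltr_wpDl ?n1_ge0.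
have Kb0 : 0 < 2 * (K * b ^+ 2) + 1 by rewrite ltr_wpDl // !mulr_ge0 // ltW.
exists (Num.min d (Num.min (2^-1 / b) (e / (2 * (K * b ^+ 2) + 1)))).
  by rewrite !lt_min d0 !divr_gt0.
move=> h; rewrite !lt_min => /andP[hd /andP[hb he]].
have [F [hF cF nF]] := Hd h hd; rewrite /= cF.
have h0 := normr_ge0 h.
have nF1 : n1 (F - rc h *: v) <= `|h|.
  by apply: le_trans nF _; rewrite ler_piMl // ge_min lexx.
have nF2 : n1 (F - rc h *: v) <= e / 4 * `|h|.
  by apply: le_trans nF _; rewrite ler_wpM2r // ge_min lexx orbT.
have nFb : n1 F <= b * `|h|.
  have := n1D (F - rc h *: v) (rc h *: v); rewrite subrK n1Z cmod_rc /b mulrDl mul1r.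
  by move: nF1; clear; move: (n1 (F - rc h *: v)) (n1 F) (n1 v) `|h| => *; nra.
have F12 : n1 F <= 2^-1.
  by apply: le_trans nFb _; move: hb; rewrite ltr_pdivlMr // mulrC => /ltW.
have := HK F hF F12.
set Q := oproj _; set P := oproj _ => hQ.
have -> : Q - P - rc h *: (v + v ^t*) = (Q - (P + F + F ^t*)) + ((F - rc h *: v) + (F - rc h *: v) ^t*).
  rewrite adjmB adjmZ conj_rc scalerDr.
  move: (F ^t*) (rc h *: v) (rc h *: v ^t*) => f x y.
  by apply/matrixP => i j; rewrite !mxE; ring.
apply: le_trans (n1D _ _) _.
have s1 := n1D (F - rc h *: v) ((F - rc h *: v) ^t*); rewrite n1_adj in s1.
have s2 : K * n1 F ^+ 2 <= K * b ^+ 2 * `|h| * `|h|.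
  have sF : n1 F ^+ 2 <= (b * `|h|) ^+ 2.
    by rewrite ler_sqr ?nnegrE ?n1_ge0 // mulr_ge0 // ltW.
  by apply: le_trans (ler_wpM2l K0 sF) _; rewrite exprMn mulrA (expr2 `|h|) mulrA.
move: he; rewrite ltr_pdivlMr // => he.
apply: le_trans (lerD hQ s1) _; apply: le_trans (lerD s2 (lerD nF2 nF2)) _.
move: he h0 e0; clear; move: (K * b ^+ 2) `|h| => x y; nra.
Qed.
End Velocities.

(** * Curves obtained by moving a subspace *)

Section Curves.
Context {R : realType}.
Local Notation C := (Cplx R).

Lemma mxcontinuous_cst p q (A : 'M[C]_(p, q)) (t : R) : mxcontinuous (fun=> A) t.
Proof. by move=> e e0; exists 1 => // h _; rewrite subrr n1_0. Qed.

Lemma mxcontinuousB p q (f g : R -> 'M[C]_(p, q)) (t : R) :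
  mxcontinuous f t -> mxcontinuous g t -> mxcontinuous (fun s => f s - g s) t.
Proof.
move=> cf cg e e0; have e20 : 0 < e / 2 by rewrite divr_gt0.
have [d1 d10 H1] := cf _ e20; have [d2 d20 H2] := cg _ e20.
exists (Num.min d1 d2); first by rewrite lt_min d10.
move=> h; rewrite lt_min => /andP[/H1 h1 /H2 h2].
have -> : f (t + h) - g (t + h) - (f t - g t) = (f (t + h) - f t) - (g (t + h) - g t).
  by rewrite !opprB addrACA [- g _ + _]addrC addrACA; congr (_ + _); rewrite addrC.
apply: le_lt_trans (n1B _ _) _; move: h1 h2; clear.
by move: (n1 (f _ - _)) (n1 (g _ - _)) => x y; lra.
Qed.

Lemma mxcontinuousM p q r (f : R -> 'M[C]_(p, q)) (g : R -> 'M[C]_(q, r)) (t : R) :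
  mxcontinuous f t -> mxcontinuous g t -> mxcontinuous (fun s => f s *m g s) t.
Proof.
move=> cf cg e e0; pose a := n1 (f t) + 1; pose b := n1 (g t) + 1.
have a0 : 0 < a by rewrite ltr_wpDl ?n1_ge0.
have b0 : 0 < b by rewrite ltr_wpDl ?n1_ge0.
have [|d1 d10 H1] := cf (e / 2 / b); first by rewrite !divr_gt0.
have [|d2 d20 H2] := cg (Num.min 1 (e / 2 / a)); first by rewrite lt_min ltr01 !divr_gt0.
exists (Num.min d1 d2); first by rewrite lt_min d10.
move=> h; rewrite lt_min => /andP[/H1 h1 /H2]; rewrite lt_min => /andP[h21 h2].
have -> : f (t + h) *m g (t + h) - f t *m g t =
   (f (t + h) - f t) *m g (t + h) + f t *m (g (t + h) - g t).
  by rewrite mulmxBl mulmxBr addrA subrK.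
have gb : n1 (g (t + h)) <= b.
  by have := n1D (g (t + h) - g t) (g t); rewrite subrK /b; move: h21; clear; lra.
apply: le_lt_trans (n1D _ _) _.
have s1 : n1 ((f (t + h) - f t) *m g (t + h)) <= n1 (f (t + h) - f t) * b.
  by apply: le_trans (n1M _ _) _; rewrite ler_wpM2l ?n1_ge0.
have s2 : n1 (f t *m (g (t + h) - g t)) <= a * n1 (g (t + h) - g t).
  by apply: le_trans (n1M _ _) _; rewrite ler_wpM2r ?n1_ge0 // lerDl.
move: h1 h2; rewrite !ltr_pdivlMr //; move: s1 s2; clear.
by move: (n1 (f _ - _)) (n1 (g _ - _)) => x y; lra.
Qed.

Lemma mxcontinuous_inv p (k : R -> 'M[C]_p) (t : R) : k t \in unitmx ->
  mxcontinuous k t -> mxcontinuous (invmx \o k) t.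
Proof.
move=> uk ck e e0; pose a := n1 (invmx (k t)); have a0 : 0 <= a := n1_ge0 _.
pose b := 2 * n1 (1%:M : 'M[C]_p) * a * a + 1.
have b0 : 0 < b by rewrite ltr_wpDl // !mulr_ge0 ?n1_ge0.
have [|d d0 H] := ck (Num.min (2^-1 / (a + 1)) (e / b)).
  by rewrite lt_min !divr_gt0 // ltr_wpDl.
have a10 : 0 < a + 1 by rewrite ltr_wpDl.
exists d => // h /H /=; rewrite lt_min !ltr_pdivlMr // => /andP[h1 h2].
pose X := invmx (k t) *m (k (t + h) - k t).
have nX : n1 X <= a * n1 (k (t + h) - k t) by apply: n1M.
have X2 : n1 X <= 2^-1.
  by move: nX h1 (n1_ge0 (k (t + h) - k t)); clear; move: (n1 _) (n1 _) => *; lra.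
have [uX _ hX _] := neumann X2.
have kE : k (t + h) = k t *m (1%:M + X).
  by rewrite mulmxDr mulmx1 /X mulKVmx // [RHS]addrC subrK.
have ukh : k (t + h) \in unitmx by rewrite kE unitmx_mul uk uX.
have iE : invmx (k (t + h)) = invmx (1%:M + X) *m invmx (k t).
  by rewrite -[RHS](mulKmx ukh) {3}kE (mulmxA (k t *m _)) mulmxK // mulmxV // mulmx1.
have -> : invmx (k (t + h)) - invmx (k t) = (invmx (1%:M + X) - 1%:M) *m invmx (k t).
  by rewrite mulmxBl mul1mx iE.
apply: le_lt_trans (n1M _ _) _; rewrite -/a.
have h3 := le_trans hX (ler_wpM2l (mulr_ge0 (ler0n R 2) (n1_ge0 1%:M)) nX).
apply: le_lt_trans (ler_wpM2r a0 h3) _.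
apply: le_lt_trans h2; rewrite /b; move: (n1_ge0 (k (t + h) - k t)); clear.
by move: (n1 (k (t + h) - k t)) (n1 (1%:M : 'M[C]_p)) => x y x0; lra.
Qed.

Lemma mxcontinuous_within p q (v : R -> 'M[C]_(p.+1, q.+1)) (A : set R) :
  (forall t, A t -> mxcontinuous v t) -> {within A, continuous v}.
Proof.
move=> H; apply: continuous_in_subspaceT => t /set_mem At.
apply/(@cvg_n1 _ _ (nbhs t) (nbhs_filter t)) => e e0; have [d d0 Hd] := H t At e e0.
apply/near_real; exists d => // s hs; have := Hd _ hs.
by rewrite (addrC t) subrK.
Qed.

Context {n : nat}.
Local Notation V := 'rV[C]_n.+1.
Local Notation M := 'M[C]_n.+1.

Definition moved (L : {vspace V}) (k : M) : {vspace V} := (linfun (mulmxr k : V -> V) @: L)%VS.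

(** Reduces the motion at time t + h to a motion of the subspace at time t
    by a matrix close to 1. *)
Lemma moved_mul L k k' : moved (moved L k) k' = moved L (k *m k').
Proof.
apply/vspaceP => w; apply/mem_image_mulmx/mem_image_mulmx.
  by move=> [x /mem_image_mulmx[y yL ->] ->]; exists y; rewrite ?mulmxA.
by move=> [y yL ->]; exists (y *m k); rewrite ?mulmxA //; apply/mem_image_mulmx; exists y.
Qed.

(** In the chart centered at the space at time t, a matrix 1 + s has
    coordinate P s (1 - P) to first order. *)
Lemma velocity_moved (L : {vspace V}) (k : R -> M) t (dk : M) :
  k t \in unitmx -> has_mxderiv k t dk ->
  has_velocity (fun s => moved L (k s)) t
    (oproj (moved L (k t)) *m (invmx (k t) *m dk) *m (1%:M - oproj (moved L (k t)))).
Proof.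
move=> uk Hk; set L' := moved L (k t); set P := oproj L'; set E := invmx (k t) *m dk.
have PP : P *m P = P := orthoproj_idem L'.
(* Relative to the space at time t the motion is by 1 + s h. *)
pose s h := invmx (k t) *m (k (t + h) - k t).
pose a := n1 (invmx (k t)) + 1; have a0 : 0 < a by rewrite ltr_wpDl ?n1_ge0.
have Hs e : 0 < e -> exists2 d : R, 0 < d & forall h, `|h| < d -> n1 (s h - rc h *: E) <= e * `|h|.
  move=> e0; have [|d d0 Hd] := Hk (e / a); first by rewrite divr_gt0.
  exists d => // h /Hd; rewrite mulrAC ler_pdivlMr // => hd; apply: le_trans hd.
  rewrite /s /E scalemxAr -mulmxBr; apply: le_trans (n1M _ _) _; rewrite mulrC.
  by rewrite ler_wpM2l ?n1_ge0 // lerDl.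
have sE h : moved L (k (t + h)) = moved L' (1%:M + s h).
  by rewrite moved_mul mulmxDr mulmx1 mulKVmx // [k t + _]addrC subrK.
pose N := 1%:M - P.
have PN : P *m N = 0 by rewrite mulmxBr mulmx1 PP subrr.
pose q h := P *m s h *m P; pose r h := P *m s h *m N.
have qE h : P *m (1%:M + s h) *m P + (1%:M - P) = 1%:M + q h.
  by rewrite mulmxDr mulmx1 mulmxDl PP addrAC [P + _]addrC subrK.
have rE h : P *m (1%:M + s h) *m (1%:M - P) = r h.
  by rewrite -/N (mulmxDr P) mulmx1 mulmxDl PN add0r.
have [d1 d10 Hd1] := Hs 1 ltr01.
pose b := n1 E + 1; have b0 : 0 < b by rewrite ltr_wpDl ?n1_ge0.
have sb h : `|h| < d1 -> n1 (s h) <= b * `|h|.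
  move=> /Hd1; have := n1D (s h - rc h *: E) (rc h *: E); rewrite subrK n1Z cmod_rc /b mul1r.
  by clear; move: (n1 (s h - rc h *: E)) (n1 (s h)) (n1 E) `|h| => *; nra.
pose nP := n1 P; pose nN := n1 N.
have nP0 : 0 <= nP := n1_ge0 P; have nN0 : 0 <= nN := n1_ge0 N.
have n1MM (x y z : M) : n1 (x *m y *m z) <= n1 x * n1 z * n1 y.
  apply: le_trans (n1M _ _) _; rewrite mulrAC ler_wpM2r ?n1_ge0 //; exact: n1M.
have qb h : `|h| < d1 -> n1 (q h) <= nP * nP * b * `|h|.
  move=> /sb hb; apply: le_trans (n1MM _ _ _) _; rewrite -(mulrA _ b).
  by rewrite ler_wpM2l // mulr_ge0.
have rb h : `|h| < d1 -> n1 (r h) <= nP * nN * b * `|h|.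
  move=> /sb hb; apply: le_trans (n1MM _ _ _) _; rewrite -(mulrA _ b).
  by rewrite ler_wpM2l // mulr_ge0.
pose b1 := nP * nP * b; pose b2 := nP * nN * b.
have b10 : 0 <= b1 by rewrite !mulr_ge0 // ltW.
have b20 : 0 <= b2 by rewrite !mulr_ge0 // ltW.
pose d2 := Num.min d1 (2^-1 / (b1 + 1)).
have d20 : 0 < d2 by rewrite lt_min d10 divr_gt0 // ltr_wpDl.
have q2 h : `|h| < d2 -> n1 (q h) <= 2^-1.
  rewrite lt_min => /andP[hd]; rewrite ltr_pdivlMr ?ltr_wpDl // => hb.
  apply: le_trans (qb h hd) _; rewrite -/b1; move: hb (normr_ge0 h); clear.
  by move: `|h| => *; lra.
apply: (@velocity_intro _ _ _ _ _ (fun h => graph_coord L' (1%:M + s h))).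
  exists d2; first exact: d20.
  move=> h /q2 hq; have [uq _ _ _] := neumann hq.
  have /(@graph_coordP _ _ L')[h1 h2] : P *m (1%:M + s h) *m P + (1%:M - P) \in unitmx by rewrite qE.
  by split; [exact: h1|rewrite sE; apply: esym; exact: h2].
move=> e e0; pose c1 := 2 * n1 (1%:M : M) * b1 * b2 + 1.
have c10 : 0 < c1.
  apply: ltr_wpDl => //; apply: mulr_ge0 b20; apply: mulr_ge0 b10.
  by apply: mulr_ge0; [|apply: n1_ge0].
pose c2 := nP * nN + 1; have c20 : 0 < c2 by rewrite ltr_wpDl // mulr_ge0.
have [|d3 d30 Hd3] := Hs (e / 2 / c2); first by rewrite !divr_gt0.
exists (Num.min (Num.min d2 d3) (e / 2 / c1)); first by rewrite lt_min lt_min d20 d30 !divr_gt0.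
move=> h; rewrite lt_min lt_min => /andP[/andP[hd2 hd3]]; rewrite ltr_pdivlMr // => hc.
have hd1 : `|h| < d1 by move: hd2; rewrite lt_min => /andP[].
have [_ _ hZ _] := neumann (q2 h hd2).
rewrite /graph_coord -/P qE rE.
set Z := invmx _ - 1%:M in hZ.
have -> : invmx (1%:M + q h) *m r h - rc h *: (P *m E *m (1%:M - P)) =
   Z *m r h + P *m (s h - rc h *: E) *m N.
  rewrite (mulmxBr P (s h)) (mulmxBl _ _ N) -/(r h) -scalemxAr -scalemxAl addrA; congr (_ - _).
  by rewrite /Z mulmxBl mul1mx subrK.
apply: le_trans (n1D _ _) _.
have s1 : n1 (Z *m r h) <= (c1 * `|h|) * `|h|.
  apply: le_trans (n1M _ _) _.
  have z1 := le_trans hZ (ler_wpM2l (mulr_ge0 (ler0n R 2) (n1_ge0 1%:M)) (qb h hd1)).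
  apply: le_trans (ler_pM (n1_ge0 _) (n1_ge0 _) z1 (rb h hd1)) _.
  rewrite -/b1 -/b2 /c1; move: (normr_ge0 h); clear; move: `|h| (n1 (1%:M : M)) => x y; nra.
have s2 : n1 (P *m (s h - rc h *: E) *m N) <= c2 * (e / 2 / c2 * `|h|).
  apply: le_trans (n1MM _ _ _) _.
  by apply: (ler_pM _ (n1_ge0 _) _ (Hd3 h hd3)); rewrite ?mulr_ge0 // lerDl.
have e2 : c2 * (e / 2 / c2 * `|h|) = e / 2 * `|h|.
  by rewrite mulrA (mulrC c2) divfK // gt_eqF.
rewrite e2 in s2; apply: le_trans (lerD s1 s2) _.
have := ler_wpM2r (normr_ge0 h) (ltW hc); clear; move: `|h| => x; lra.
Qed.

(** The velocity involves the projections onto the moving space, which are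
    continuous because they are differentiable by [oproj_velocity]. *)
Lemma curve_of_matrices (L : {vspace V}) (k dk : R -> M) :
  (forall t, 0 <= t <= 1 -> [/\ k t \in unitmx, has_mxderiv k t (dk t) & mxcontinuous dk t]) ->
  C1_curve (fun s => moved L (k s)) (fun t =>
    oproj (moved L (k t)) *m (invmx (k t) *m dk t) *m (1%:M - oproj (moved L (k t)))).
Proof.
move=> H; split=> [t t01|]; first by have [h1 h2 _] := H t t01; apply: velocity_moved.
apply: mxcontinuous_within => t /=; rewrite in_itv /= => t01; have [h1 h2 h3] := H t t01.
have hP : mxcontinuous (oproj \o (fun s => moved L (k s))) t.
  exact: (mxderiv_continuous (oproj_velocity (velocity_moved L h1 h2))).
apply: mxcontinuousM; last by apply: mxcontinuousB hP; apply: mxcontinuous_cst.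
apply: mxcontinuousM => //; apply: mxcontinuousM => //.
by apply: mxcontinuous_inv => //; apply: mxderiv_continuous h2.
Qed.

End Curves.

Section RealDerivatives.
Context {R : realType}.

Lemma is_derive_expand (f : R -> R) (x df : R) : is_derive x 1 f df <->
  forall e : R, 0 < e -> exists2 d : R, 0 < d &
    forall h, `|h| < d -> `|f (x + h) - f x - h * df| <= e * `|h|.
Proof.
have cvgE : (h^-1 *: ((f \o shift x) (h *: 1) - f x) @[h --> (0 : R)^'] --> (df : R)) <->
  forall e : R, 0 < e -> exists2 d : R, 0 < d &
    forall h, `|h| < d -> `|f (x + h) - f x - h * df| <= e * `|h|.
  have eqn (h : R) : h != 0 -> `|df - h^-1 *: ((f \o shift x) (h *: 1) - f x)| * `|h| =
      `|f (x + h) - f x - h * df|.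
    move=> h0; rewrite -normrM distrC.
    have -> : h *: (1 : R) = h by rewrite /GRing.scale /= mulr1.
    rewrite /= [h + x]addrC; congr `|_|; rewrite mulrBl /GRing.scale /= mulrAC mulVf // mul1r.
    by rewrite [df * h]mulrC.
  split=> [/cvgrPdist_le H e e0|H].
    have /near_real[d d0 {}H] := H e e0; exists d => // h hd.
    have [->|h0] := eqVneq h 0; first by rewrite addr0 subrr mul0r subr0 normr0 mulr0.
    by rewrite -eqn // ler_wpM2r //; apply: H => //; rewrite subr0.
  apply/cvgrPdist_le => e e0; have [d d0 Hd] := H e e0.
  apply/near_real; exists d => // h; rewrite subr0 => /Hd hd h0.
  by have := hd; rewrite -eqn // ler_pM2r // normr_gt0.
rewrite -cvgE; split=> [[dv <-]|H]; first exact: dv.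
by apply: DeriveDef; [apply: cvgP H|apply: cvg_lim H].
Qed.
End RealDerivatives.

Section RotationCurve.
Context {R : realType} {n : nat}.
Local Notation C := (Cplx R).
Local Notation V := 'rV[C]_n.+1.
Local Notation M := 'M[C]_n.+1.
Variables (L : {vspace V}) (a b : V).
Local Notation P := (oproj L).
Hypothesis aL : a *m P = a.
Hypothesis bL : b *m P = 0.
Hypothesis aa : hdot a a = 1.
Hypothesis bb : hdot b b = 1.
Local Notation rotm := (rotm a b).
Local Notation G := (rotG a b).
Local Notation J := (rotJ a b).

Let rotmK s : rotm s *m (rotm s) ^t* = 1%:M := rotmK aL bL aa bb s.

Lemma rot_unit s : rotm s \in unitmx.
Proof. by have := mulmx1_unit (rotmK s) => -[]. Qed.

Lemma rot_deriv (th t : R) :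
  has_mxderiv (fun s => rotm (th * s)) t (rotm (th * t) *m (rc th *: J)).
Proof.
have base : has_mxderiv rotm 0 J.
  move=> e e0; pose k := n1 G + n1 J + 1.
  have k0 : 0 < k by rewrite ltr_wpDl // addr_ge0 ?n1_ge0.
  have ek : 0 < e / k by rewrite divr_gt0.
  have [d1 d10 H1] := (is_derive_expand (@cos R) 0 _).1 (is_derive_cos 0) _ ek.
  have [d2 d20 H2] := (is_derive_expand (@sin R) 0 _).1 (is_derive_sin 0) _ ek.
  exists (Num.min d1 d2); first by rewrite lt_min d10.
  move=> h; rewrite lt_min => /andP[/H1 h1 /H2 h2].
  rewrite add0r cos0 sin0 oppr0 mulr0 subr0 in h1.
  rewrite add0r cos0 sin0 subr0 mulr1 in h2.
  rewrite add0r.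
  have -> : rotm h - rotm 0 - rc h *: J = rc (cos h - 1) *: G + rc (sin h - h) *: J.
    rewrite (rotm0 a b) /rotm !rcB; move: (rc (cos h)) (rc (sin h)) (rc h) => x y z.
    move: (rc 1) (rotG a b) (rotJ a b) => u A B.
    by apply/matrixP => i j; rewrite !mxE; ring.
  apply: le_trans (n1D _ _) _; rewrite !n1Z !cmod_rc.
  have s1 := ler_wpM2r (n1_ge0 G) h1; have s2 := ler_wpM2r (n1_ge0 J) h2.
  apply: (le_trans (lerD s1 s2)); rewrite -mulrDr.
  have kk : n1 G + n1 J <= k by rewrite /k lerDl.
  apply: (le_trans (ler_wpM2l (mulr_ge0 (ltW ek) (normr_ge0 h)) kk)).
  by rewrite mulrAC divfK ?gt_eqF.
move=> e e0; pose c := n1 (rotm (th * t)) + 1.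
have c0 : 0 < c by rewrite ltr_wpDl ?n1_ge0.
pose f := `|th| + 1; have f0 : 0 < f by rewrite ltr_wpDl.
have [|d d0 Hd] := base (e / c / f); first by rewrite !divr_gt0.
exists (d / f); first by rewrite divr_gt0.
move=> h; rewrite ltr_pdivlMr // => hd.
have thf : `|th * h| <= `|h| * f by rewrite normrM mulrC ler_wpM2l // lerDl.
have := Hd (th * h) (le_lt_trans thf hd); rewrite add0r (rotm0 a b) => Hh.
have -> : rotm (th * (t + h)) - rotm (th * t) - rc h *: (rotm (th * t) *m (rc th *: J)) =
   rotm (th * t) *m (rotm (th * h) - 1%:M - rc (th * h) *: J).
  rewrite mulrDr -(rotmD aL bL aa bb) !mulmxBr mulmx1; congr (_ - _).
  by rewrite -!scalemxAr scalerA -rcM [h * th]mulrC.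
apply: (le_trans (n1M _ _)).
have s1 : e / c / f * `|th * h| <= e / c * `|h|.
  apply: (le_trans (ler_wpM2l _ thf)); first by rewrite !divr_ge0 ?ltW.
  by rewrite [`|h| * f]mulrC mulrA divfK ?gt_eqF.
have cc : n1 (rotm (th * t)) <= c by rewrite lerDl.
apply: (le_trans (ler_pM (n1_ge0 _) (n1_ge0 _) cc (le_trans Hh s1))).
by rewrite mulrA [c * _]mulrC divfK ?gt_eqF.
Qed.

(** The velocity is th times the rank one map from the rotated a to the
    rotated b, two unit vectors. *)
Lemma rot_speed (th s : R) : 0 <= th ->
  fnorm (oproj (rotL L a b s) *m (rc th *: J) *m (1%:M - oproj (rotL L a b s))) = th.
Proof.
move=> th0; set U := rotm s; have UV : (U ^t*) *m U = 1%:M := rotmVK aL bL aa bb s.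
have UK : U *m (U ^t*) = 1%:M := rotmK s.
have JU : U *m J = J *m U by rewrite /U (rotJ_comm aL bL aa bb).
have PJN : P *m J *m (1%:M - P) = a ^t* *m b.
  have Pa : P *m a ^t* = a ^t* by rewrite -{1}(orthoproj_herm L) -adjmM aL.
  have Pb : P *m b ^t* = 0 by rewrite -{1}(orthoproj_herm L) -adjmM bL adjm0.
  rewrite /rotJ (mulmxBr P) (mulmxA P _ b) Pa (mulmxA P _ a) Pb mul0mx subr0 -mulmxA.
  by rewrite mulmxBr mulmx1 bL subr0.
have -> : oproj (rotL L a b s) *m (rc th *: J) *m (1%:M - oproj (rotL L a b s)) =
   (rc th *: (a *m U)) ^t* *m (b *m U).
  rewrite (oproj_rotL aL bL aa bb) -/U -scalemxAr -scalemxAl adjmZ conj_rc -scalemxAl; congr (_ *: _).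
  have e1 : U *m (1%:M - U ^t* *m P *m U) = (1%:M - P) *m U.
    by rewrite mulmxBr mulmx1 mulmxBl mul1mx !mulmxA UK mul1mx.
  rewrite -(mulmxA _ U J) JU -(mulmxA _ (J *m U)) -(mulmxA J) e1.
  by rewrite adjmM !mulmxA -(mulmxA _ P J) -(mulmxA (U ^t*)) PJN !mulmxA.
have nU w : vnorm (w *m U) = vnorm w by apply: (vnorm_rot aL bL aa bb).
have n1E w : hdot w w = 1 -> vnorm w = 1.
  by move=> w1; apply: eq_vnorm => //; rewrite vnorm_sqRe w1 expr1n.
by rewrite fnorm_rank1 vnormZ !nU cmod_rc !n1E // !mulr1 ger0_norm.
Qed.

Lemma rotation_curve (th : R) : 0 <= th -> exists v,
  C1_curve (fun t => rotL L a b (th * t)) v /\ curve_length v = th.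
Proof.
move=> th0; eexists; split.
  apply: (@curve_of_matrices _ _ L (fun s => rotm (th * s))
     (fun s => rotm (th * s) *m (rc th *: J))) => t _; split.
  - exact: rot_unit.
  - exact: rot_deriv.
  apply: mxcontinuousM; last exact: mxcontinuous_cst.
  exact: mxderiv_continuous (rot_deriv th t).
rewrite /curve_length.
transitivity (\int[lebesgue_measure]_(t in `[(0 : R), 1]) th)%R.
  apply: eq_Rintegral => t _.
  by rewrite mulKmx ?rot_unit // -fnormE -/(rotL L a b _) rot_speed.
by rewrite Rintegral_cst //= lebesgue_measure_itv /= lte_fin ltr01 /= subr0 mulr1.
Qed.
End RotationCurve.

(** * Curves between subspaces of equal dimension *)

Section ConnectingCurve.
Context {R : realType} {n : nat}.
Local Notation C := (Cplx R).
Local Notation V := 'rV[C]_n.+1.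
Local Notation M := 'M[C]_n.+1.

(** Bases of the two spaces are related by a map of full rank, which extends
    to an invertible one. *)
Lemma moved_transitive (L L' : {vspace V}) : \dim L = \dim L' ->
  exists2 g : M, g \in unitmx & moved L g = L'.
Proof.
move=> dE; pose B (U : {vspace V}) : 'M[C]_(\dim U, n.+1) := \matrix_(i < \dim U) (vbasis U)`_i.
have /row_freeP[Q BQ] : row_free (B L) by rewrite /row_free rank_basis_mx.
have [B' [memB' rB']] : exists B' : 'M[C]_(\dim L, n.+1),
    (forall w, (w <= B')%MS = (w \in L')) /\ \rank B' = \dim L.
  by rewrite dE; exists (B L'); split=> [w|]; [exact: mem_basis_mx|rewrite rank_basis_mx].
have [|g ug gE] := @complete_unitmx _ _ _ (B L) (Q *m B').
  by rewrite mulmxA BQ mul1mx rank_basis_mx.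
rewrite mulmxA BQ mul1mx in gE.
exists g => //; apply/vspaceP => w; rewrite -memB' gE; apply/mem_image_mulmx/submxP.
  move=> [x]; rewrite -mem_basis_mx => /submxP[y ->] ->; exists y; by rewrite mulmxA.
move=> [y ->]; exists (y *m B L); last by rewrite mulmxA.
by rewrite -mem_basis_mx submxMl.
Qed.

(** The determinant is a polynomial in x with value 1 at 0. *)
Lemma finite_roots (E : M) : exists s : seq C, forall x : C,
  x \notin s -> 1%:M + x *: E \in unitmx.
Proof.
pose p : {poly C} := \det (1%:M + 'X *: map_mx polyC E).
have pE x : p.[x] = \det (1%:M + x *: E).
  rewrite -horner_evalE /p -det_map_mx; congr (\det _).
  apply/matrixP => i j; rewrite !mxE /= horner_evalE hornerD hornerM hornerX hornerC; congr (_ + _).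
  by case: (i == j); rewrite ?mulr1n ?mulr0n ?hornerC ?horner0.
have p0 : p != 0.
  apply/eqP => h; have := pE 0; rewrite h horner0 scale0r addr0 det1 => /eqP.
  by rewrite eq_sym oner_eq0.
have [s sE] := closed_field_poly_normal p; exists s => x xs.
rewrite unitmxE unitfE -pE sE hornerZ mulf_neq0 ?lead_coef_eq0 //.
by apply: contra xs; rewrite -rootE root_prod_XsubC.
Qed.

(** A path from 0 to 1 in the complex plane; the parameter mu is used to
    avoid finitely many points, which the straight segment may hit. *)
Definition detour (mu t : R) : C := (t +i* (mu * (t * (1 - t))))%C.

Lemma detour_avoids (s : seq C) : 0 \notin s -> 1 \notin s ->
  exists mu : R, forall t, 0 <= t <= 1 -> detour mu t \notin s.
Proof.
(* A point r with real part strictly between 0 and 1 is hit for a single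
   value of mu, and mu is chosen larger than all these values. *)
move=> s0 s1; pose bad (r : C) := complex.Im r / (complex.Re r * (1 - complex.Re r)).
pose mu := 1 + \sum_(r <- s) `|bad r|; exists mu => t /andP[t0 t1].
have [->|t0'] := eqVneq t 0; first by rewrite /detour mul0r mulr0.
have [->|t1'] := eqVneq t 1; first by rewrite /detour subrr mulr0 mulr0.
apply/negP => ds; have : mu <= \sum_(r <- s) `|bad r|.
  have bE : bad (detour mu t) = mu.
    by rewrite /bad /= mulfK // mulf_neq0 // subr_eq0 eq_sym.
  rewrite -{1}bE (big_rem _ ds) /= (le_trans (ler_norm _)) // lerDl.
  by apply: sumr_ge0.
by rewrite /mu gerDr ler10.
Qed.

(** For an invertible g taking L to L', move L by 1 + tau (g - 1), where tau
    runs from 0 to 1 and avoids the finitely many singular values. *)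
Lemma connecting_curve (L L' : {vspace V}) : \dim L = \dim L' ->
  exists c v, [/\ C1_curve c v, c 0 = L & c 1 = L'].
Proof.
move=> dE; have [g ug gL] := moved_transitive dE.
pose E := g - 1%:M; have [s Hs] := finite_roots E.
pose s' := [seq x <- s | (1%:M + x *: E) \notin unitmx].
have Hs' x : x \notin s' -> 1%:M + x *: E \in unitmx.
  case uE : (1%:M + x *: E \in unitmx) => // xs; rewrite -uE; apply: Hs.
  by apply: contra xs => xs; rewrite mem_filter uE.
have [mu Hmu] : exists mu : R, forall t, 0 <= t <= 1 -> detour mu t \notin s'.
  apply: detour_avoids; rewrite mem_filter negb_and negbK.
    by rewrite scale0r addr0 unitmx1.
  by rewrite scale1r /E addrC subrK ug.
pose k t := 1%:M + detour mu t *: E.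
pose dt (t : R) : C := (1 +i* (mu * (1 - 2 * t)))%C.
exists (fun t => moved L (k t)); eexists; split.
- apply: (@curve_of_matrices _ _ L k (fun t => dt t *: E)) => t t01; split.
  + by apply: Hs'; apply: Hmu.
  + move=> e e0; pose b := `|mu| * n1 E + 1; have b0 : 0 < b by rewrite ltr_wpDl // mulr_ge0 ?n1_ge0.
    exists (e / b); first by rewrite divr_gt0.
    move=> h; rewrite ltr_pdivlMr // => hb.
    have -> : k (t + h) - k t - rc h *: (dt t *: E) = rc (- (mu * (h * h))) *: ('i%C *: E).
      have ds : detour mu (t + h) = detour mu t + rc h * dt t + rc (- (mu * (h * h))) * 'i%C.
        apply/eqP; rewrite eq_complex /detour /rc /dt; simpc.
        by apply/andP; split=> //; apply/eqP; rewrite /=; ring.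
      rewrite /k ds; move: (detour mu t) (rc h) (dt t) (rc _) ('i%C : C) (E) => d x y u w B.
      by apply/matrixP => i j; rewrite !mxE; ring.
    rewrite !n1Z cmod_rc normrN !normrM cmod_i mul1r.
    apply: (@le_trans _ _ (`|h| * b * `|h|)).
      rewrite /b mulrDr mulr1 mulrDl; apply: (@le_trans _ _ (`|h| * (`|mu| * n1 E) * `|h|)).
        by rewrite le_eqVlt; apply/orP; left; apply/eqP; ring.
      by rewrite lerDl mulr_ge0.
    by rewrite ler_wpM2r // ltW.
  + move=> e e0; pose b := 2 * `|mu| * n1 E + 1.
    have b0 : 0 < b by rewrite ltr_wpDl // !mulr_ge0 ?n1_ge0.
    exists (e / b); first by rewrite divr_gt0.
    move=> h; rewrite ltr_pdivlMr // => hb.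
    have -> : dt (t + h) *: E - dt t *: E = rc (- (2 * mu * h)) *: ('i%C *: E).
      rewrite -scalerBl scalerA; congr (_ *: _); apply/eqP; rewrite eq_complex /=.
      by apply/andP; split; apply/eqP; simpc; ring.
    rewrite !n1Z cmod_rc normrN !normrM cmod_i mul1r (ger0_norm (ler0n R 2)).
    apply: le_lt_trans hb; rewrite /b mulrDr mulr1.
    have -> : 2 * `|mu| * `|h| * n1 E = `|h| * (2 * `|mu| * n1 E) by ring.
    by rewrite lerDl.
- apply/vspaceP => w; rewrite /k /detour mul0r mulr0.
  rewrite (_ : (0 +i* 0)%C = 0 :> C) // scale0r addr0.
  apply/mem_image_mulmx/idP => [[x xL ->]|wL]; first by rewrite mulmx1.
  by exists w; rewrite ?mulmx1.
- by rewrite -gL; congr moved; rewrite /k /detour subrr !mulr0 (_ : (1 +i* 0)%C = 1 :> C) // scale1r /E addrC subrK.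
Qed.
End ConnectingCurve.

(** * A comparison inequality for angles *)

Section AngleComparison.
Context {R : realType}.
Variables (phi dphi g : R -> R).
Hypothesis phi_deriv : forall t : R, 0 <= t <= 1 -> is_derive t 1 phi (dphi t).
Hypothesis g_cont : {within `[0, 1], continuous g}.
Hypothesis phi_bound : forall t : R, 0 <= t <= 1 -> -1 <= phi t <= 1.
Hypothesis dphi_bound : forall t : R, 0 <= t <= 1 ->
  `|dphi t| <= 2 * g t * Num.sqrt (1 - phi t ^+ 2).
Hypothesis g_ge0 : forall t : R, 0 <= g t.
Hypothesis phi1 : phi 1 = 1.

Let I := (\int[lebesgue_measure]_(t in `[0%R, 1%R]) g t)%R.

Lemma scaled_bound (l x : R) : 0 < l -> l < 1 -> -1 <= x <= 1 -> -1 < l * x < 1.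
Proof.
move=> l0 l1 /andP[x0 x1]; apply/andP; split.
  have : l * -1 <= l * x by rewrite ler_wpM2l // ltW.
  by move: l1; lra.
have : l * x <= l * 1 by rewrite ler_wpM2l // ltW.
by move: l1; lra.
Qed.

(** The arccosine is not differentiable at the ends of its domain, which phi
    may reach; scaling phi by l < 1 avoids them, at the price of the term
    acos l. *)
Lemma scaled_angle_comparison (l : R) : 0 < l -> l < 1 -> acos (l * phi 0) <= acos l + 2 * I.
Proof.
move=> l0 l1.
have i01 (t : R) : t \in `]0, 1[%R -> 0 <= t <= 1.
  by rewrite in_itv /= => /andP[t0 t1]; rewrite !ltW.
pose G : R -> R := (@acos R) \o (fun t => l * phi t).
pose V t : R := (\int[lebesgue_measure]_(s in `[0%R, t]) g s)%R.
have g_int : lebesgue_measure.-integrable `[0%R, 1%R] (EFin \o g).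
  by apply: continuous_compact_integrable => //; apply: segment_compact.
have dG (t : R) : 0 <= t <= 1 ->
    is_derive t 1 G (- (Num.sqrt (1 - (l * phi t) ^+ 2))^-1 * (l * dphi t)).
  move=> t01; apply: is_derive1_comp.
    by apply: is_derive1_acos; apply: scaled_bound => //; apply: phi_bound.
  have := phi_deriv t01; move=> h; have := is_deriveZ l h.
  by [].
have dV (t : R) : t \in `]0, 1[%R -> is_derive t 1 V (g t).
  move=> t01; have t01' := t01; move: t01'; rewrite in_itv /= => /andP[t0 t1].
  have gt : {for t, continuous g}.
    have : {within `]0, 1[, continuous g}.
      by apply: continuous_subspaceW g_cont; apply: subset_itv_oo_cc.
    rewrite continuous_open_subspace; last exact: interval_open.
    by apply; rewrite inE.
  have [d1 d2] := continuous_FTC1_closed t1 g_int t0 gt.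
  by apply: DeriveDef; [exact: d1|rewrite -derive1E; exact: d2].
pose F := G + (fun t => 2 * V t).
have dF (t : R) : t \in `]0, 1[%R ->
    is_derive t 1 F (- (Num.sqrt (1 - (l * phi t) ^+ 2))^-1 * (l * dphi t) + 2 * g t).
  move=> t01; apply: is_deriveD; first by apply: dG; apply: i01.
  exact: (is_deriveZ 2 (dV t t01)).
have F01 : F 0 <= F 1.
  apply: (@ger0_derive1_le_cc _ F 0 1) => //.
  - by move=> t t01; have [] := dF t t01.
  - move=> t t01; rewrite derive1E; have [_ ->] := dF t t01.
    have /andP[p0 p1] := scaled_bound l0 l1 (phi_bound (i01 t t01)).
    have pos : 0 < 1 - (l * phi t) ^+ 2.
      by move: p0 p1; move: (l * phi t) => x; nra.
    have sq0 : 0 < Num.sqrt (1 - (l * phi t) ^+ 2) by rewrite sqrtr_gt0.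
    have s1 : l * `|dphi t| <= 2 * g t * Num.sqrt (1 - (l * phi t) ^+ 2).
      apply: (@le_trans _ _ (l * (2 * g t * Num.sqrt (1 - phi t ^+ 2)))).
        by apply: (ler_wpM2l (ltW l0)); apply: dphi_bound; apply: i01.
      rewrite mulrCA ler_wpM2l ?mulr_ge0 //.
      rewrite -[l in leLHS](ger0_norm (ltW l0)) -sqrtr_sqr -sqrtrM ?sqr_ge0 // ler_sqrt; last exact: ltW.
      by rewrite mulrBr mulr1 exprMn lerD2r exprn_ile1 ?ltW.
    have s2 : l * dphi t <= 2 * g t * Num.sqrt (1 - (l * phi t) ^+ 2).
      by apply: le_trans s1; apply: (ler_wpM2l (ltW l0)); apply: ler_norm.
    rewrite mulNr addrC subr_ge0 mulrC ler_pdivrMr //.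
  - have cG : {within `[0%R, 1%R], continuous G}.
      apply: derivable_within_continuous => t; rewrite in_itv /= => t01.
      by have [] := dG t t01.
    have cV : {within `[0%R, 1%R], continuous V}.
      exact: (@parameterized_integral_continuous _ 0 1 g ler01 g_int).
    by move=> x; apply: cvgD; [exact: cG|apply: cvgM; [exact: cvg_cst|exact: cV]].
  - by rewrite in_itv /= lexx ler01.
  - by rewrite in_itv /= lexx ler01.
have V0 : V 0 = 0 by rewrite /V set_itv1 Rintegral_set1.
by move: F01; rewrite /F /G /= !fctE /= V0 phi1 mulr0 addr0 mulr1.
Qed.

(** Letting l tend to 1 in the scaled inequality, after taking cosines,
    which makes the limit elementary. With l = cos d the term acos l is d.
    *)
Lemma angle_comparison : 2 * I <= pi -> cos (2 * I) <= phi 0.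
Proof.
set A := 2 * I => Ap.
have I0 : 0 <= A by rewrite mulr_ge0 // Rintegral_ge0.
have p0 := phi_bound (_ : 0 <= (0 : R) <= 1); rewrite lexx ler01 in p0; have {}p0 := p0 isT.
have [->|Api] := eqVneq A pi; first by rewrite cospi; case/andP: p0.
have {}Ap : A < pi by rewrite lt_neqAle Api.
(* The scaled inequality for l = cos d. *)
have key (d : R) : 0 < d -> d < pi / 2 -> d + A <= pi -> cos (d + A) <= cos d * phi 0.
  move=> d0 d1 dA.
  have cd0 : 0 < cos d by apply: cos_gt0_pihalf; rewrite d1 andbT (lt_trans _ d0) // oppr_lt0 divr_gt0 ?pi_gt0.
  have d0pi : 0 <= d <= pi.
    by rewrite ltW //= (le_trans _ dA) // lerDl.
  have cd1 : cos d < 1.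
    rewrite lt_neqAle cos_le1 andbT; apply: contraTneq d0 => cd.
    have /cosK : d \in `[0, pi] by rewrite in_itv.
    by rewrite cd acos1 => <-; rewrite ltxx.
  have := scaled_angle_comparison cd0 cd1; rewrite cosK ?in_itv // -/A => h.
  have /andP[b0 b1] := scaled_bound cd0 cd1 p0.
  have bb : -1 <= cos d * phi 0 <= 1 by rewrite !ltW.
  rewrite -[leRHS]acosK ?in_itv //.
  rewrite leNgt; apply/negP => lt; move: h; rewrite leNgt => /negP; apply.
  by rewrite -ltr_cos ?in_itv /= ?acos_ge0 ?acos_lepi // addr_ge0 // ltW.
have [d1 d10 H1] := (is_derive_expand (@sin R) 0 _).1 (is_derive_sin 0) 1 ltr01.
have [d2 d20 H2] := (is_derive_expand (@cos R) 0 _).1 (is_derive_cos 0) 1 ltr01.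
pose d := Num.min (Num.min (d1 / 2) (d2 / 2)) (Num.min (2^-1) (Num.min (pi / 4) (pi - A))).
have d0 : 0 < d by rewrite !lt_min !divr_gt0 ?pi_gt0 //= invr_gt0 ltr0n subr_gt0.
rewrite -subr_le0 leNgt; apply/negP => pos; suff : cos A - phi 0 <= 0 by rewrite leNgt pos.
apply: (@le_linear_small _ _ (4 * d)) => t t0 t1.
pose x := t * d; have x0 : 0 < x by rewrite mulr_gt0.
have xd : x <= d by rewrite /x ler_piMl // ltW.
have := xd; rewrite {1}/d !le_min => /andP[/andP[xd1 xd2] /andP[x2 /andP[x4 xA]]].
have pp : 0 < pi :> R := pi_gt0 R.
have xp2 : x < pi / 2 by move: x4 pp; lra.
have xAp : x + A <= pi by move: xA; lra.
have hk := key x x0 xp2 xAp; rewrite cosD in hk.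
have xn : `|x| = x by rewrite gtr0_norm.
have : `|sin (0 + x) - sin 0 - x * cos 0| <= 1 * `|x| by apply: H1; rewrite xn; move: xd1 d10; lra.
rewrite add0r sin0 cos0 subr0 mulr1 xn mul1r ler_norml => /andP[_ s1].
have : `|cos (0 + x) - cos 0 - x * - sin 0| <= 1 * `|x| by apply: H2; rewrite xn; move: xd2 d20; lra.
rewrite add0r sin0 cos0 oppr0 mulr0 subr0 xn mul1r ler_norml => /andP[c1 _].
have sA1 : sin A <= 1 := sin_le1 A.
have sA0 : 0 <= sin A by rewrite sin_ge0_pi // I0 ltW.
have sx0 : 0 <= sin x by rewrite sin_ge0_pi // ltW //=; move: x4 pp; lra.
have s2 : sin x * sin A <= sin x by rewrite ler_piMr.
have c2 : 2^-1 <= cos x by move: c1 x2; lra.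
have s3 : 2^-1 * (cos A - phi 0) <= cos x * (cos A - phi 0) by rewrite ler_wpM2r // ltW.
have -> : 4 * d * t = 4 * x by rewrite /x; ring.
move: hk s1 s2 s3; move: (sin x * sin A) (sin x) (cos x) (cos A) (phi 0) => *; lra.
Qed.
End AngleComparison.

(** * A lower bound for the length of curves *)

Section LengthLower.
Context {R : realType} {n : nat}.
Local Notation C := (Cplx R).
Local Notation V := 'rV[C]_n.+1.
Local Notation M := 'M[C]_n.+1.
Implicit Types (A B v : M) (w : V) (L : {vspace V}).

(** Continuity of the Frobenius norm is obtained from its square, a
    polynomial in the moduli of the entries. *)
Lemma fnorm_sq_lipschitz A B :
  `|fnorm A ^+ 2 - fnorm B ^+ 2| <= n1 (A - B) * (n1 A + n1 B).
Proof.
rewrite !fnorm_entries -sumrB; apply: (le_trans (ler_norm_sum _ _ _)).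
rewrite [n1 (A - B)]/n1 mulr_suml; apply: ler_sum => i _.
rewrite -sumrB; apply: (le_trans (ler_norm_sum _ _ _)); rewrite mulr_suml; apply: ler_sum => j _.
have tri (x y : C) : cmod x <= cmod (x - y) + cmod y.
  by apply: (le_trans _ (cmodD _ _)); rewrite subrK.
rewrite subr_sqr normrM; apply: ler_pM => //.
  rewrite !mxE ler_norml lerBlDr tri andbT lerNl opprB lerBlDr.
  by rewrite -(cmodN (A i j - B i j)) opprB tri.
by rewrite ger0_norm ?addr_ge0 ?cmod_ge0 // lerD // n1_entry.
Qed.

Lemma fnorm_cvg {T : Type} (F : set_system T) {FF : Filter F} (f : T -> M) A :
  f @ F --> A -> fnorm (f t) @[t --> F] --> fnorm A.
Proof.
move=> /cvg_n1 H; apply/cvgrPdist_lt => e e0.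
pose b := 2 * n1 A + 1; have b0 : 0 < b by rewrite ltr_wpDl ?mulr_ge0 ?n1_ge0.
have de0 : 0 < Num.min 1 (e ^+ 2 / b) by rewrite lt_min ltr01 divr_gt0 ?exprn_gt0.
apply: filterS (H _ de0) => t; rewrite lt_min ltr_pdivlMr // => /andP[h1 h2].
rewrite -ltr_sqr ?nnegrE ?(ltW e0) // real_normK ?num_real //.
have ft : n1 (f t) <= n1 A + 1.
  have := n1D (f t - A) A; rewrite subrK; move: h1; clear.
  by move: (n1 (f t - A)) (n1 (f t)) (n1 A) => *; lra.
have h3 := fnorm_sq_lipschitz (f t) A; rewrite distrC in h3.
have h4 : (fnorm A - fnorm (f t)) ^+ 2 <= `|fnorm A ^+ 2 - fnorm (f t) ^+ 2|.
  rewrite subr_sqr normrM -[leLHS]ger0_norm ?sqr_ge0 // expr2 normrM ler_wpM2l //.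
  apply: (le_trans (ler_normB _ _)).
  by rewrite [leRHS]ger0_norm ?addr_ge0 ?fnorm_ge0 // !ger0_norm ?fnorm_ge0.
apply: (le_lt_trans h4); apply: (le_lt_trans h3); apply: le_lt_trans h2.
rewrite ler_wpM2l ?n1_ge0 // /b; move: ft; clear.
by move: (n1 (f t)) (n1 A) => *; lra.
Qed.

Lemma fnorm_within (A : set R) (v : R -> M) :
  {within A, continuous v} -> {within A, continuous (fun t => fnorm (v t))}.
Proof. by move=> cv x; apply: fnorm_cvg; apply: cv. Qed.

Lemma projection_speed (c : R -> {vspace V}) t v w : has_velocity c t v -> vnorm w = 1 ->
  is_derive t 1 (fun s => 2 * vnorm (w *m oproj (c s)) ^+ 2 - 1)
    (2 * complex.Re (hdot (w *m (v + v ^t*)) w)).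
Proof.
move=> hv w1; apply/is_derive_expand => e e0.
pose b := 2 * n1 w + 1; have b0 : 0 < b by rewrite ltr_wpDl ?mulr_ge0 ?n1_ge0.
have [|d d0 Hd] := oproj_velocity hv (_ : 0 < e / b); first by rewrite divr_gt0.
exists d => // h /Hd /=.
have fE U : vnorm (w *m oproj U) ^+ 2 = complex.Re (hdot (w *m oproj U) w).
  by rewrite vnorm_sqRe dot_orthoproj -mulmxA orthoproj_idem -dot_orthoproj.
rewrite !fE; set P := oproj (c t); set Q := oproj (c (t + h)); set D := v + v ^t* => hb.
have -> : 2 * complex.Re (hdot (w *m Q) w) - 1 - (2 * complex.Re (hdot (w *m P) w) - 1) -
   h * (2 * complex.Re (hdot (w *m D) w)) =
   2 * complex.Re (hdot (w *m (Q - P - rc h *: D)) w).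
  have ReB (x y : C) : complex.Re (x - y) = complex.Re x - complex.Re y by case: x; case: y.
  have Rerc (x : R) (y : C) : complex.Re (rc x * y) = x * complex.Re y.
    by case: y => y1 y2; rewrite /rc /=; simpc.
  rewrite !mulmxBr -scalemxAr !dotBl dotZl !ReB Rerc; ring.
rewrite normrM (ger0_norm (ler0n R 2)).
have s1 : `|complex.Re (hdot (w *m (Q - P - rc h *: D)) w)| <= n1 w * n1 (Q - P - rc h *: D).
  apply: (le_trans (Re_le_cmod _)); apply: (le_trans (cauchy_schwarz _ _)); rewrite w1 mulr1.
  exact: (le_trans (vnorm_le_n1 _) (n1M _ _)).
apply: (le_trans (ler_wpM2l (ler0n R 2) s1)).
apply: (@le_trans _ _ (b * (e / b * `|h|))).
  have wb : 2 * n1 w <= b by rewrite /b lerDl.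
  by rewrite (mulrA 2); apply: (ler_pM (mulr_ge0 (ler0n R 2) (n1_ge0 w)) (n1_ge0 _) wb hb).
by rewrite mulrA [b * _]mulrC divfK ?gt_eqF.
Qed.

(** With p = w P and q = w (1 - P), the derivative is 4 Re of the inner
    product of p v and q, and the square root is 2 |p| |q|. *)
Lemma projection_speed_bound L v w : hom_perp L v -> vnorm w = 1 ->
  `|2 * complex.Re (hdot (w *m (v + v ^t*)) w)| <=
  2 * fnorm v * Num.sqrt (1 - (2 * vnorm (w *m oproj L) ^+ 2 - 1) ^+ 2).
Proof.
move=> /hom_perpE[v1 v2] w1; set P := oproj L in v1 v2 *.
pose p := w *m P; pose q := w *m (1%:M - P).
have pq : vnorm p ^+ 2 + vnorm q ^+ 2 = 1.
  by rewrite -(orthoproj_pythagoras L w) w1 expr1n.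
have -> : 1 - (2 * vnorm (w *m P) ^+ 2 - 1) ^+ 2 = (2 * vnorm p * vnorm q) ^+ 2.
  rewrite -/p; move: pq; move: (vnorm p) (vnorm q) => x y xy.
  have -> : 1 - (2 * x ^+ 2 - 1) ^+ 2 = 4 * x ^+ 2 * (1 - x ^+ 2) by ring.
  have yE : y ^+ 2 = 1 - x ^+ 2 by rewrite -xy addrC addKr.
  by rewrite !exprMn yE; ring.
rewrite sqrtr_sqr [`|2 * vnorm p * _|]ger0_norm ?mulr_ge0 ?vnorm_ge0 //.
have wv : hdot (w *m v) w = hdot (p *m v) q.
  have e1 : w *m v = p *m v by rewrite /p -mulmxA v1.
  have e2 : p *m v = p *m v *m (1%:M - P) by rewrite (mulmxBr (p *m v)) mulmx1 -(mulmxA p v) v2 mulmx0 subr0.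
  rewrite e1 {1}e2 dot_adj; congr hdot.
  by rewrite adjmB adjm1 orthoproj_herm.
have -> : complex.Re (hdot (w *m (v + v ^t*)) w) = 2 * complex.Re (hdot (p *m v) q).
  rewrite mulmxDr dotDl ReD -wv [hdot (w *m v ^t*) w]dotC -dot_adj.
  by rewrite complexRe_conj mulr2n mulrDl mul1r.
rewrite !normrM (ger0_norm (ler0n R 2)).
have s1 : `|complex.Re (hdot (p *m v) q)| <= vnorm p * fnorm v * vnorm q.
  apply: (le_trans (Re_le_cmod _)); apply: (le_trans (cauchy_schwarz _ _)).
  by apply: ler_wpM2r; [exact: vnorm_ge0|exact: vnorm_mulmx].
have sh (x y z : R) : 2 * x * (2 * y * z) = 2 * (2 * (y * x * z)) by ring.
rewrite sh.
exact: (ler_wpM2l (ler0n R 2) (ler_wpM2l (ler0n R 2) s1)).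
Qed.

(** Comparison applied to phi = 2 |w P_t|^2 - 1, the cosine of twice the
    angle between w and the moving space; twice this angle is at most twice
    the length. *)
Lemma length_lower (c : R -> {vspace V}) (v : R -> M) w : C1_curve c v ->
  w \in c 1 -> vnorm w = 1 -> curve_length v <= pi / 2 ->
  vnorm (w *m (1%:M - oproj (c 0))) <= sin (curve_length v).
Proof.
move=> [hv cv] wL w1.
have lE : curve_length v = (\int[lebesgue_measure]_(t in `[(0 : R), 1]) fnorm (v t))%R.
  by rewrite /curve_length; apply: eq_Rintegral => t _; rewrite fnormE.
set l := curve_length v in lE * => l2.
have l0 : 0 <= l by rewrite lE; apply: Rintegral_ge0 => t _; apply: fnorm_ge0.
pose phi (s : R) := 2 * vnorm (w *m oproj (c s)) ^+ 2 - 1.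
have := @angle_comparison R phi (fun t => 2 * complex.Re (hdot (w *m (v t + (v t) ^t*)) w))
  (fun t => fnorm (v t)).
rewrite -lE => /(_ _ _ _ _ _ _ _)/= H.
have {H} : cos (2 * l) <= phi 0.
  apply: H.
  - by move=> t t01; apply: projection_speed w1; apply: hv.
  - exact: fnorm_within.
  - move=> t _; have := vnorm_orthoproj (c t) w; have := vnorm_ge0 (w *m oproj (c t)).
    by rewrite w1 /phi; move: (vnorm _) => x x0 x1; apply/andP; split; nra.
  - by move=> t t01; apply: projection_speed_bound w1; apply: hom_perp_velocity (hv t t01).
  - by move=> t; apply: fnorm_ge0.
  - by rewrite /phi orthoproj_id // w1 expr1n mulr1; ring.
  - by move: l2; clear; lra.
have -> : 2 * l = l *+ 2 by rewrite mulr2n; ring.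
rewrite cos_mulr2n /phi cos2sin2 => h.
have := orthoproj_pythagoras (c 0) w; rewrite w1 expr1n => pyt.
rewrite -ler_sqr ?nnegrE ?vnorm_ge0 //; last first.
  by rewrite sin_ge0_pi // l0 /=; move: l2 (pi_gt0 R); clear; lra.
move: h pyt; rewrite mulr2n; clear.
move: (vnorm _ ^+ 2) (vnorm _ ^+ 2) (sin l ^+ 2) => *; lra.
Qed.
End LengthLower.

(** * Distances to the local Schubert variety *)

Section Distances.
Local Notation transversal := Defs.transversal.
Context {R : realType} {n : nat}.
Local Notation C := (Cplx R).
Local Notation V := 'rV[C]_n.+1.
Local Notation M := 'M[C]_n.+1.
Variables (m : nat) (X : set V) (z : V) (L T : {vspace V}).
Hypothesis m_gt0 : (0 < m)%N.
Hypothesis mn : (m < n)%N.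
Hypothesis z0 : z != 0.
Hypothesis zL : z \in L.
Hypothesis dL : \dim L = (n - m).+1.
Hypothesis dT : \dim T = m.
Hypothesis HT : forall w, w \in T <-> tangent_space X z w.
Local Notation Sigma := (schubert (n - m) X z).
Local Notation P := (oproj L).

Lemma tangent_orth w : w \in T -> hdot w z = 0.
Proof. by move=> /HT/tangent_spaceE[]. Qed.

Lemma schubertE L' : Sigma L' <->
  [/\ \dim L' = (n - m).+1, z \in L' & exists w, [/\ w != 0, w \in T & w \in L']].
Proof.
split=> [[h1 h2 [w [w0 wT [wL _]]]]|[h1 h2 [w [w0 wT wL]]]]; split=> //; exists w; split=> //.
- exact/HT.
- exact/HT.
by split=> //; rewrite -hdot_dotmx; apply: tangent_orth.
Qed.

Let T0 : T != 0%VS.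
Proof. by rewrite -dimv_eq0 dT -lt0n. Qed.

Lemma hdot_unit (w : V) : hdot w w = 1 <-> vnorm w = 1.
Proof.
split=> [w1|w1]; last by rewrite dot_vnorm w1 expr1n.
by apply: eq_vnorm => //; rewrite vnorm_sqRe w1 expr1n.
Qed.

(** Polar decomposition of a vector, with a prescribed direction d for the
    zero vector. *)
Lemma polar_vector (w d : V) : vnorm d = 1 ->
  exists a, [/\ vnorm a = 1, w = rc (vnorm w) *: a & a = d \/ exists k : C, a = k *: w].
Proof.
move=> d1; have [->|w0] := eqVneq w 0.
  by exists d; split; [|rewrite vnorm0 rc0 scale0r|left].
exists (rc (vnorm w)^-1 *: w); split; first exact: unit_vector.
  by rewrite scalerA -rcM mulfV ?scale1r // gt_eqF // vnorm_gt0.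
by right; eexists.
Qed.

(** Rotate L in the plane of the components a and b of u in L and
    orthogonally to L, by the angle between u and L. The line of z is fixed
    because both components are orthogonal to z. *)
Lemma schubert_rotation (u : V) : u \in T -> vnorm u = 1 ->
  let r := vnorm (u *m (1%:M - P)) in exists L',
    [/\ Sigma L', dproj L L' <= r & dgeo L L' <= asin r].
Proof.
move=> uT u1 r.
have r0 : 0 <= r := vnorm_ge0 _; have r1 : r <= 1 by rewrite /r -u1; apply: vnorm_orthoprojC.
have r11 : -1 <= r <= 1 by rewrite r1 andbT; apply: le_trans r0; rewrite oppr_le0 ler01.
have sr : sin (asin r) = r by apply: asinK; rewrite in_itv.
have pyt := orthoproj_pythagoras L u; rewrite u1 expr1n -/r in pyt.
have cr : cos (asin r) = vnorm (u *m P).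
  rewrite cos_asin // -[vnorm _]ger0_norm ?vnorm_ge0 // -sqrtr_sqr; congr Num.sqrt.
  by rewrite pyt addrK.
have [d1 [d1u d1P d1z]] : exists d, [/\ vnorm d = 1, d *m P = d & hdot d z = 0].
  have : tlinear L z != 0%VS by rewrite -dimv_eq0 (dim_tlinear z0 zL dL) subn_eq0 -ltnNge.
  rewrite -vpick0 => v0; have vT := memv_pick (tlinear L z).
  have [vL vz] := (mem_tlinear L z _).1 vT.
  exists (((vnorm (vpick (tlinear L z)))^-1%:C)%C *: vpick (tlinear L z)); split.
  - exact: unit_vector.
  - by rewrite -scalemxAl orthoproj_id.
  - by rewrite dotZl hdot_dotmx vz mulr0.
have [d2 [d2u d2P]] : exists d, vnorm d = 1 /\ d *m P = 0.
  have [v vL] : exists v, v \notin L.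
    apply/not_existsP => h; have : (fullv <= L)%VS.
      by apply/subvP => v _; apply/negPn/negP; apply: h.
    move/dimvS; rewrite dimvf dL /dim /= mul1n; move: m_gt0 mn; lia.
  have v0 : v *m (1%:M - P) != 0.
    by rewrite mulmxBr mulmx1 subr_eq0 eq_sym -orthoprojP.
  exists (((vnorm (v *m (1%:M - P)))^-1%:C)%C *: (v *m (1%:M - P))); split; first exact: unit_vector.
  by rewrite -scalemxAl -mulmxA mulmxBl mul1mx orthoproj_idem subrr mulmx0 scaler0.
(* If u lies in L or is orthogonal to L one of the components vanishes, and
   any unit vector d1 of L orthogonal to z, or d2 orthogonal to L, takes its
   place; these exist because m < n and 0 < m. *)
have [a [a1 aE aC]] := polar_vector (u *m P) d1u.
have [b [b1 bE bC]] := polar_vector (u *m (1%:M - P)) d2u.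
have aP : a *m P = a.
  case: aC => [->//|[k ->]]; by rewrite -scalemxAl -mulmxA orthoproj_idem.
have bP : b *m P = 0.
  case: bC => [->//|[k ->]].
  by rewrite -scalemxAl -mulmxA mulmxBl mul1mx orthoproj_idem subrr mulmx0 scaler0.
have az : hdot a z = 0.
  case: aC => [->//|[k ->]].
  by rewrite dotZl dot_orthoproj orthoproj_id // tangent_orth // mulr0.
have bz : hdot z b = 0 by rewrite -(orthoproj_id zL) dot_orthoproj bP dot0r.
have aa : hdot a a = 1 by apply/hdot_unit.
have bb : hdot b b = 1 by apply/hdot_unit.
have uE : u = a *m rotm a b (asin r).
  rewrite (rot_a aP bP aa) sr cr -aE /r -bE -mulmxDr addrC subrK mulmx1 //.
have aL : a \in L by rewrite orthoprojP aP.
exists (rotL L a b (asin r)); split.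
- apply/schubertE; split; first by rewrite (dim_rotL aP bP aa bb).
    rewrite -(rot_fix (a := a) (b := b) (asin r) (dot_eq0C az) bz).
    by apply/mem_image_mulmx; exists z.
  exists u; split=> //; first by rewrite -vnorm_gt0 u1.
  by rewrite uE; apply/mem_image_mulmx; exists a.
- by rewrite -{2}sr; apply: dproj_rotL => //; rewrite sr.
have as0 : 0 <= asin r.
  have h : asin r \in `[(- (pi / 2)), pi / 2]%R by rewrite in_itv /= asin_geNpi2 ?asin_lepi2.
  rewrite leNgt; apply/negP => lt; have : sin (asin r) < 0.
    rewrite -oppr_gt0 -sinN; apply: sin_gt0_pi; rewrite oppr_gt0 lt /=.
    move: h; rewrite in_itv /= => /andP[h _]; move: h (pi_gt0 R); lra.
  by rewrite sr ltNge r0.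
have [v [cv lv]] := rotation_curve (L := L) aP bP aa bb as0.
apply: ge_inf.
  by exists 0 => _ [c [v' [_ _ _ ->]]]; apply: Rintegral_ge0 => t _; apply: sqrtr_ge0.
exists (fun t => rotL L a b (asin r * t)), v.
split; [exact: cv| |by rewrite mulr1|exact: esym lv].
rewrite mulr0; apply/vspaceP => w; rewrite (mem_rotL aP bP aa bb).
by rewrite (rotm0 a b) adjm1 mulmx1.
Qed.

(** On a vector of L' the difference of the projections is the component
    orthogonal to L. *)
Lemma gap_le_dproj L' : Sigma L' -> gap L T <= dproj L L'.
Proof.
move=> /schubertE[_ _ [w [w0 wT wL]]]; have nw : 0 < vnorm w by rewrite vnorm_gt0.
pose u := ((vnorm w)^-1%:C)%C *: w; have u1 : vnorm u = 1 := unit_vector w0.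
have uT : u \in T by apply: memvZ.
have := gap_le L uT; rewrite u1 mulr1 => h; apply: le_trans h _.
rewrite /dproj -!oprojE; have := specnorm_ge (P - oproj L') (_ : vnorm u <= 1).
rewrite u1 lexx mulmxBr [u *m oproj L']orthoproj_id ?memvZ // => /(_ isT).
by rewrite -vnormN opprB mulmxBr mulmx1.
Qed.

Lemma asin_gap_le_dgeo L' : Sigma L' -> asin (gap L T) <= dgeo L L'.
Proof.
move=> /schubertE[dL' _ [w [w0 wT wL]]].
have g0 := gap_ge0 L T0; have g1 := gap_le1 L T0.
have g11 : -1 <= gap L T <= 1 by rewrite g1 andbT; apply: le_trans g0; rewrite oppr_le0 ler01.
have [c [v [cv c0 c1]]] := connecting_curve (etrans dL (esym dL')).
apply: lb_le_inf; first by exists (curve_length v); exists c, v.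
move=> _ [{cv c0 c1}c [{}v [cv c0 c1 ->]]].
have [len|/ltW len] := leP (curve_length v) (pi / 2); last first.
  by apply: le_trans len; apply: asin_lepi2.
have l0 : 0 <= curve_length v by apply: Rintegral_ge0 => t _; apply: sqrtr_ge0.
pose u := ((vnorm w)^-1%:C)%C *: w; have u1 : vnorm u = 1 := unit_vector w0.
have uT : u \in T by apply: memvZ.
have uL : u \in c 1 by rewrite c1; apply: memvZ.
have := length_lower cv uL u1 len; rewrite c0 => h.
have gs : gap L T <= sin (curve_length v).
  by apply: le_trans h; have := gap_le L uT; rewrite u1 mulr1.
rewrite leNgt; apply/negP => lt; move: gs; rewrite leNgt => /negP; apply.
rewrite -[ltRHS](asinK (_ : gap L T \in `[-1, 1]%R)) ?in_itv //=.
rewrite ltr_sin // in_itv /= ?asin_geNpi2 ?asin_lepi2 //.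
by rewrite len andbT; apply: le_trans l0; rewrite oppr_le0 divr_ge0 ?pi_ge0.
Qed.

Lemma dist_dproj : dist_to dproj L Sigma = gap L T.
Proof.
have [_ [u0 [u0T u01] _]] := gap_nonempty L T0.
have [L0 [S0 _ _]] := schubert_rotation u0T u01.
apply/eqP; rewrite eq_le; apply/andP; split; last first.
  apply: lb_le_inf; first by exists (dproj L L0); exists L0.
  by move=> _ [L' SL' <-]; apply: gap_le_dproj.
apply/ler_addgt0Pr => e e0.
have [u [uT u1 ue]] : exists u, [/\ u \in T, vnorm u = 1 & vnorm (u *m (1%:M - P)) < gap L T + e].
  by apply: gap_lt => //; rewrite ltrDl.
have [L' [SL' d1 _]] := schubert_rotation uT u1.
apply: le_trans (ltW ue); apply: le_trans d1; apply: ge_inf; last by exists L'.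
by exists 0 => _ [L2 _ <-]; apply: specnorm_ge0.
Qed.

(** The distance d is at most the angle between u and L for each unit vector
    u of T, so sin d is a lower bound of the set defining the gap. *)
Lemma sin_dist_dgeo : sin (dist_to dgeo L Sigma) = gap L T.
Proof.
have [_ [u0 [u0T u01] _]] := gap_nonempty L T0.
have [L0 [S0 _ _]] := schubert_rotation u0T u01.
have g0 := gap_ge0 L T0; have g1 := gap_le1 L T0.
have g11 : -1 <= gap L T <= 1 by rewrite g1 andbT; apply: le_trans g0; rewrite oppr_le0 ler01.
set d := dist_to dgeo L Sigma.
have lb : has_lbound [set dgeo L L' | L' in Sigma].
  by exists (asin (gap L T)) => _ [L' SL' <-]; apply: asin_gap_le_dgeo.
have d_ge : asin (gap L T) <= d.
  apply: lb_le_inf; first by exists (dgeo L L0); exists L0.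
  by move=> _ [L' SL' <-]; apply: asin_gap_le_dgeo.
have d_le u : u \in T -> vnorm u = 1 -> d <= asin (vnorm (u *m (1%:M - P))).
  move=> uT u1; have [L' [SL' _ h]] := schubert_rotation uT u1.
  by apply: le_trans h; apply: ge_inf => //; exists L'.
have r11 u : vnorm u = 1 -> -1 <= vnorm (u *m (1%:M - P)) <= 1.
  move=> u1; rewrite -{2}u1 vnorm_orthoprojC andbT.
  by apply: le_trans (vnorm_ge0 _); rewrite oppr_le0 ler01.
have dpi : d <= pi / 2 by apply: le_trans (d_le u0 u0T u01) _; apply: asin_lepi2; apply: r11.
have dpiN : - (pi / 2) <= d by apply: le_trans d_ge; apply: asin_geNpi2.
have incr : {in `[(- (pi / 2)), pi / 2]%R &, {mono (@sin R) : x y / x <= y}}.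
  by apply: le_mono_in => x y xi yi xy; rewrite ltr_sin.
apply/eqP; rewrite eq_le; apply/andP; split.
  apply: lb_le_inf; first exact: gap_nonempty.
  move=> _ [u [uT u1] <-]; rewrite -[leRHS]asinK ?in_itv /= ?r11 //.
  by rewrite incr ?in_itv /= ?dpi ?dpiN ?asin_geNpi2 ?asin_lepi2 ?r11 // d_le.
rewrite -[leLHS]asinK ?in_itv //=.
by rewrite incr ?in_itv /= ?dpi ?dpiN ?asin_geNpi2 ?asin_lepi2.
Qed.

Lemma kappa_gap : proj_variety X -> has_chain X m -> smooth_point X z ->
  kappa X L z = (((gap L T)%:E)^-1)%E.
Proof.
move=> vX chX smX; have cX : proj_closed X by case: vX.
have Xz : X z by case: smX.
have TLE := transversal_disjoint mn z0 zL dL dT HT.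
have TL := tangent_cap_linear L HT.
have [TL0|TL0] := eqVneq (T :&: L)%VS 0%VS.
  have tr : transversal X L z by apply/TLE; rewrite TL.
  have [c [F [E [N [cm FX HE LN NL]]]]] := local_equations mn z0 zL dL dT HT cX Xz tr.
  have exg := exists_solution_map vX chX Xz zL (fun i => vanishing_ideal_of (FX i)) HE LN NL cm.
  rewrite (kappa_transversal cX smX zL HT T0 tr TL0 exg) inver gt_eqF //.
  exact: gap_gt0.
rewrite (gap_eq0 TL0) inve0 /kappa asboolF // => -[_ /TLE]; rewrite TL => h.
by rewrite h eqxx in TL0.
Qed.
End Distances.

Theorem theorem1p6 (R : realType) (n m : nat) (m_gt0 : (0 < m)%N)
    (m_lt_n : (m < n)%N) (Z : set 'rV[Cplx R]_n.+1)
    (varZ : proj_variety Z) (dimZ : proj_dim Z m)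
    (z : 'rV[Cplx R]_n.+1) (smooth_z : smooth_point Z z)
    (L : {vspace 'rV[Cplx R]_n.+1}) (dimL : \dim L = (n - m).+1)
    (z_in_L : z \in L) :
  dist_to dproj L (schubert (n - m) Z z) =
    sin (dist_to dgeo L (schubert (n - m) Z z)) /\
  kappa Z L z =
    (((sin (dist_to dgeo L (schubert (n - m) Z z)))%:E)^-1)%E.
Proof.
have [Zz [k [T [dimk dT HT]]]] := smooth_z.
have z0 : z != 0 by apply: proj_closed_neq0 Zz; case: varZ.
rewrite (proj_dim_uniq dimk dimZ) in dT.
rewrite (sin_dist_dgeo m_gt0 m_lt_n z0 z_in_L dimL dT HT).
rewrite (dist_dproj m_gt0 m_lt_n z0 z_in_L dimL dT HT); split=> //.
by apply: (kappa_gap m_gt0 m_lt_n z0 z_in_L dimL dT HT) => //; case: dimZ.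
Qed.
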